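(* Let $0<a_+<a_-$ and let $\rho:[0,1]\to[0,\infty)$ be measurable with $\int_0^1 s^{-\epsilon_0}\rho(s)\,ds<\infty$ for some $\epsilon_0>0$ and $$a_+<-\int_0^1\log(s)\,\rho(s)\,ds<a_-.$$ With $Y$, $\beta_+$ and $\langle m,\mathbf{1}\rangle$ as in the context and $c_1=1/\langle m,\mathbf{1}\rangle$, the invariant distribution $\nu(dx)$ of $(Y_t)_{t\ge0}$ has on $(1,\infty)$ a density given by $$\nu(x)=\frac{c_1}{a_+}\,x^{-(1+\beta_+)}.$$
   Context: $Y=e^\eta$ is the Markov process on $(0,\infty)$ with generator $\mathcal{G}_Yg(x)=c(x)g'(x)+\int_0^1(g(sx)-g(x))\rho(s)\,ds$, where $c(x)=a_-x$ for $x<1$ and $c(x)=a_+x$ for $x\ge1$. That is, $\eta$ has drift $a_+$ while $\eta\ge0$, drift $a_-$ while $\eta<0$, and negative jumps given by a compound Poisson process with Lévy measure $e^z\rho(e^z)dz$ on $(-\infty,0)$. Under the stated inequalities $Y$ is positive recurrent and has a unique invariant probability distribution $\nu$ (this $\nu$ is the asymptotic profile of the growth-fragmentation semigroup). $\langle m,\mathbf{1}\rangle$ is the total mass of the invariant measure $m$ of $Y$ with density $m(x)=\frac{q(1,x)}{c(x)q(x,1)}$ ($x\neq 1$), where $q(z,x)=\tilde{\mathbb{P}}_z(H_Y(x)<H_Y(z))$, $\tilde{\mathbb{P}}_z$ is the law of $Y$ started from $z$, and $H_Y(x)=\inf\{t>0:Y_t=x\}$; explicitly $$\langle m,\mathbf{1}\rangle=\frac{a_--a_+}{a_+}\,\frac{1}{\Psi_-'(-1)}\,\frac{1}{\Phi_+(\Psi_+(-1))+1},$$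 where $\Psi_\pm(q)=a_\pm q+\int_0^1(s^q-1)s\rho(s)\,ds$ and $\Phi_+(p)$ is the largest $q$ with $\Psi_+(q)=p$. $\tilde\Psi_+(q)=a_+q+\int_0^1(s^q-1)\rho(s)\,ds$, and $\beta_+>0$ is the largest root of $\tilde\Psi_+$. *)

(* Defs.v *)
From HB Require Import structures.
From mathcomp Require Import all_boot all_order all_algebra.
From mathcomp Require Import all_classical all_reals all_analysis.
Import Order.TTheory GRing.Theory Num.Theory numFieldNormedType.Exports.

Set Implicit Arguments.
Unset Strict Implicit.
Unset Printing Implicit Defensive.

Local Open Scope classical_set_scope.
Local Open Scope ring_scope.

Section laplace_exponents.
Context {R : realType}.
Variables (a : R) (rho : R -> R).

Definition Psi (q : R) : R :=
  a * q + \int[lebesgue_measure]_(s in `[0, 1]) ((s `^ q - 1) * s * rho s).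

(* "Largest solution" is rendered by the supremum of the solution set, which is
   attained at the points where Phi and beta are used. *)
Definition Phi (p : R) : R := sup [set q | Psi q = p].

Definition tildePsi (q : R) : R :=
  a * q + \int[lebesgue_measure]_(s in `[0, 1]) ((s `^ q - 1) * rho s).

Definition beta : R := sup [set q | tildePsi q = 0].

End laplace_exponents.

(* The process Y = exp eta is obtained from waiting times E n and jump factors
   S n: between jumps ln Y = eta moves with slope am or ap, and at the n-th
   jump Y is multiplied by S n. A factor with law proportional to rho(s) ds is
   the same as a jump ln s of eta with Levy measure e^z rho(e^z) dz on z < 0. *)
Section process.
Context {R : realType}.
Variables (am ap : R) (rho : R -> R).

Definition jump_rate : R := \int[lebesgue_measure]_(s in `[0, 1]) rho s.

Definition slope (y : R) : R := if 0 <= y then ap else am.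

Definition drift (x : R) : R := if x < 1 then am * x else ap * x.

Context {d : measure_display} {T : measurableType d} (P : probability T R).

(* The time of the n-th jump; it is 0 for n = 0. *)
Definition jump_time (E : nat -> {RV P >-> R}) (n : nat) (w : T) : R :=
  \sum_(i < n) E i w.

(* Positivity, non-explosion and the range of the factors are required for
   every w, as usual for a compound Poisson process with regular paths. *)
Record compound_poisson (E S : nat -> {RV P >-> R}) : Prop := {
  waiting_time_gt0 : forall n w, 0 < E n w ;
  jump_time_unbounded : forall w, jump_time E n w @[n --> \oo] --> +oo ;
  jump_factor_itv : forall n w, 0 < S n w < 1 ;
  waiting_time_law : forall n A, measurable A ->
    distribution P (E n) A = exponential_prob jump_rate A ;
  jump_factor_law : forall n A, measurable A ->
    distribution P (S n) A =
    ((jump_rate^-1)%:E *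
     \int[lebesgue_measure]_(s in A `&` `[0%R, 1%R]) (rho s)%:E)%E ;
  jump_independence : forall n (A B : nat -> set R),
    (forall i, measurable (A i)) -> (forall i, measurable (B i)) ->
    P (\bigcap_(i in `I_n) ((E i @^-1` A i) `&` (S i @^-1` B i))) =
    (\prod_(i < n) (P (E i @^-1` A i) * P (S i @^-1` B i)))%E }.

(* eta z is the process started from ln z, i.e., exp (eta z) starts from z. *)
Record refracted (E S : nat -> {RV P >-> R}) (eta : R -> R -> T -> R) : Prop :=
{ refracted_path : forall z w, 0 < z ->
    measurable_fun (`[0, +oo[ : set R) (fun t => eta z t w) ;
  refracted_eq : forall z w n t, 0 < z ->
    jump_time E n w <= t < jump_time E n.+1 w ->
    eta z t w = ln z
      + (\int[lebesgue_measure]_(s in `[0, t]) slope (eta z s w))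
      + \sum_(i < n) ln (S i w) }.

Variable eta : R -> R -> T -> R.

Definition Y (z t : R) (w : T) : R := expR (eta z t w).

Definition invariant_law (nu : probability (measurableTypeR R) R) : Prop :=
  nu [set` `]0, +oo[] = 1%E /\
  forall t A, 0 <= t -> measurable A ->
    (\int[nu]_(z in `]0%R, +oo[) P (Y z t @^-1` A))%E = nu A.

(* H_Y(x) for the process started from z. *)
Definition hitting_time (z x : R) (w : T) : \bar R :=
  ereal_inf [set t%:E | t in [set t | 0 < t /\ Y z t w = x]].

Definition hit_prob (z x : R) : R :=
  fine (P [set w | (hitting_time z x w < hitting_time z z w)%E]).

Definition m_density (x : R) : R := hit_prob 1 x / (drift x * hit_prob x 1).

Definition m_mass : \bar R :=
  (\int[lebesgue_measure]_(x in `]0%R, +oo[) (m_density x)%:E)%E.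

End process.

(* Main.v *)
Require Import Defs.
From HB Require Import structures.
From mathcomp Require Import all_boot all_order all_algebra.
From mathcomp Require Import all_classical all_reals all_analysis.
From mathcomp Require Import measurable_realfun.
From mathcomp Require Import ring lra.
Import Order.TTheory GRing.Theory Num.Theory numFieldNormedType.Exports.

Set Implicit Arguments.
Unset Strict Implicit.
Unset Printing Implicit Defensive.

Local Open Scope classical_set_scope.
Local Open Scope ring_scope.

(* [b%:R] would parse [b] in [nat_scope]. *)
Local Notation ind b := ((nat_of_bool b%R)%:R).

(** Everything is done for the logarithm [eta], with [mu] the image of [nu] under [ln]. Invariance
    over a short time t, divided by t, gives the stationary generator identity: the mean growth rate
    of f along the drift equals [lam * gap f], where [gap f] is the mean loss of f at a jump
    ([flow_increment_cvg], [balance], [gap_limit]). The theorem comes from a few choices of f. Write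
    kappa for the integral of -ln(s) rho(s), and F for the tail of [mu].

    The identity shows that the mean slope is kappa, hence F(0) = (am - kappa) / (am - ap)
    ([mean_slope], [mean_positive]). The time coordinate [tau] of the drift gives
    [lam * gap tau = 1] ([gap_tau]). The indicator of [l, oo) shows that the drift crosses l upwards
    at the same rate [flux l] at which jumps cross it downwards ([flux_cvg]).

    The function exp(beta x) on [0, u], with beta a root of [tildePsi], cancels in the interior and
    leaves the boundary terms: exp(beta u) Z(u) = Z(0) ([Z_scale]). Moreover Z(u) is an average of
    F(u) - F(u + o) over positive overshoots o whose law does not depend on u ([ZE]). Hence exp(beta
    h) F(u + h) - F(u) averages its own values further to the right; it vanishes at infinity, so it
    is 0 by a maximum principle, and F(h) = exp(-beta h) F(0) ([upper_exp]). This is the power law,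
    and it also yields flux(0) = ap beta F(0) ([flux0]).

    Last, let Q(x) be the probability of hitting b before a from x. It is harmonic away from a and b
    and jumps by Q(a) at a and by -(1 - Q(b)) at b, so flux(a) Q(a) = flux(b) (1 - Q(b))
    ([flux_balance]). The ratio of hitting probabilities in [m_density] is therefore flux(ln x) /
    flux(0) ([flux_symmetry], [m_density_flux]), and Tonelli with the identity for [tau] gives total
    mass 1 / flux(0) ([mass_flux]). Thus c1 / ap = beta F(0), the constant in front of the power.
    The closed form of the mass follows from Phi(Psi(-1)) + 1 = beta for slope ap ([Phi_beta]) and
    Psi'(-1) = am - kappa for slope am ([derive1_Psi]). *)

(** * Expectations of bounded measurable functions *)

Section expectation.
Context {R : realType}.

Definition Ex d (T : measurableType d) (M : probability T R) (f : T -> R) : R :=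
  \int[M]_x f x.

(** This class is integrable against every probability and closed under the operations used, so on
    it [Ex] never takes the default value of a divergent integral. The few unbounded integrands are
    handled separately by dominated convergence or Tonelli. *)
Definition bmf d (T : measurableType d) (f : T -> R) :=
  measurable_fun setT f /\ exists C, forall x, `|f x| <= C.

Section bounded.
Context d (T : measurableType d) (M : probability T R).
Implicit Types f g : T -> R.

Lemma bmf_integrable f : bmf f -> M.-integrable setT (EFin \o f).
Proof.
move=> [mf [C fC]]; apply: measurable_bounded_integrable => //.
  by rewrite -ge0_fin_numE// fin_num_measure.
by exists C; split; [exact: num_real|move=> x Cx y _ /=; rewrite (le_trans (fC y))// ltW].
Qed.

Lemma bmf_cst (c : R) : bmf (fun _ : T => c).
Proof. by split; [exact: measurable_cst|exists `|c|]. Qed.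

Lemma bmfD f g : bmf f -> bmf g -> bmf (fun x => f x + g x).
Proof.
move=> [mf [C fC]] [mg [D gD]]; split; first exact: measurable_funD.
by exists (C + D) => x; rewrite (le_trans (ler_normD _ _))// lerD.
Qed.

Lemma bmfN f : bmf f -> bmf (fun x => - f x).
Proof.
move=> [mf [C fC]]; split; first exact: measurableT_comp.
by exists C => x; rewrite normrN.
Qed.

Lemma bmfB f g : bmf f -> bmf g -> bmf (fun x => f x - g x).
Proof. by move=> ? ?; apply: bmfD => //; exact: bmfN. Qed.

Lemma bmfM f g : bmf f -> bmf g -> bmf (fun x => f x * g x).
Proof.
move=> [mf [C fC]] [mg [D gD]]; split; first exact: measurable_funM.
by exists (C * D) => x; rewrite normrM ler_pM.
Qed.

Lemma bmfZ (c : R) f : bmf f -> bmf (fun x => c * f x).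
Proof. by move=> ?; apply: bmfM => //; exact: bmf_cst. Qed.

Lemma bmf_norm f : bmf f -> bmf (fun x => `|f x|).
Proof.
move=> [mf [C fC]]; split; first exact: measurableT_comp.
by exists C => x; rewrite normr_id.
Qed.

Lemma bmf_bool (b : T -> bool) : measurable_fun setT b ->
  bmf (fun x => (b x)%:R).
Proof.
move=> mb; split; last by exists 1 => x; case: (b x); rewrite ?normr1 ?normr0.
rewrite (_ : (fun x => _) = (fun x => if b x then 1 else 0)); last first.
  by apply/funext => x; case: (b x).
by apply: measurable_fun_ifT => //; exact: measurable_cst.
Qed.

Lemma measurable_ind (b : T -> bool) : measurable_fun setT b ->
  measurable_fun setT (fun x => (b x)%:R : R).
Proof. by move=> /bmf_bool []. Qed.

Lemma Ex_ext f g : f =1 g -> Ex M f = Ex M g.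
Proof. by move=> fg; congr Ex; apply/funext. Qed.

Lemma ExD f g : bmf f -> bmf g -> Ex M (fun x => f x + g x) = Ex M f + Ex M g.
Proof. by move=> ? ?; apply: RintegralD => //; exact: bmf_integrable. Qed.

Lemma ExB f g : bmf f -> bmf g -> Ex M (fun x => f x - g x) = Ex M f - Ex M g.
Proof. by move=> ? ?; apply: RintegralB => //; exact: bmf_integrable. Qed.

Lemma ExZ (c : R) f : bmf f -> Ex M (fun x => c * f x) = c * Ex M f.
Proof. by move=> ?; apply: RintegralZl => //; exact: bmf_integrable. Qed.

Lemma Ex_cst (c : R) : Ex M (fun _ => c) = c.
Proof. by rewrite /Ex Rintegral_cst// [X in fine X]probability_setT mulr1. Qed.

Lemma Ex_ge0 f : (forall x, 0 <= f x) -> 0 <= Ex M f.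
Proof. by move=> f0; exact: Rintegral_ge0. Qed.

Lemma Ex_le f g : bmf f -> bmf g -> (forall x, f x <= g x) -> Ex M f <= Ex M g.
Proof. by move=> ? ? fg; apply: le_Rintegral => //; exact: bmf_integrable. Qed.

Lemma Ex_le_cst f (c : R) : bmf f -> (forall x, f x <= c) -> Ex M f <= c.
Proof. by move=> bf fc; rewrite -[leRHS]Ex_cst; apply: Ex_le => //; exact: bmf_cst. Qed.

Lemma Ex_norm f : bmf f -> `|Ex M f| <= Ex M (fun x => `|f x|).
Proof. by move=> ?; apply: le_normr_Rintegral => //; exact: bmf_integrable. Qed.

Lemma Ex_normB f g h : bmf f -> bmf g -> bmf h ->
  (forall x, `|f x - g x| <= h x) -> `|Ex M f - Ex M g| <= Ex M h.
Proof.
move=> bf bg bh fgh; rewrite -ExB//; apply: le_trans (Ex_norm _) _.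
  exact: bmfB.
by apply: Ex_le => //; apply/bmf_norm/bmfB.
Qed.

Lemma ExE f : bmf f -> (Ex M f)%:E = (\int[M]_x (f x)%:E)%E.
Proof.
move=> bf; rewrite fineK//; apply: integrable_fin_num => //.
exact: bmf_integrable.
Qed.

Lemma prob_Ex (b : T -> bool) : measurable_fun setT b ->
  M [set x | b x] = (Ex M (fun x => (b x)%:R))%:E.
Proof.
move=> mb; rewrite ExE; last exact: bmf_bool.
rewrite -[LHS]mul1e -integral_cst; last first.
  by rewrite -[X in measurable X]setTI; exact: mb.
rewrite integral_mkcond; apply: eq_integral => x _.
rewrite patchE (_ : (x \in _) = b x); first by case: (b x).
by apply/idP/idP; rewrite inE.
Qed.

(** Measurability and boundedness of the limit are conclusions: this is how hitting probabilities,
    known only as limits, become admissible test functions. *)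
Lemma Ex_dct (f_ : nat -> T -> R) f (C : R) :
  (forall n, measurable_fun setT (f_ n)) -> (forall n x, `|f_ n x| <= C) ->
  (forall x, f_ n x @[n --> \oo] --> f x) ->
  bmf f /\ (Ex M (f_ n) @[n --> \oo] --> Ex M f).
Proof.
move=> mf_ fC ff.
have mf : measurable_fun setT f.
  by apply: (measurable_fun_cvg mf_) => // x _; exact: ff.
have bf : bmf f.
  split => //; exists C => x.
  have /cvg_norm fx := ff x; rewrite -(cvg_lim _ fx)//.
  apply: limr_le; first by apply/cvg_ex; exists `|f x|.
  by apply: nearW => n; exact: fC.
split=> //; rewrite /Ex /Rintegral.
apply: fine_cvg; rewrite -/(Rintegral _ _ _) -/(Ex _ _) ExE//.
have [|||||_ _ //] := @dominated_convergence _ _ _ M setT measurableT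
  (fun n => EFin \o f_ n) (EFin \o f) (cst C%:E).
- by move=> n; exact/measurable_EFinP.
- exact/measurable_EFinP.
- by apply: aeW => x _; apply: cvg_EFin; [exact: nearW|exact: ff].
- exact: finite_measure_integrable_cst.
- by apply: aeW => x n _; rewrite /= lee_fin.
Qed.

Lemma bmf_comp d' (T' : measurableType d') (f : T' -> R) (g : T -> T') :
  bmf f -> measurable_fun setT g -> bmf (fun x => f (g x)).
Proof.
move=> [mf [C fC]] mg; split; first exact: measurableT_comp.
by exists C.
Qed.

End bounded.

Section fubini.
Context d1 d2 (T1 : measurableType d1) (T2 : measurableType d2).
Variables (M1 : probability T1 R) (M2 : probability T2 R).

Lemma bmf_pair1 (f : T1 * T2 -> R) x : bmf f -> bmf (fun y => f (x, y)).
Proof. by move=> bf; apply: (bmf_comp bf); exact: pair1_measurable. Qed.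

Lemma bmf_pair2 (f : T1 * T2 -> R) y : bmf f -> bmf (fun x => f (x, y)).
Proof. by move=> bf; apply: (bmf_comp bf); exact: pair2_measurable. Qed.

Lemma bmf_Ex2 (f : T1 * T2 -> R) : bmf f ->
  bmf (fun x => Ex M2 (fun y => f (x, y))).
Proof.
move=> bf; split; last first.
  have [_ [C fC]] := bf; exists C => x.
  apply: le_trans (Ex_norm _ _) _; first exact: bmf_pair1.
  by apply: Ex_le_cst => //; apply/bmf_norm/bmf_pair1.
apply/measurable_EFinP.
rewrite (_ : _ \o _ = fubini_F M2 (EFin \o f)); last first.
  by apply/funext => x /=; rewrite ExE//; exact: bmf_pair1.
(* Measurability in the first variable does not depend on a measure there; a Dirac mass fills the
   slot. *)
apply: (@measurable_fubini_F _ _ _ _ _ (dirac point)).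
exact: (bmf_integrable (dirac point \x M2)%E).
Qed.

Lemma bmf_Ex1 (f : T1 * T2 -> R) : bmf f ->
  bmf (fun y => Ex M1 (fun x => f (x, y))).
Proof.
move=> bf; split; last first.
  have [_ [C fC]] := bf; exists C => x.
  apply: le_trans (Ex_norm _ _) _; first exact: bmf_pair2.
  by apply: Ex_le_cst => //; apply/bmf_norm/bmf_pair2.
apply/measurable_EFinP.
rewrite (_ : _ \o _ = fubini_G M1 (EFin \o f)); last first.
  by apply/funext => x /=; rewrite ExE//; exact: bmf_pair2.
apply: (@measurable_fubini_G _ _ _ _ _ _ (dirac point)).
exact: (bmf_integrable (M1 \x dirac point)%E).
Qed.

Lemma Ex_fubini1 (f : T1 * T2 -> R) : bmf f ->
  Ex (M1 \x M2)%E f = Ex M1 (fun x => Ex M2 (fun y => f (x, y))).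
Proof.
move=> bf; apply: EFin_inj; rewrite ExE// -integral12_prod_meas1; last first.
  exact: bmf_integrable.
rewrite ExE; last exact: bmf_Ex2.
by apply: eq_integral => x _; rewrite ExE//; exact: bmf_pair1.
Qed.

Lemma Ex_fubini2 (f : T1 * T2 -> R) : bmf f ->
  Ex (M1 \x M2)%E f = Ex M2 (fun y => Ex M1 (fun x => f (x, y))).
Proof.
move=> bf; apply: EFin_inj; rewrite ExE// -integral21_prod_meas1; last first.
  exact: bmf_integrable.
rewrite ExE; last exact: bmf_Ex1.
by apply: eq_integral => x _; rewrite ExE//; exact: bmf_pair2.
Qed.

End fubini.

Lemma Ex_pushforward d1 d2 (T1 : measurableType d1) (T2 : measurableType d2)
    (M1 : probability T1 R) (M2 : probability T2 R) (phi : T1 -> T2) f :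
  measurable_fun setT phi ->
  (forall A, measurable A -> M2 A = M1 (phi @^-1` A)) ->
  bmf f -> Ex M2 f = Ex M1 (fun x => f (phi x)).
Proof.
move=> mphi M12 bf; rewrite /Ex /Rintegral.
rewrite (eq_measure_integral (pushforward M1 phi)); last first.
  by move=> A mA _; exact: M12.
rewrite integral_pushforward//=.
  by apply/measurable_EFinP; case: bf.
by apply: bmf_integrable; exact: bmf_comp.
Qed.

End expectation.

(** * The deterministic motion between jumps *)

Section flow.
Context {R : realType}.
Variables (am ap : R).
Hypotheses (ap_gt0 : 0 < ap) (ap_lt_am : ap < am).

Let am_gt0 : 0 < am. Proof. exact: lt_trans ap_lt_am. Qed.

(** [tau] is the time coordinate of the drift: it grows at unit speed along the motion, and [sigma]
    is its inverse because both preserve the sign. So [flow] is a translation conjugated by [sigma],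
    and its semigroup law is that of addition. *)
Definition sigma (u : R) : R := slope am ap u * u.
Definition tau (x : R) : R := x / slope am ap x.
Definition flow (t x : R) : R := sigma (tau x + t).

Lemma slope_gt0 y : 0 < slope am ap y.
Proof. by rewrite /slope; case: ifP. Qed.

Lemma slope_bounds y : ap <= slope am ap y <= am.
Proof. by rewrite /slope; case: ifP; rewrite lexx ?(ltW ap_lt_am). Qed.

Lemma sigma_ge0 u : (0 <= sigma u) = (0 <= u).
Proof. by rewrite /sigma pmulr_rge0// slope_gt0. Qed.

Lemma tau_ge0 x : (0 <= tau x) = (0 <= x).
Proof. by rewrite /tau pmulr_lge0// invr_gt0 slope_gt0. Qed.

Lemma sigmaK u : tau (sigma u) = u.
Proof.
rewrite /tau (_ : slope am ap (sigma u) = slope am ap u); last first.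
  by rewrite {1}/slope sigma_ge0.
by rewrite /sigma mulrC mulKf// gt_eqF// slope_gt0.
Qed.

Lemma tauK x : sigma (tau x) = x.
Proof.
rewrite /sigma (_ : slope am ap (tau x) = slope am ap x); last first.
  by rewrite {1}/slope tau_ge0.
by rewrite /tau mulrC divfK// gt_eqF// slope_gt0.
Qed.

Lemma sigma_bounds u v : u <= v ->
  ap * (v - u) <= sigma v - sigma u <= am * (v - u).
Proof.
move=> uv; have d_ge0 : 0 <= am - ap by rewrite subr_ge0 ltW.
have H : 0 <= (am - ap) * (v - u) by rewrite mulr_ge0// subr_ge0.
rewrite /sigma /slope; have [u0|u0] := lerP 0 u; have [v0|v0] := lerP 0 v.
- lra.
- by move: (le_lt_trans u0 (le_lt_trans uv v0)); rewrite ltxx.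
- have Hu : 0 <= (am - ap) * - u by rewrite mulr_ge0// oppr_ge0 ltW.
  have Hv : 0 <= (am - ap) * v by rewrite mulr_ge0.
  lra.
- lra.
Qed.

Lemma sigma_mono : {mono sigma : u v / u <= v}.
Proof.
apply: le_mono => u v uv; have /andP[+ _] := sigma_bounds (ltW uv).
have : 0 < ap * (v - u) by rewrite mulr_gt0// subr_gt0.
lra.
Qed.

Lemma tau_mono : {mono tau : u v / u <= v}.
Proof. by move=> x y; rewrite -[in RHS](tauK x) -[in RHS](tauK y) sigma_mono. Qed.

Lemma tau_mono_lt : {mono tau : u v / u < v}.
Proof. exact: leW_mono tau_mono. Qed.

Lemma tau_bound x y : x <= y -> ap * (tau y - tau x) <= y - x.
Proof.
by rewrite -tau_mono => /sigma_bounds; rewrite !tauK => /andP[].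
Qed.

Lemma flowD s t x : flow (s + t) x = flow t (flow s x).
Proof. by rewrite /flow sigmaK addrA. Qed.

Lemma tau_flow t x : tau (flow t x) = tau x + t.
Proof. by rewrite /flow sigmaK. Qed.

Lemma flow_tau x y : flow (tau y - tau x) x = y.
Proof. by rewrite /flow addrC subrK tauK. Qed.

Lemma flow_bounds t x : 0 <= t -> x + ap * t <= flow t x <= x + am * t.
Proof.
move=> t0; have := @sigma_bounds (tau x) (tau x + t); rewrite tauK lerDl => /(_ t0).
rewrite addrC addKr -/(flow t x); lra.
Qed.

Lemma flow_ge t x : 0 <= t -> x <= flow t x.
Proof.
move=> t0; have /andP[+ _] := flow_bounds x t0; apply: le_trans.
by rewrite lerDl mulr_ge0// ltW.
Qed.

Lemma flow_gt t x : 0 < t -> x < flow t x.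
Proof.
move=> t0; have /andP[+ _] := flow_bounds x (ltW t0); apply: lt_le_trans.
by rewrite ltrDl mulr_gt0.
Qed.

Lemma le_flow s t x : s <= t -> flow s x <= flow t x.
Proof. by move=> st; rewrite sigma_mono lerD2l. Qed.

Lemma lt_flowE l t x : (l < flow t x) = (tau l < tau x + t).
Proof. by rewrite -tau_mono_lt tau_flow. Qed.

Lemma flow_nneg t x : 0 <= x -> 0 <= t -> flow t x = x + ap * t.
Proof.
move=> x0 t0; rewrite /flow /sigma /slope addr_ge0 ?tau_ge0//.
by rewrite /tau /slope x0; field; rewrite gt_eqF.
Qed.

Lemma flow_neg t x : x < 0 -> x + am * t < 0 -> flow t x = x + am * t.
Proof.
move=> x0 t0; have tauE : tau x = x / am by rewrite /tau /slope leNgt x0.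
rewrite /flow /sigma /slope ifF.
  by rewrite tauE; field; rewrite gt_eqF.
apply/negbTE; rewrite -ltNge tauE -(pmulr_llt0 _ am_gt0) mulrDl divfK ?gt_eqF//.
by rewrite (mulrC t).
Qed.

Lemma measurable_slope D : measurable_fun D (slope am ap).
Proof.
apply: measurable_funTS; apply: measurable_fun_ifT => //.
by apply: measurable_fun_ler => //; exact: measurable_cst.
Qed.

Lemma measurable_sigma : measurable_fun setT sigma.
Proof. by apply: measurable_funM => //; exact: measurable_slope. Qed.

Lemma measurable_tau : measurable_fun setT tau.
Proof.
rewrite (_ : tau = fun x => if 0 <= x then x / ap else x / am); last first.
  by apply/funext => x; rewrite /tau /slope; case: ifP.
apply: measurable_fun_ifT.
- by apply: measurable_fun_ler => //; exact: measurable_cst.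
- by apply: measurable_funM => //; exact: measurable_cst.
- by apply: measurable_funM => //; exact: measurable_cst.
Qed.

Lemma measurable_flow d (T : measurableType d) (f g : T -> R) :
  measurable_fun setT f -> measurable_fun setT g ->
  measurable_fun setT (fun w => flow (f w) (g w)).
Proof.
move=> mf mg; apply: (measurableT_comp measurable_sigma).
by apply: measurable_funD => //; exact: (measurableT_comp measurable_tau).
Qed.

Section path.
Notation leb := (@lebesgue_measure R).
Variable h : R -> R.
Hypothesis mh : measurable_fun (`[0, +oo[ : set R) h.
Hypothesis hb : forall s, ap <= h s <= am.

Lemma integrable_between a b : 0 <= a -> leb.-integrable `[a, b] (EFin \o h).
Proof.
move=> a0; apply: measurable_bounded_integrable => //.
- by rewrite [ltLHS]lebesgue_measure_itv/=; case: ifP => _; rewrite ?ltry.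
- apply: measurable_funS mh => //.
  by move=> x/=; rewrite !in_itv/= => /andP[ax _]; rewrite (le_trans a0).
- exists am; split; [exact: num_real|move=> C amC x _ /=].
  by have := hb x; have := ap_gt0; rewrite ler_norml => ? /andP[? ?]; lra.
Qed.

Let integrable_h a b : 0 <= a -> leb.-integrable `]a, b] (EFin \o h).
Proof.
move=> a0; apply: integrableS (integrable_between b a0) => //.
by move=> x/=; rewrite !in_itv/= => /andP[/ltW -> ->].
Qed.

Let int_chop a b c : 0 <= a -> a <= b -> b <= c ->
  \int[leb]_(s in `]a, c]) h s =
  \int[leb]_(s in `]a, b]) h s + \int[leb]_(s in `]b, c]) h s.
Proof.
move=> a0 ab bc; rewrite -[X in _ + X](@Rintegral_itvB _ h (BRight a) (BRight c) b) ?bnd_simp//.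
  by rewrite addrC subrK.
exact: integrable_h.
Qed.

Let length a b : a <= b -> fine (leb `]a, b]) = b - a.
Proof.
move=> ab; rewrite [X in fine X]lebesgue_measure_itv/=; case: ifPn => //.
rewrite lte_fin -leNgt => ba.
by rewrite (le_anti (introT andP (conj ab ba))) subrr.
Qed.

Let int_cst a b c : 0 <= a -> a <= b -> (forall s, a < s < b -> h s = c) ->
  \int[leb]_(s in `]a, b]) h s = c * (b - a).
Proof.
move=> a0 ab hc; rewrite -(length ab) -Rintegral_cst//; congr fine.
apply: eq_integral_itv_bounded => //.
  apply: measurable_funS mh => //.
  by move=> x/=; rewrite !in_itv/= => /andP[/ltW ax _]; rewrite (le_trans a0).

Qed.

Let int_ge0 a b : 0 <= \int[leb]_(s in `]a, b]) h s.
Proof.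
apply: Rintegral_ge0 => x _; have /andP[+ _] := hb x.
by apply: le_trans; exact: ltW.
Qed.

Let int_le a b : 0 <= a -> a <= b ->
  \int[leb]_(s in `]a, b]) h s <= am * (b - a).
Proof.
move=> a0 ab; rewrite -(length ab) -!Rintegral_cst//; apply: le_Rintegral => //.
- exact: integrable_h.
- apply/integrableP; split; first exact: measurable_cst.
  rewrite integral_cst// lte_mul_pinfty//.
  by rewrite [ltLHS]lebesgue_measure_itv/=; case: ifP => _; rewrite ?ltry.
- by move=> x _; case/andP: (hb x).
Qed.

(** The slope is discontinuous at 0, so uniqueness is checked by hand: the path has speed at least
    ap > 0, hence crosses 0 at most once, with slope am before and ap after. Slopes are needed only
    on open intervals, which is why the end t = J' is allowed. *)
Lemma flow_of_integral (J J' X : R) (g : R -> R) : 0 <= J ->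
  (forall s, 0 <= s -> h s = slope am ap (g s)) ->
  (forall s, J <= s < J' -> g s = X + \int[leb]_(r in `]J, s]) h r) ->
  forall t, J <= t <= J' -> X + \int[leb]_(r in `]J, t]) h r = flow (t - J) X.
Proof.
move=> J0 hg gE t /andP[Jt tJ'].
have ge (s0 s : R) : J <= s0 -> s0 <= s -> s < J' ->
    g s = g s0 + \int[leb]_(r in `]s0, s]) h r.
  move=> Js0 s0s sJ'; rewrite !gE ?Js0 ?(le_lt_trans s0s)//= ?(le_trans Js0)//.
  by rewrite (@int_chop J s0 s)// addrA.
have [X0|X0] := leP 0 X.
  rewrite flow_nneg// ?subr_ge0// (@int_cst _ _ ap)// => s /andP[Js st].
  rewrite hg ?(le_trans J0 (ltW Js))// /slope gE ?(ltW Js) ?(lt_le_trans st)//.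
  by rewrite addr_ge0.
have below s : J <= s -> s < J' -> X + am * (s - J) < 0 -> g s < 0.
  move=> Js sJ'; apply: le_lt_trans.
  by rewrite gE ?Js// lerD2l int_le.
(* The time at which a path started below 0 with slope am reaches 0. *)
pose T0 := J - X / am.
have JT0 : J <= T0.
  by rewrite /T0 lerDl oppr_ge0 pmulr_lle0 ?invr_gt0 ?am_gt0// ltW.
have XE : X = - am * (T0 - J) by rewrite /T0; field; rewrite gt_eqF.
have slopeE s : J < s -> s < T0 -> s < J' -> h s = am.
  move=> Js sT sJ'; rewrite hg ?(le_trans J0 (ltW Js))// /slope leNgt below ?(ltW Js)//.
  by rewrite XE mulNr addrC -mulrBr pmulr_rlt0//; lra.
have [tT0|T0t] := leP t T0.
  rewrite (@int_cst _ _ am)// => [|s /andP[Js st]]; last first.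
    by rewrite slopeE// ?(lt_le_trans st).
  (* [flow_neg] wants a strictly negative endpoint; arrival at 0 exactly at time t is treated
     apart. *)
  have [E0|N0] := eqVneq (X + am * (t - J)) 0.
    rewrite E0 /flow /tau /sigma /slope [in X / _]leNgt X0 /=.
    rewrite (_ : X / am + (t - J) = 0) ?mulr0//.
    by apply: (mulfI (lt0r_neq0 am_gt0)); rewrite mulr0 -E0; field; rewrite gt_eqF.
  rewrite flow_neg// lt_neqAle N0 XE mulNr addrC -mulrBr pmulr_rle0//.
  by lra.
rewrite (@int_chop J T0 t) ?(ltW T0t)// (@int_cst J T0 am)//; last first.
  by move=> s /andP[Js st]; rewrite slopeE// (lt_le_trans _ tJ')// (lt_trans st).
rewrite addrA {1}XE mulNr addNr add0r.
have gT0 : g T0 = 0.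
  rewrite gE ?JT0 ?(lt_le_trans T0t)// (@int_cst J T0 am)//.
    by rewrite {1}XE mulNr addNr.
  by move=> s /andP[Js st]; rewrite slopeE// (lt_le_trans _ tJ')// (lt_trans st).
rewrite (@int_cst T0 t ap) ?(le_trans J0) ?(ltW T0t)// => [|s /andP[Ts st]].
  rewrite (_ : t - J = (T0 - J) + (t - T0)); last by ring.
  rewrite flowD (_ : flow (T0 - J) X = 0).
    by rewrite flow_nneg ?add0r// subr_ge0 ltW.
  rewrite /flow /tau /slope leNgt X0/= (_ : X / am + (T0 - J) = 0).
    by rewrite /sigma mulr0.
  by rewrite /T0; ring.
rewrite hg ?(le_trans J0 (le_trans JT0 (ltW Ts)))// /slope (ge T0) ?(ltW Ts)//.
  by rewrite gT0 add0r int_ge0.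
by rewrite (lt_le_trans st).
Qed.

End path.

End flow.

(** * The chain of positions after the jumps *)

Section state.
Context {R : realType} (am ap : R).

(** Position of the logarithmic process just after the k-th jump. Plain sequences are taken as
    arguments so that measurability can be proved for any sigma-algebra, in particular that of the
    past. *)
Fixpoint state (e s : nat -> R) (x : R) (k : nat) : R :=
  if k is k'.+1 then flow am ap (e k') (state e s x k') + ln (s k') else x.

Lemma measurable_state d (T : measurableType d) (e s : nat -> T -> R)
    (x : T -> R) k :
  (forall i, (i < k)%N -> measurable_fun setT (e i)) ->
  (forall i, (i < k)%N -> measurable_fun setT (s i)) ->
  measurable_fun setT x ->
  measurable_fun setT (fun w => state (e^~ w) (s^~ w) (x w) k).
Proof.
move=> + + mx; elim: k => // k IH me ms /=; apply: measurable_funD.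
  apply: measurable_flow; first exact: me.
  by apply: IH => i ik; [apply: me|apply: ms]; exact: ltnW.
by apply: measurableT_comp (ms k _) => //; exact: measurable_ln.
Qed.

End state.

(** * Explicit paths, joint measurability, and invariance for functions *)

Section stationary.
Context {R : realType} (am ap : R) (rho : R -> R).
Hypotheses (ap_gt0 : 0 < ap) (ap_lt_am : ap < am).
Context {d : measure_display} {T : measurableType d} (P : probability T R).
Variables E S : nat -> {RV P >-> R}.
Hypothesis ES : compound_poisson rho E S.
Variable eta : R -> R -> T -> R.
Hypothesis eta_refracted : refracted am ap E S eta.
Variable nu : probability (measurableTypeR R) R.
Hypothesis nu_inv : invariant_law P eta nu.

Local Notation J n w := (jump_time E n w).
Local Notation St x w k := (state am ap (E^~ w) (S^~ w) x k).
Local Notation leb := (@lebesgue_measure R).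

Lemma jump_time0 w : J 0 w = 0.
Proof. by rewrite /jump_time big_ord0. Qed.

Lemma jump_timeS n w : J n.+1 w = J n w + E n w.
Proof. by rewrite /jump_time big_ord_recr. Qed.

Lemma jump_time_ge0 n w : 0 <= J n w.
Proof. by apply: sumr_ge0 => i _; apply/ltW/(waiting_time_gt0 ES). Qed.

Lemma jump_time_lt n w : J n w < J n.+1 w.
Proof. by rewrite jump_timeS ltrDl (waiting_time_gt0 ES). Qed.

Lemma le_jump_time m n w : (m <= n)%N -> J m w <= J n w.
Proof.
move=> /subnK <-; elim: (n - m)%N => // k IH.
by rewrite addSn (le_trans IH)// ltW// jump_time_lt.
Qed.

Lemma jump_time_itv t w : 0 <= t -> exists n, J n w <= t < J n.+1 w.
Proof.
move=> t0; have [n tn] : exists n, t < J n w.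
  have /cvgryPgt/(_ t)[N _ /(_ N)/= tN] := jump_time_unbounded ES w.
  by exists N; exact: tN.
elim: n tn => [|n IH]; first by rewrite jump_time0 ltNge t0.
by move=> tn; have [/IH//|nt] := ltP t (J n w); exists n; rewrite nt.
Qed.

(** The equation in [refracted] has the unknown path inside the integral; [flow_of_integral] solves
    it period by period, by induction on the number of jumps. *)
Lemma eta_flow z w n t : 0 < z -> J n w <= t < J n.+1 w ->
  eta z t w = flow am ap (t - J n w) (St (ln z) w n).
Proof.
move=> z0; pose h s := slope am ap (eta z s w).
have mh : measurable_fun (`[0, +oo[ : set R) h.
  by apply: measurableT_comp (refracted_path eta_refracted w z0); exact: measurable_slope.
have hb s : ap <= h s <= am by exact: slope_bounds.
have int0 t' n' : J n' w <= t' ->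
  \int[leb]_(s in `[0, t']) h s =
  \int[leb]_(s in `[0, J n' w]) h s + \int[leb]_(s in `]J n' w, t']) h s.
  move=> nt; rewrite -[X in _ + X](@Rintegral_itvB _ h (BLeft 0) (BRight t') (J n' w)) ?bnd_simp ?jump_time_ge0//.
    by rewrite addrC subrK.
  exact: (integrable_between ap_gt0 mh hb).
(* The closed right end supplies the left limit at the next jump time, which the induction needs. *)
have step n' : St (ln z) w n' = ln z + \int[leb]_(s in `[0, J n' w]) h s + \sum_(i < n') ln (S i w) ->
    forall t', J n' w <= t' <= J n'.+1 w ->
    St (ln z) w n' + \int[leb]_(s in `]J n' w, t']) h s = flow am ap (t' - J n' w) (St (ln z) w n').
  move=> XE t'; apply: (@flow_of_integral _ _ _ ap_gt0 ap_lt_am h mh hb _ _ _ (fun s => eta z s w)) => //.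
    exact: jump_time_ge0.
  move=> s sJ; rewrite (refracted_eq eta_refracted z0 sJ) (int0 _ n'); last by case/andP: sJ.
  by rewrite XE; ring.
suff XE : St (ln z) w n = ln z + \int[leb]_(s in `[0, J n w]) h s + \sum_(i < n) ln (S i w).
  move=> tJ; rewrite -step//; last by case/andP: tJ => -> /ltW.
  rewrite (refracted_eq eta_refracted z0 tJ) (int0 _ n); last by case/andP: tJ.
  by rewrite XE; ring.
elim: n => [|n IH].
  by rewrite jump_time0 set_itv1 Rintegral_set1 big_ord0 !addr0.
rewrite big_ord_recr /= (int0 _ n) ?(ltW (jump_time_lt _ _))//.
rewrite (_ : E n w = J n.+1 w - J n w); last by rewrite jump_timeS addrC addKr.
rewrite -step ?lexx ?(ltW (jump_time_lt _ _))// IH; ring.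
Qed.

Lemma measurable_jump_time n : measurable_fun setT (jump_time E n).
Proof.
rewrite /jump_time; elim: n => [|n IH].
  by under eq_fun do rewrite big_ord0; exact: measurable_cst.
by under eq_fun do rewrite big_ord_recr; exact: measurable_funD.
Qed.

Let measurable_X k :
  measurable_fun setT (fun p : R * T => St p.1 p.2 k).
Proof.
by apply: measurable_state => // i _; apply: measurableT_comp => //.
Qed.

(** Joint measurability is not part of [refracted]; it comes from the explicit formula on each event
    that exactly n jumps occurred by time t. *)
Lemma measurable_eta t : 0 <= t ->
  measurable_fun setT (fun p : R * T => eta (expR p.1) t p.2).
Proof.
move=> t0 _ A mA; rewrite setTI.
rewrite (_ : _ @^-1` A = \bigcup_n
    ([set p : R * T | J n p.2 <= t < J n.+1 p.2] `&`
     (fun p : R * T => flow am ap (t - J n p.2) (St p.1 p.2 n)) @^-1` A)); last first.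
  apply/seteqP; split=> -[x w] /=.
    move=> Aw; have [n tn] := jump_time_itv w t0.
    by exists n => //; split => //=; move: Aw; rewrite (eta_flow _ tn) ?expR_gt0// expRK.
  by move=> [n _ [tn /=]]; rewrite (eta_flow _ tn) ?expR_gt0// expRK.
apply: bigcup_measurable => n _; apply: measurableI.
  have mJ m : measurable_fun setT (fun p : R * T => J m p.2).
    by apply: measurableT_comp => //; exact: measurable_jump_time.
  have : measurable_fun setT (fun p : R * T => (J n p.2 <= t) && (t < J n.+1 p.2)).
    by apply: measurable_and; [apply: measurable_fun_ler|apply: measurable_fun_ltr];
      [exact: mJ|exact: measurable_cst|exact: measurable_cst|exact: mJ].
  by move=> /(_ measurableT [set true] I); rewrite setTI.
rewrite -[X in measurable X]setTI; apply: measurable_flow => //.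
apply: measurable_funB; first exact: measurable_cst.
by apply: measurableT_comp => //; exact: measurable_jump_time.
Qed.

Let measurable_lnR :
  @measurable_fun _ _ (measurableTypeR R) R setT (@ln R) := @measurable_ln R.

Definition log_mfun : {mfun measurableTypeR R >-> R} :=
  HB.pack (@ln R)
    (@isMeasurableFun.Build _ _ (measurableTypeR R) R (@ln R) measurable_lnR).

Definition log_law : probability R R := distribution nu log_mfun.

(** The two sides are compared on sets through the pushforward. [nu] gives no mass to the complement
    of (0, oo), so the conventional value of [ln] there is harmless. *)
Lemma invariant_Ex t (f : R -> R) : 0 <= t -> bmf f ->
  Ex log_law f = Ex (log_law \x P)%E (fun p => f (eta (expR p.1) t p.2)).
Proof.
move=> t0; apply: Ex_pushforward; first exact: measurable_eta.
move=> B mB.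
have [nu0 inv] := nu_inv.
pose C := (fun p : R * T => eta (expR p.1) t p.2) @^-1` B.
have mC : measurable C.
  by rewrite -[X in measurable X]setTI; exact: measurable_eta.
pose A : set R := `]0, +oo[ `&` (@ln R) @^-1` B.
have mA : measurable A.
  apply: measurableI => //; rewrite -[X in measurable X]setTI.
  exact: measurable_ln.
have nuN : nu (~` `]0, +oo[) = 0%E.
  by rewrite probability_setC// nu0 subee.
transitivity (nu A).
  have -> : A = `]0, +oo[ `&` log_mfun @^-1` B by [].
  rewrite [LHS](_ : _ = nu (log_mfun @^-1` B))// -[RHS]adde0.
  have mlnB : measurable (log_mfun @^-1` B).
    by rewrite -[X in measurable X]setTI; exact: measurable_lnR.
  have N0 : nu (log_mfun @^-1` B `&` ~` `]0, +oo[) = 0%E.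
    apply: (@subset_measure0 _ _ _ nu _ (~` `]0, +oo[)) => //.
      by apply: measurableI => //; exact: measurableC.
    exact: measurableC.
  rewrite -[in LHS](setIT (log_mfun @^-1` B)) -(setvU `]0, +oo[) setIUr measureU.
  - by rewrite [LHS]addeC; congr (_ + _)%E; [rewrite setIC|exact: N0].
  - by apply: measurableI => //; exact: measurableC.
  - exact: measurableI.
  - by rewrite setIACA setICl setI0.
rewrite -(inv t A t0 mA).
rewrite [RHS](_ : _ = \int[log_law]_x P (xsection C x))%E//.
rewrite ge0_integral_pushforward//; last exact: measurable_fun_xsection.
rewrite preimage_setT (@ge0_negligible_integral _ _ _ nu setT (~` `]0, +oo[))//; last 2 first.
- exact: measurableC.
- by apply: measurableT_comp; [exact: measurable_fun_xsection|exact: measurable_lnR].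
rewrite setDE setCK setTI; apply: eq_integral => z; rewrite inE/= in_itv/= andbT => z0.
congr (P _); apply/seteqP; split=> w.
  by rewrite /Y /A /xsection /C/= inE/= in_itv/= andbT expRK lnK ?posrE// => -[].
by rewrite /Y /A /xsection /C/= inE/= in_itv/= andbT expRK expR_gt0 lnK ?posrE.
Qed.

End stationary.

(** * Identification of laws and integration against densities *)

Section laws.
Context {R : realType}.

(** Open half-lines to the right are stable under intersection and generate the Borel sets, so
    survival functions determine a law. *)
Lemma eq_law_ccdf d1 d2 (T1 : measurableType d1) (T2 : measurableType d2)
    (M1 : probability T1 R) (M2 : probability T2 R)
    (phi : T1 -> R) (psi : T2 -> R) :
  measurable_fun setT phi -> measurable_fun setT psi ->
  (forall x : R, Ex M1 (fun w => ind (x < phi w)) = Ex M2 (fun w => ind (x < psi w))) ->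
  forall f, bmf f -> Ex M1 (fun w => f (phi w)) = Ex M2 (fun w => f (psi w)).
Proof.
move=> mphi mpsi H f bf.
pose phi' : {mfun T1 >-> R} := HB.pack phi (isMeasurableFun.Build _ _ _ _ phi mphi).
pose psi' : {mfun T2 >-> R} := HB.pack psi (isMeasurableFun.Build _ _ _ _ psi mpsi).
rewrite -(@Ex_pushforward _ _ _ _ _ M1 (distribution M1 phi') phi)//.
rewrite -(@Ex_pushforward _ _ _ _ _ M2 (distribution M2 psi') psi)//.
rewrite /Ex /Rintegral; congr fine; apply: eq_measure_integral => A mA _.
apply: (measure_unique (@RGenOInfty.G R) (fun n => `]- n%:R, +oo[%classic)) => //.
- exact: RGenOInfty.measurableE.
- move=> _ _ [x ->] [y ->]; exists (Num.max x y).
  by apply/seteqP; split=> z/=; rewrite !in_itv/= !andbT gt_max => /andP.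
- by move=> n; exists (- n%:R).
- apply/seteqP; split=> // x _; exists (Num.trunc `|x|).+1 => //=.
  rewrite in_itv/= andbT ltrNl; apply: le_lt_trans (truncnS_gt _).
  by rewrite -normrN ler_norm.
- move=> _ [x ->].
  have := congr1 EFin (H x); rewrite -!prob_Ex//.
  + rewrite [X in X = _ -> _](_ : _ = distribution M1 phi' `]x, +oo[); last first.
      by congr (M1 _); apply/seteqP; split=> z/=; rewrite in_itv/= andbT.
    rewrite [X in _ = X -> _](_ : _ = distribution M2 psi' `]x, +oo[)//.
    by congr (M2 _); apply/seteqP; split=> z/=; rewrite in_itv/= andbT.
  + exact: measurable_fun_ltr.
  + exact: measurable_fun_ltr.
- by move=> n; rewrite (le_lt_trans (probability_le1 _ _))// ltry.
Qed.

Import HBNNSimple.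

(** The usual passage from sets to simple functions to monotone limits; it converts the law of the
    jump factors, given on sets, into integrals against [rho]. *)
Lemma ge0_integral_density d (T : measurableType d)
    (mu nu : {measure set T -> \bar R}) (D : set T) (g : T -> R) :
  measurable D -> measurable_fun D g -> (forall x, D x -> 0 <= g x) ->
  (forall A, measurable A -> nu A = (\int[mu]_(x in A `&` D) (g x)%:E)%E) ->
  forall f : T -> R, measurable_fun setT f -> (forall x, 0 <= f x) ->
  (\int[nu]_x (f x)%:E = \int[mu]_(x in D) (f x * g x)%:E)%E.
Proof.
move=> mD mg g0 nuE f mf f0.
have mEf : measurable_fun setT (EFin \o f) by exact/measurable_EFinP.
pose f_ := nnsfun_approx measurableT mEf.
have fcvg x : (EFin \o f_^~ x) @ \oo --> (f x)%:E.
  by apply: cvg_nnsfun_approx => // y _; rewrite lee_fin.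
have step (h : {nnsfun T >-> R}) :
    (\int[nu]_x (h x)%:E = \int[mu]_(x in D) (h x * g x)%:E)%E.
  under [LHS]eq_integral do rewrite fimfunE -fsumEFin//.
  rewrite [LHS]ge0_integral_fsum//; last 2 first.
    - by move=> r; exact/measurable_EFinP/measurableT_comp.
    - by move=> n x _; rewrite EFinM nnfun_muleindic_ge0.
  under [RHS]eq_integral.
    move=> x xD; rewrite fimfunE EFinM -fsumEFin// ge0_mule_fsuml; last first.
      by move=> r; rewrite EFinM nnfun_muleindic_ge0.
    over.
  rewrite [RHS]ge0_integral_fsum//; last 2 first.
    - move=> r; under eq_fun do rewrite -EFinM.
      apply/measurable_EFinP; apply: measurable_funM => //.
      by apply: measurable_funTS; apply: measurable_funM => //; exact: measurable_cst.
    - move=> n x Dx; rewrite mule_ge0 ?lee_fin ?g0//.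
      by have := nnfun_muleindic_ge0 h n x; rewrite -EFinM lee_fin.
  apply: eq_fsbigr => r _; rewrite integralZl_indic_nnsfun// integral_indic// setIT.
  rewrite nuE// integral_mkcondl.
  have [r0|r0] := ltP r 0.
    rewrite preimage_nnfun0// !integral0_eq ?mule0//.
      by move=> x _; rewrite indicE in_set0 mulr0 mul0e.
    by move=> x _; rewrite patchE in_set0.
  rewrite -ge0_integralZl//.
  - apply: eq_integral => x _; rewrite patchE indicE.
    case: ifPn => _ /=; first by rewrite mulr1.
    by rewrite mulr0 mul0e [X in (_ * X)%E](_ : _ = 0%E)// mule0.
  - apply/measurable_restrict => //.
    by apply: (@measurable_funS _ _ _ _ D) => //; exact/measurable_EFinP.
  - by move=> x Dx; rewrite patchE; case: ifPn; rewrite ?lee_fin ?g0.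
transitivity (limn (fun n => \int[nu]_x (f_ n x)%:E)%E).
  rewrite -monotone_convergence//=.
  - by apply: eq_integral => x _; apply/esym/cvg_lim => //; exact: fcvg.
  - by move=> n; exact/measurable_EFinP/measurable_funTS.
  - by move=> n x _; rewrite lee_fin.
  - by move=> x _ a b ab; rewrite lee_fin; exact/lefP/nd_nnsfun_approx.
under eq_fun do rewrite step.
rewrite -monotone_convergence//=.
- apply: eq_integral => x /[!inE] Dx; apply/cvg_lim => //.
  under eq_fun do rewrite EFinM; rewrite EFinM.
  by apply: cvgeZr => //; exact: fcvg.
- by move=> n; apply/measurable_EFinP/measurable_funM => //; exact: measurable_funTS.
- by move=> n x Dx; rewrite lee_fin mulr_ge0// g0.
- move=> x Dx a b ab; rewrite lee_fin ler_wpM2r ?g0//.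
  exact/lefP/nd_nnsfun_approx.
Qed.

End laws.

(** * Independence from the past *)

Section independent_sequence.
Context {R : realType} d (T : measurableType d) (P : probability T R).
Variable V : nat -> {RV P >-> R}.

(** A family stable under intersection that generates the sigma-algebra of the first j variables. *)
Definition past (j : nat) : set (set T) :=
  [set B | exists A : nat -> set R, (forall i, measurable (A i)) /\
    B = \bigcap_(i in `I_j) (V i @^-1` A i)].

Hypothesis indepV : forall j (A : nat -> set R), (forall i, measurable (A i)) ->
  P (\bigcap_(i in `I_j) (V i @^-1` A i)) = (\prod_(i < j) P (V i @^-1` A i))%E.

Lemma past_setI_closed j : setI_closed (past j).
Proof.
move=> _ _ [A [mA ->]] [B [mB ->]]; exists (fun i => A i `&` B i); split.
  by move=> i; exact: measurableI.
by rewrite -bigcapI.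
Qed.

Lemma pastT j : past j setT.
Proof.
exists (fun=> setT); split => //.
by apply/seteqP; split.
Qed.

Lemma measurable_preimage i A : measurable A -> measurable (V i @^-1` A).
Proof. by move=> mA; rewrite -[X in measurable X]setTI; exact: measurable_funP. Qed.

Lemma past_measurable j : past j `<=` measurable.
Proof.
move=> _ [A [mA ->]]; apply: bigcap_measurableType.
by move=> i _; exact: measurable_preimage.
Qed.

(** As functions of B both sides are finite measures, and they agree on the generating family by the
    product formula. *)
Lemma past_indep j B A : <<s past j >> B -> measurable A ->
  P (B `&` V j @^-1` A) = (P B * P (V j @^-1` A))%E.
Proof.
move=> pB mA; have mD := measurable_preimage j mA.
have p_ge0 : 0 <= fine (P (V j @^-1` A)) by rewrite fine_ge0.
pose m2 := mscale (NngNum p_ge0) P.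
have -> : (P B * P (V j @^-1` A))%E = m2 B.
  by rewrite /m2/= /mscale/= fineK ?fin_num_measure// muleC.
have -> : P (B `&` V j @^-1` A) = mrestr P mD B by [].
apply: (g_sigma_algebra_measure_unique (past j) _ (fun=> setT)) pB.
- exact: past_measurable.
- by move=> _; exact: pastT.
- by rewrite bigcup_const.
- exact: past_setI_closed.
- move=> _ [C [mC ->]]; rewrite /m2/= /mscale/mrestr/= fineK ?fin_num_measure//.
  (* The event on variable j becomes one more factor of the product formula at j + 1. *)
  pose C' i := if i == j then A else C i.
  have mC' i : measurable (C' i) by rewrite /C'; case: ifP.
  have := indepV j.+1 mC'; rewrite big_ord_recr/= [C' j]/C' eqxx muleC.
  rewrite (eq_bigr (fun i : 'I_j => P (V i @^-1` C i))); last first.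
    by move=> i _; rewrite /C' ltn_eqF.
  rewrite -indepV// => <-.
  congr (P _); apply/seteqP; split=> w /=.
    move=> [Cw Aw] i /=; rewrite ltnS leq_eqVlt /C' => /orP[/eqP->|ij]; first by rewrite eqxx.
    by rewrite ltn_eqF//; exact: Cw.
  move=> H; split=> [i /= ij|]; last by have := H j (ltnSn j); rewrite /C' eqxx.
  by have := H i (ltnW ij); rewrite /C' ltn_eqF.
- move=> _; rewrite /= /mrestr (le_lt_trans (probability_le1 _ _))//= ?ltry//.
  exact: measurableI.
Qed.

Lemma measurable_past j i : (i < j)%N ->
  measurable_fun (setT : set (g_sigma_algebraType (past j))) (V i : _ -> R).
Proof.
move=> ij _ A mA; rewrite setTI; apply: sub_sigma_algebra.
exists (fun k => if k == i then A else setT); split; first by move=> k; case: ifP.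
apply/seteqP; split=> w /=.
  by move=> Aw k /= _; case: eqP => [->|].
by move=> /(_ i ij); rewrite /= eqxx.
Qed.

Lemma sub_past i j : (i <= j)%N -> past i `<=` past j.
Proof.
move=> ij _ [A [mA ->]]; exists (fun k => if (k < i)%N then A k else setT); split.
  by move=> k; case: ifP.
apply/seteqP; split=> w /= H k /=; first by move=> _; case: ifP => // ki; exact: H.
by move=> ki; have := H k (leq_trans ki ij); rewrite ki.
Qed.

Lemma measurable_fun_past d1 (T1 : measurableType d1) i j (X : T -> T1) :
  (i <= j)%N ->
  measurable_fun (setT : set (g_sigma_algebraType (past i))) (X : _ -> T1) ->
  measurable_fun (setT : set (g_sigma_algebraType (past j))) (X : _ -> T1).
Proof.
move=> ij mX _ A mA; have := mX measurableT A mA.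
by apply: sub_smallest2r; [exact: smallest_sigma_algebra|exact: sub_past].
Qed.

(** Freezing: by [past_indep] on rectangles the joint law of X and the next variable is a product,
    so Fubini applies. *)
Lemma past_Ex d1 (T1 : measurableType d1) j (X : T -> T1) (f : T1 * R -> R) :
  measurable_fun (setT : set (g_sigma_algebraType (past j))) (X : _ -> T1) ->
  bmf f ->
  Ex P (fun w => f (X w, V j w)) =
  Ex P (fun w => Ex (distribution P (V j)) (fun v => f (X w, v))).
Proof.
move=> pX bf.
have mX : measurable_fun setT X.
  move=> _ A mA; have := pX measurableT A mA.
  by apply: smallest_sub; [exact: sigma_algebra_measurable|exact: past_measurable].
pose X' : {mfun T >-> T1} := HB.pack X (isMeasurableFun.Build _ _ _ _ X mX).
have mXV : measurable_fun setT (fun w => (X w, V j w)) by exact: measurable_fun_pair.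
pose XV : {mfun T >-> (T1 * R)%type} :=
  HB.pack (fun w => (X w, V j w)) (isMeasurableFun.Build _ _ _ _ _ mXV).
rewrite -[RHS](@Ex_pushforward _ _ _ _ _ P (distribution P X') X
  (fun x => Ex (distribution P (V j)) (fun v => f (x, v))))//; last first.
  exact: bmf_Ex2.
rewrite -Ex_fubini1//; apply/esym/Ex_pushforward => // A mA.
apply: (@product_measure_unique _ _ _ _ _ _ _ (distribution P XV)) mA => B C mB mC.
rewrite [RHS](_ : _ = P (X @^-1` B) * P (V j @^-1` C))%E// -past_indep//.
by have := pX measurableT B mB; rewrite setTI.
Qed.

End independent_sequence.

(** * Laws of waiting times and jump factors *)

Section compound_poisson_laws.
Context {R : realType} (rho : R -> R) {d} {T : measurableType d}.
Context (P : probability T R) (E S : nat -> {RV P >-> R}).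
Hypothesis rho_meas : measurable_fun (`[0, 1] : set R) rho.
Hypothesis rho_ge0 : forall s : R, 0 <= s <= 1 -> 0 <= rho s.
Hypothesis ES : compound_poisson rho E S.

Local Notation lam := (jump_rate rho).
Local Notation leb := (@lebesgue_measure R).

(** Interleaving in the order in which the path uses the variables: the past of index 2k consists of
    the marks of the first k periods. *)
Definition marks (m : nat) : {RV P >-> R} := if odd m then S m./2 else E m./2.

Lemma marks_indep j (A : nat -> set R) : (forall i, measurable (A i)) ->
  P (\bigcap_(i in `I_j) (marks i @^-1` A i)) =
  (\prod_(i < j) P (marks i @^-1` A i))%E.
Proof.
have even n B : (forall i, measurable (B i)) ->
    P (\bigcap_(i in `I_n.*2) (marks i @^-1` B i)) =
    (\prod_(i < n.*2) P (marks i @^-1` B i))%E.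
  move=> mB.
  have -> : (\prod_(i < n.*2) P (marks i @^-1` B i))%E =
      (\prod_(i < n) (P (E i @^-1` B i.*2) * P (S i @^-1` B i.*2.+1)))%E.
    elim: n => [|n IH]; first by rewrite !big_ord0.
    rewrite [RHS]big_ord_recr/= -IH doubleS !big_ord_recr/= muleA.
    by rewrite /marks/= odd_double/= uphalf_double doubleK.
  rewrite -(jump_independence ES n (fun i => mB i.*2) (fun i => mB i.*2.+1)).
  congr (P _); apply/seteqP; split=> w /= H i /= ni.
    split; [have := H i.*2|have := H i.*2.+1]; rewrite /marks/= odd_double/=.
      by rewrite doubleK ltn_double; exact.
    by rewrite uphalf_double -doubleS leq_double; exact.
  have i2 : (i./2 < n)%N by rewrite ltn_half_double.
  have [h1 h2] := H i./2 i2; rewrite /marks; case: ifP => oi.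
    suff -> : B i = B i./2.*2.+1 by [].
    by congr B; rewrite -[LHS]odd_double_half oi.
  suff -> : B i = B i./2.*2 by [].
  by congr B; rewrite -[LHS]odd_double_half oi.
(* Any j is reduced to the even case by padding with full sets up to 2j. *)
move=> mA; pose B i := if (i < j)%N then A i else setT.
have mB i : measurable (B i) by rewrite /B; case: ifP.
have jj : (j <= j.*2)%N by rewrite -addnn leq_addr.
transitivity (P (\bigcap_(i in `I_j.*2) (marks i @^-1` B i))).
  congr (P _); apply/seteqP; split=> w /= H i /=.
    by move=> _; rewrite /B; case: ifP => // ij; exact: H.
  by move=> ij; have := H i (leq_trans ij jj); rewrite /B ij.
rewrite even// (big_ord_widen _ (fun i => P (marks i @^-1` A i)) jj) [RHS]big_mkcond.
apply: eq_bigr => i _; rewrite /B; case: ifP => // _.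
by rewrite preimage_setT probability_setT.
Qed.

(** With rate 0, whose inverse is 0 by convention, the law of a factor would be the zero measure
    instead of a probability. *)
Lemma jump_rate_gt0 : 0 < lam.
Proof.
have lam_ge0 : 0 <= lam.
  by apply: Rintegral_ge0 => s /=; rewrite in_itv/=; exact: rho_ge0.
rewrite lt_neqAle lam_ge0 andbT; apply/eqP => lam0.
have H : distribution P (S 0) setT = 1%E by exact: probability_setT.
have := etrans (esym (jump_factor_law ES 0 measurableT)) H.
by rewrite -lam0 invr0 mul0e => /eqP; rewrite eq_sym onee_eq0.
Qed.

Lemma waiting_time_ccdf k (t : R) : 0 <= t ->
  Ex (distribution P (E k)) (fun e => ind (t < e)) = expR (- lam * t).
Proof.
move=> t0.
rewrite (@Ex_ext _ _ _ _ _ (fun e : R => 1 - ind (e <= t))); last first.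
  by move=> e; rewrite ltNge; case: (e <= t); rewrite ?subrr ?subr0.
have mt : measurable_fun setT (fun e : R => e <= t).
  by apply: measurable_fun_ler => //; exact: measurable_cst.
rewrite ExB; [|exact: bmf_cst|exact: bmf_bool]; rewrite Ex_cst.
suff -> : Ex (distribution P (E k)) (fun e => ind (e <= t)) = 1 - expR (- lam * t).
  by rewrite opprB addrC subrK.
apply: EFin_inj; rewrite -prob_Ex//.
transitivity (exponential_prob lam `[0, t]).
  transitivity (distribution P (E k) `[0, t]); last exact: (waiting_time_law ES).
  congr (P _); apply/seteqP; split=> w /=; rewrite in_itv/=.
    by move=> ->; rewrite ltW// (waiting_time_gt0 ES).
  by case/andP.
have [t0'|] := ltP 0 t; first by rewrite exponential_prob_itv0c.
move=> tle0; have -> : t = 0 by apply/eqP; rewrite eq_le tle0.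
by rewrite set_itv1 /exponential_prob integral_set1 mulr0 expR0 subrr.
Qed.

Lemma waiting_time_cdf k (t : R) : 0 <= t ->
  Ex (distribution P (E k)) (fun e => ind (e <= t)) = 1 - expR (- lam * t).
Proof.
move=> t0; rewrite -(waiting_time_ccdf k t0).
rewrite [LHS](@Ex_ext _ _ _ _ _ (fun e : R => 1 - ind (t < e))); last first.
  by move=> e; rewrite ltNge; case: (e <= t); rewrite ?subrr ?subr0.
rewrite ExB ?Ex_cst//; first exact: bmf_cst.
by apply: bmf_bool; apply: measurable_fun_ltr => //; exact: measurable_cst.
Qed.

Lemma factor_density (f : R -> R) : measurable_fun setT f -> (forall x, 0 <= f x) ->
  (lam%:E * \int[P]_w (f (S 0 w))%:E =
   \int[leb]_(s in `[0%R, 1%R]) (f s * rho s)%:E)%E.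
Proof.
move=> mf f0; have lam_ge0 := ltW jump_rate_gt0.
have mEf : measurable_fun setT (EFin \o f) by exact/measurable_EFinP.
have mS : @measurable_fun _ _ T (measurableTypeR R) setT (S 0).
  by have mS0 : measurable_fun setT (S 0) by []; exact: mS0.
pose S' : {mfun T >-> measurableTypeR R} :=
  HB.pack (S 0 : T -> R) (@isMeasurableFun.Build _ _ T (measurableTypeR R) (S 0) mS).
rewrite -(@ge0_integral_density _ _ _ leb (mscale (NngNum lam_ge0) (distribution P S')))//.
- rewrite ge0_integral_mscale//.
    congr (_ * _)%E.
    by rewrite (@ge0_integral_distribution _ _ _ _ _ P S' (EFin \o f))// => x; rewrite lee_fin.
  by move=> x _; rewrite lee_fin.
- move=> A mA; rewrite /= /mscale/=.
  transitivity (lam%:E * ((lam^-1)%:E * \int[leb]_(s in A `&` `[0%R, 1%R]) (rho s)%:E))%E.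
    by congr (_ * _)%E; exact: (jump_factor_law ES 0 mA).
  by rewrite muleA -EFinM divff ?mul1e// gt_eqF// jump_rate_gt0.
Qed.

Lemma distribution_E k (f : R -> R) :
  Ex (distribution P (E k)) f = Ex (distribution P (E 0)) f.
Proof.
congr fine; apply: eq_measure_integral => A mA _.
exact: etrans (waiting_time_law ES k mA) (esym (waiting_time_law ES 0 mA)).
Qed.

Lemma distribution_S k (f : R -> R) :
  Ex (distribution P (S k)) f = Ex (distribution P (S 0)) f.
Proof.
congr fine; apply: eq_measure_integral => A mA _.
exact: etrans (jump_factor_law ES k mA) (esym (jump_factor_law ES 0 mA)).
Qed.

(** The positive part of e - t has the same survival function as e' times the indicator of t < e,
    with e' an independent copy of e; Fubini then factors the expectation. *)
Lemma memoryless (t : R) (f : R -> R) : 0 <= t -> bmf f ->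
  Ex (distribution P (E 0)) (fun e => ind (t < e) * f (e - t)) =
  expR (- lam * t) * Ex (distribution P (E 0)) f.
Proof.
move=> t0 bf; set M := distribution P (E 0).
have mt (x : R) : measurable_fun setT (fun e : R => x < e).
  by apply: measurable_fun_ltr => //; exact: measurable_cst.
have ccdfM (x : R) : 0 <= x -> Ex M (fun e => ind (x < e)) = expR (- lam * x).
  exact: waiting_time_ccdf.
have b0 : bmf (fun y : R => ind (0 < y) : R) by exact: bmf_bool (mt 0).
(* Killing f at 0 makes the event e <= t contribute nothing on either side, and changes nothing
   under a positive waiting time. *)
pose f' y := f y * ind (0 < y).
have bf' : bmf f' by exact: bmfM.
have posE (h : R -> R) : bmf h -> Ex M h = Ex M (fun e => h e * ind (0 < e)).
  move=> bh; rewrite !(@Ex_pushforward _ _ _ _ _ P M (E 0))//; last exact: bmfM.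
  by apply: Ex_ext => w; rewrite (waiting_time_gt0 ES) mulr1.
transitivity (Ex M (fun e => f' (Num.max (e - t) 0))).
  apply: Ex_ext => e; rewrite /f' -(subr_gt0 t); case: (ltP 0 (e - t)) => H.
    by rewrite H mulr1 mul1r.
  by rewrite ltxx mulr0 mul0r.
have mind : measurable_fun setT (fun p : R * R => ind (t < p.1) * p.2).
  apply: measurable_funM => //.
  by apply: measurable_ind; exact: (measurableT_comp (mt t)).
transitivity (Ex (M \x M)%E (fun p => f' (ind (t < p.1) * p.2))).
  apply: (eq_law_ccdf _ mind _ bf').
    apply: measurable_maxr; last exact: measurable_cst.
    by apply: measurable_funB => //; exact: measurable_cst.
  move=> x; rewrite Ex_fubini1; last first.
    by apply: bmf_bool; apply: measurable_fun_ltr => //; exact: measurable_cst.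
  have [x0|x0] := ltP x 0.
    rewrite (@Ex_ext _ _ _ _ _ (fun=> 1)); last first.
      by move=> e; rewrite lt_max x0 orbT.
    apply: Ex_ext => e1 /=; rewrite posE; last first.
      apply: bmf_bool; apply: measurable_fun_ltr; first exact: measurable_cst.
      exact: measurable_funM.
    rewrite (@Ex_ext _ _ _ _ _ (fun e : R => 1 * ind (0 < e))).
      by rewrite -(posE (fun=> 1)) ?Ex_cst//; exact: bmf_cst.
    move=> e2; case: (ltP 0 e2) => e20; rewrite ?mulr0// !mulr1.
    by rewrite (lt_le_trans x0)// mulr_ge0// ltW.
  rewrite [LHS](@Ex_ext _ _ _ _ _ (fun e : R => ind (t + x < e))); last first.
    by move=> e; rewrite lt_max [x < 0]ltNge x0 /= orbF ltrBrDl.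
  rewrite ccdfM ?addr_ge0//.
  rewrite [RHS](@Ex_ext _ _ _ _ _ (fun e : R => expR (- lam * x) * ind (t < e))); last first.
    move=> e /=; case: (t < e).
      rewrite mulr1 -(ccdfM _ x0); apply: Ex_ext => e'; by rewrite mul1r.
    rewrite mulr0 (@Ex_ext _ _ _ _ _ (fun=> 0)) ?Ex_cst// => e'.
    by rewrite mul0r ltNge x0.
  rewrite ExZ; last exact: bmf_bool (mt t).
  by rewrite ccdfM// mulrDr expRD mulrC.
rewrite Ex_fubini1; last exact: bmf_comp bf' mind.
rewrite -(ccdfM _ t0) mulrC -ExZ; last exact: bmf_bool (mt t).
apply: Ex_ext => e /=; rewrite mulrC; case: (t < e).
  by rewrite mul1r [RHS]posE//; apply: Ex_ext => e'; rewrite /f' mul1r.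
rewrite mul0r (@Ex_ext _ _ _ _ _ (fun=> 0)) ?Ex_cst// => e'.
by rewrite /f' mul0r ltxx mulr0.
Qed.

(** This event contains that of two jumps before t, and its probability is of order t^2, so it drops
    out of the generator. *)
Lemma two_waiting_times (t : R) : 0 <= t ->
  Ex P (fun w => ind ((E 0 w <= t) && (E 1 w <= t))) = (1 - expR (- lam * t)) ^+ 2.
Proof.
move=> t0.
have mt : measurable_fun setT (fun e : R => e <= t).
  by apply: measurable_fun_ler => //; exact: measurable_cst.
have mtE k : measurable_fun setT (fun w => E k w <= t).
  by apply: (measurableT_comp mt).
have PE k : P (E k @^-1` [set e | e <= t]) = (1 - expR (- lam * t))%:E.
  transitivity (Ex (distribution P (E k)) (fun e => ind (e <= t)))%:E.
    by rewrite -prob_Ex.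
  by rewrite waiting_time_cdf.
apply: EFin_inj; rewrite -prob_Ex; last exact: measurable_and.
have mA : measurable [set e : R | e <= t].
  by rewrite -[X in measurable X]setTI; have := mt measurableT [set true] I.
have := jump_independence ES 2 (fun=> mA) (fun=> measurableT).
rewrite !big_ord_recr big_ord0/= mul1e !preimage_setT !probability_setT !mule1 !PE.
rewrite -EFinM -expr2 => <-; congr (P _); apply/seteqP; split=> w /=.
  by move=> /andP[E0 E1] [|[|//]] _.
by move=> H; have [-> _] := H 0 isT; have [-> _] := H 1 isT.
Qed.

(** The factor has a density, so a jump almost never lands on a prescribed level. *)
Lemma factor_singleton (c : R) :
  Ex (distribution P (S 0)) (fun s => ind (ln s == c)) = 0.
Proof.
have mc (c' : R) : measurable_fun setT (fun s : R => s == c').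
  by apply: measurable_fun_eqr => //; exact: measurable_cst.
rewrite (@Ex_pushforward _ _ _ _ _ P _ (S 0))//; last first.
  by apply: bmf_bool; apply: measurable_fun_eqr; [exact: measurable_ln|exact: measurable_cst].
rewrite (@Ex_ext _ _ _ _ _ (fun w => ind (S 0 w == expR c))); last first.
  move=> w; have /andP[S0 _] := jump_factor_itv ES 0 w.
  by rewrite -(inj_eq (@expR_inj R)) lnK// posrE.
apply: EFin_inj; rewrite -prob_Ex; last first.
  exact: (measurableT_comp (mc _)).
transitivity (distribution P (S 0) [set expR c]).
  by congr (P _); apply/seteqP; split=> w /= /eqP.
transitivity ((lam^-1)%:E * \int[leb]_(s in [set expR c] `&` `[0%R, 1%R]) (rho s)%:E)%E.
  by apply: (jump_factor_law ES).
by rewrite (integral_Sset1 (expR c)) ?mule0//; exact: subIsetl.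
Qed.

(** Markov property for one period: freeze the past, integrate the factor, then the waiting time.
    All copies have the law of index 0. *)
Lemma mark_Ex k d1 (T1 : measurableType d1) (X : T -> T1) (f : (T1 * R) * R -> R) :
  measurable_fun (setT : set (g_sigma_algebraType (past marks k.*2))) (X : _ -> T1) ->
  bmf f ->
  Ex P (fun w => f ((X w, E k w), S k w)) =
  Ex P (fun w => Ex (distribution P (E 0)) (fun e =>
                 Ex (distribution P (S 0)) (fun s => f ((X w, e), s)))).
Proof.
move=> pX bf.
have mE : marks k.*2 = E k by rewrite /marks odd_double doubleK.
have mS : marks k.*2.+1 = S k by rewrite /marks/= odd_double/= uphalf_double.
have pXE : measurable_fun (setT : set (g_sigma_algebraType (past marks k.*2.+1)))
    ((fun w => (X w, E k w)) : _ -> T1 * R).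
  apply: measurable_fun_pair; first exact: measurable_fun_past pX.
  by rewrite -mE; exact: measurable_past.
have := past_Ex marks_indep pXE bf; rewrite mS => ->.
have bg : bmf (fun p : T1 * R => Ex (distribution P (S 0)) (fun s => f (p, s))).
  exact: bmf_Ex2.
have := past_Ex marks_indep pX bg; rewrite mE.
rewrite (@Ex_ext _ _ _ _ (fun w => Ex (distribution P (S k)) _) (fun w =>  Ex (distribution P (S 0)) (fun s => f ((X w, E k w), s)))); last first.
  by move=> w; rewrite distribution_S.
by move=> ->; apply: Ex_ext => w; rewrite distribution_E.
Qed.

End compound_poisson_laws.

(** * A sequence of times decreasing to zero *)

Section small_times.
Context {R : realType}.

Definition tn (n : nat) : R := n.+1%:R^-1.

Lemma tn_gt0 n : 0 < tn n. Proof. by rewrite invr_gt0. Qed.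

Lemma tn_ge0 n : 0 <= tn n. Proof. exact/ltW/tn_gt0. Qed.

Lemma cvg_tn : tn n @[n --> \oo] --> 0.
Proof. exact: cvg_harmonic. Qed.

Lemma cvg_exp_rate (lam : R) : 0 < lam ->
  (1 - expR (- lam * tn n)) / tn n @[n --> \oo] --> lam.
Proof.
move=> lam0.
have lamt n : 0 < 1 + lam * tn n by rewrite addr_gt0// mulr_gt0// tn_gt0.
apply: (@squeeze_cvgr _ _ _ _ (fun n => lam / (1 + lam * tn n)) (fun=> lam)).
- apply: nearW => n; have t0 := tn_gt0 n; apply/andP; split.
    rewrite ler_pdivlMr// mulrAC ler_pdivrMr//.
    have := expR_ge1Dx (lam * tn n); rewrite mulNr expRN => H.
    have e0 : 0 < expR (lam * tn n) by exact: expR_gt0.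
    have K : (expR (lam * tn n))^-1 * (1 + lam * tn n) <= 1.
      by rewrite mulrC ler_pdivrMr// mul1r.
    lra.
  rewrite ler_pdivrMr// lerBlDr -lerBlDl.
  by have := expR_ge1Dx (- lam * tn n); rewrite mulNr.
- rewrite -[X in _ --> X]divr1; apply: cvgM; first exact: cvg_cst.
  apply: cvgV; first exact: oner_neq0.
  rewrite -[X in _ --> X]addr0; apply: cvgD; first exact: cvg_cst.
  rewrite -[X in _ --> X](mulr0 lam); apply: cvgM; [exact: cvg_cst|exact: cvg_tn].
- exact: cvg_cst.
Qed.

Lemma cvg_window (k y l : R) : 0 < k ->
  ind (y < l <= y + k * tn n) @[n --> \oo] --> (0 : R).
Proof.
move=> k0; have [ly|yl] := leP l y.
  exact: cvg_cst.
apply: cvg_near_cst.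
have /cvgr_lt/(_ ((l - y) / k)) := cvg_tn.
rewrite divr_gt0 ?subr_gt0// => /(_ isT); apply: filterS => n /=.
by rewrite ltr_pdivlMr// ltrBrDl mulrC => H; rewrite leNgt H.
Qed.

End small_times.

(** * The generator identity under the invariant law *)

Section generator.
Context {R : realType} (am ap : R) (rho : R -> R).
Hypotheses (ap_gt0 : 0 < ap) (ap_lt_am : ap < am).
Context {d : measure_display} {T : measurableType d} (P : probability T R).
Variables E S : nat -> {RV P >-> R}.
Hypothesis ES : compound_poisson rho E S.
Variable eta : R -> R -> T -> R.
Hypothesis eta_refracted : refracted am ap E S eta.
Variable nu : probability (measurableTypeR R) R.
Hypothesis nu_inv : invariant_law P eta nu.

Hypothesis rho_ge0 : forall s : R, 0 <= s <= 1 -> 0 <= rho s.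

Local Notation lam := (jump_rate rho).
Local Notation mu := (log_law nu).
Local Notation muS := (distribution P (S 0)).
Local Notation flow := (flow am ap).
Local Notation jump p := (p.1 + ln p.2).

Let am_gt0 : 0 < am. Proof. exact: lt_trans ap_lt_am. Qed.

Lemma measurable_jump : measurable_fun setT (fun p : R * R => jump p).
Proof.
by apply: measurable_funD => //; apply: measurableT_comp => //; exact: measurable_ln.
Qed.

Lemma first_mark_Ex (t : R) (g : R * R -> R) : 0 <= t -> bmf g ->
  Ex (mu \x P)%E (fun p => ind (E 0 p.2 <= t) * g (p.1, S 0 p.2)) =
  (1 - expR (- lam * t)) * Ex (mu \x muS)%E g.
Proof.
move=> t0 bg.
have mt : measurable_fun setT (fun e : R => e <= t).
  by apply: measurable_fun_ler => //; exact: measurable_cst.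
have bt : bmf (fun e : R => ind (e <= t) : R) by exact: bmf_bool.
rewrite Ex_fubini1; last first.
  apply: bmfM; first by apply: (bmf_comp bt); exact: measurableT_comp.
  apply: bmf_comp bg _; apply: measurable_fun_pair => //.
  exact: measurableT_comp.
rewrite Ex_fubini1// -ExZ; last exact: bmf_Ex2.
apply: Ex_ext => x /=.
have b2 : bmf (fun q : (R * R) * R => ind (q.1.2 <= t) * g (q.1.1, q.2)).
  apply: bmfM; first by apply: (bmf_comp bt); exact: measurableT_comp.
  apply: bmf_comp bg _; apply: measurable_fun_pair => //.
  exact: measurableT_comp.
have /= -> := mark_Ex ES (k := 0) (X := fun=> x) (measurable_cst _) b2.
rewrite Ex_cst.
rewrite (@Ex_ext _ _ _ _ _ (fun e : R => Ex muS (fun s => g (x, s)) * ind (e <= t))); last first.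
  move=> e; rewrite ExZ; [exact: mulrC|exact: bmf_pair1 bg].
by rewrite ExZ// (waiting_time_cdf ES)// mulrC.
Qed.

(** Bounded, and Lipschitz up to jumps of size at most C at two levels. The class contains
    indicators of half-lines, clamped Lipschitz functions and hitting probabilities. *)
Definition steady (a b C : R) (f : R -> R) : Prop :=
  [/\ measurable_fun setT f, forall x, `|f x| <= C &
   forall x x', x <= x' ->
     `|f x' - f x| <= C * (x' - x) + C * ind ((x < a <= x') || (x < b <= x'))].

(** Bounds the oscillation of a steady function over [y, y + am t]. The windows exclude y itself, so
    for fixed y this tends to 0 with t. *)
Definition osc (a b C t y : R) : R :=
  C * (am * t) + C * (ind (y < a <= y + am * t) + ind (y < b <= y + am * t)).

Lemma bmf_osc a b C t : bmf (osc a b C t).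
Proof.
apply: bmfD; first exact: bmf_cst.
apply/bmfZ/bmfD; apply: bmf_bool; apply: measurable_and.
- by apply: measurable_fun_ltr => //; exact: measurable_cst.
- apply: measurable_fun_ler; first exact: measurable_cst.
  by apply: measurable_funD => //; exact: measurable_cst.
- by apply: measurable_fun_ltr => //; exact: measurable_cst.
- apply: measurable_fun_ler; first exact: measurable_cst.
  by apply: measurable_funD => //; exact: measurable_cst.
Qed.

Lemma steady_osc a b C f t y y' : steady a b C f -> 0 <= t ->
  y <= y' <= y + am * t -> `|f y' - f y| <= osc a b C t y.
Proof.
move=> [_ fC fl] t0 /andP[yy' y't].
have C0 : 0 <= C by exact: le_trans (fC 0).
apply: le_trans (fl _ _ yy') _; rewrite /osc lerD// ?ler_wpM2l//; first by lra.
rewrite -natrD ler_nat; case: (ltP y a) => //= ya; case: (ltP y b) => //= yb;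
  case: (leP a y') => //= ay'; rewrite ?(le_trans ay' y't)//=;
  case: (leP b y') => //= by'; rewrite ?(le_trans by' y't)//= ?leq_addl//.
Qed.

Lemma Ex_osc a b C d' (T' : measurableType d') (M : probability T' R) (g : T' -> R) :
  measurable_fun setT g ->
  Ex M (fun w => osc a b C (tn n) (g w)) @[n --> \oo] --> 0.
Proof.
move=> mg.
have [|n x|x|_] := @Ex_dct _ _ _ M
  (fun n w => osc a b C (tn n) (g w)) (fun=> 0) (`|C| * am + `|C| * 2).
- by move=> n; have [] := bmf_comp (bmf_osc a b C (tn n)) mg.
- rewrite (le_trans (ler_normD _ _))// lerD// normrM ler_wpM2l//.
    rewrite ger0_norm ?mulr_ge0 ?tn_ge0 ?(ltW am_gt0)// ler_piMr ?(ltW am_gt0)//.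
    by rewrite /tn invf_le1// ler1n.
  by rewrite ger0_norm ?addr_ge0// -natrD ler_nat; do 2 case: (_ && _).
- rewrite -[X in _ --> X](_ : C * (am * 0) + C * (0 + 0) = 0); last by ring.
  apply: cvgD; apply: cvgM; try exact: cvg_cst.
    by apply: cvgM; [exact: cvg_cst|exact: cvg_tn].
  by apply: cvgD; exact: cvg_window.
- by rewrite Ex_cst.
Qed.

Lemma steady_bmf a b C f : steady a b C f -> bmf f.
Proof. by move=> [mf fC _]; split => //; exists C. Qed.

Lemma eta_no_jump x t w : 0 <= t -> t < E 0 w -> eta (expR x) t w = flow t x.
Proof.
move=> t0 tE; have := eta_flow ap_gt0 ap_lt_am ES eta_refracted (expR_gt0 x) (n := 0) (w := w) (t := t).
by rewrite jump_timeS jump_time0 add0r t0 tE subr0 expRK => ->.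
Qed.

Lemma eta_one_jump x t w : E 0 w <= t -> t < E 0 w + E 1 w ->
  eta (expR x) t w = flow (t - E 0 w) (flow (E 0 w) x + ln (S 0 w)).
Proof.
move=> tE tE1; have := eta_flow ap_gt0 ap_lt_am ES eta_refracted (expR_gt0 x) (n := 1) (w := w) (t := t).
by rewrite !jump_timeS jump_time0 add0r tE tE1 expRK /= => ->.
Qed.

Definition after (f : R -> R) (x : R) : R := Ex muS (fun s => f (x + ln s)).

Lemma bmf_after f : bmf f -> bmf (after f).
Proof.
move=> bf; apply: (@bmf_Ex2 _ _ _ _ _ _ (fun p : R * R => f (jump p))).
exact: bmf_comp bf measurable_jump.
Qed.

(* Before the first waiting time the process follows the flow, so invariance
   reduces the increment along the flow to the event of a jump before [t]. *)
Lemma flow_increment_bound a b C f (t : R) : 0 <= t -> steady a b C f ->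
  `|Ex mu (fun x => f (flow t x) - f x) -
    (1 - expR (- lam * t)) * (Ex mu f - Ex mu (after f))| <=
  (1 - expR (- lam * t)) *
    (Ex mu (osc a b C t) + Ex (mu \x muS)%E (fun p => osc a b C t (jump p)) +
     4 * C * (1 - expR (- lam * t))).
Proof.
move=> t0 sf; have bf := steady_bmf sf.
have C0 : 0 <= C by case: sf => _ /(_ 0) /(le_trans (normr_ge0 _)).
set p_ := 1 - expR (- lam * t).
have bj : bmf (fun p : R * R => f (jump p)) by exact: bmf_comp bf measurable_jump.
have meta := measurable_eta ap_gt0 ap_lt_am ES eta_refracted t0.
have beta_ : bmf (fun p : R * T => f (eta (expR p.1) t p.2)) := bmf_comp bf meta.
have b1 : bmf (fun p : R * T => f p.1) := bmf_comp bf measurable_fst.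
have mflow : measurable_fun setT (fun p : R * T => flow t p.1).
  by apply: measurable_flow => //; exact: measurable_cst.
have bflow : bmf (fun p : R * T => f (flow t p.1)) := bmf_comp bf mflow.
have mt : measurable_fun setT (fun e : R => e <= t).
  by apply: measurable_fun_ler => //; exact: measurable_cst.
have mE k : measurable_fun setT (fun p : R * T => E k p.2 <= t).
  by apply: (measurableT_comp mt); exact: measurableT_comp.
have bE k : bmf (fun p : R * T => ind (E k p.2 <= t) : R) := bmf_bool (mE k).
have Ex1 (g : R -> R) : bmf g -> Ex mu g = Ex (mu \x P)%E (fun p => g p.1).
  move=> bg; rewrite Ex_fubini1; last exact: bmf_comp bg measurable_fst.
  by apply: Ex_ext => x /=; rewrite Ex_cst.
have mS : measurable_fun setT (fun p : R * T => (p.1, S 0 p.2)).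
  by apply: measurable_fun_pair => //; exact: measurableT_comp.
pose g1 (q : R * R) := f q.1 - f (jump q).
have bg1 : bmf g1 by apply: bmfB => //; exact: bmf_comp bf measurable_fst.
pose g2 (q : R * R) := osc a b C t q.1 + osc a b C t (jump q).
have bg2 : bmf g2.
  by apply: bmfD; [exact: bmf_comp (bmf_osc a b C t) measurable_fst|
                   exact: bmf_comp (bmf_osc a b C t) measurable_jump].
have -> : p_ * (Ex mu f - Ex mu (after f)) =
    Ex (mu \x P)%E (fun p => ind (E 0 p.2 <= t) * g1 (p.1, S 0 p.2)).
  rewrite first_mark_Ex// ExB//; last exact: bmf_comp bf measurable_fst.
  congr (_ * (_ - _)).
    rewrite Ex_fubini1; last exact: bmf_comp bf measurable_fst.
    by apply: Ex_ext => x /=; rewrite Ex_cst.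
  by rewrite Ex_fubini1.
(* Invariance replaces f(x) by f of the process at time t, which equals f of the flow unless a jump
   occurs before t. *)
have -> : Ex mu (fun x => f (flow t x) - f x) =
    Ex (mu \x P)%E (fun p => ind (E 0 p.2 <= t) * (f (flow t p.1) - f (eta (expR p.1) t p.2))).
  rewrite Ex1; last first.
    apply: bmfB => //; apply: bmf_comp bf _.
    by apply: measurable_flow => //; exact: measurable_cst.
  rewrite ExB// -Ex1// (invariant_Ex ap_gt0 ap_lt_am ES eta_refracted nu_inv t0 bf) -ExB//.
  apply: Ex_ext => -[x w] /=; have [Et|tE] := leP (E 0 w) t; first by rewrite mul1r.
  by rewrite eta_no_jump// subrr mul0r.
have -> : p_ * (Ex mu (osc a b C t) + Ex (mu \x muS)%E (fun p => osc a b C t (jump p)) + 4 * C * p_) =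
    Ex (mu \x P)%E (fun p => ind (E 0 p.2 <= t) * g2 (p.1, S 0 p.2) +
       4 * C * (ind (E 0 p.2 <= t) * ind (E 1 p.2 <= t))).
  rewrite [RHS]ExD; last 2 first.
  - by apply: bmfM => //; exact: bmf_comp bg2 mS.
  - by apply/bmfZ/bmfM.
  have two : Ex (mu \x P)%E (fun p => ind (E 0 p.2 <= t) * ind (E 1 p.2 <= t)) = p_ ^+ 2.
    rewrite /p_ -(two_waiting_times ES t0) Ex_fubini1; last exact: bmfM.
    rewrite -[RHS](Ex_cst mu); apply: Ex_ext => x; apply: Ex_ext => w /=.
    by rewrite -natrM mulnb.
  rewrite first_mark_Ex// ExZ; last exact: bmfM.
  rewrite two.
  rewrite [Ex _ g2]ExD; last 2 first.
  - exact: bmf_comp (bmf_osc a b C t) measurable_fst.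
  - exact: bmf_comp (bmf_osc a b C t) measurable_jump.
  rewrite (_ : Ex _ (fun q => osc a b C t q.1) = Ex mu (osc a b C t)).
    by rewrite -/p_ mulrDr expr2 [X in _ + X = _]mulrCA.
  rewrite Ex_fubini1; last exact: bmf_comp (bmf_osc a b C t) measurable_fst.
  by apply: Ex_ext => x /=; rewrite Ex_cst.
apply: Ex_normB.
- by apply: bmfM => //; exact: bmfB.
- by apply: bmfM => //; exact: bmf_comp bg1 mS.
- by apply: bmfD; [apply: bmfM => //; exact: bmf_comp bg2 mS|apply/bmfZ/bmfM].
move=> [x w] /=; have [Et|tE] := leP (E 0 w) t; last by rewrite !mul0r subrr normr0 mulr0 addr0.
rewrite !mul1r /g1 /g2 /=.
have osc_ge0 y : 0 <= osc a b C t y.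
  by rewrite addr_ge0// mulr_ge0// ?mulr_ge0// ?ltW ?am_gt0// addr_ge0.
have tflow y r : 0 <= r <= t -> y <= flow r y <= y + am * t.
  move=> /andP[r0 rt]; have /andP[_ H] := flow_bounds ap_gt0 ap_lt_am y r0.
  rewrite flow_ge//= (le_trans H)// lerD2l ler_wpM2l//; exact: ltW.
have [E1t|tE1] := leP (E 1 w) t.
  rewrite mulr1; have [_ fC _] := sf.
  (* When a second jump is possible only boundedness is used: four values, each at most C. *)
  apply: (@le_trans _ _ (4 * C)); last by rewrite lerDr addr_ge0.
  have := fC (flow t x); have := fC (eta (expR x) t w); have := fC x; have := fC (x + ln (S 0 w)).
  rewrite !ler_norml => /andP[? ?] /andP[? ?] /andP[? ?] /andP[? ?]; apply/andP; split; lra.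
rewrite mulr0 addr0 eta_one_jump//; last first.
  by rewrite (lt_trans tE1)// ltrDr (waiting_time_gt0 ES).
set y := x + ln _; set y' := flow (t - E 0 w) _.
have E0 := ltW (waiting_time_gt0 ES 0 w).
have yy' : y <= y' <= y + am * t.
  have /andP[h1 h2] := flow_bounds ap_gt0 ap_lt_am x E0.
  have r0 : 0 <= t - E 0 w by rewrite subr_ge0.
  have /andP[h3 h4] := flow_bounds ap_gt0 ap_lt_am (flow (E 0 w) x + ln (S 0 w)) r0.
  have : 0 <= ap * E 0 w by rewrite mulr_ge0// ltW.
  have : 0 <= ap * (t - E 0 w) by rewrite mulr_ge0// ltW.
  by move=> ? ?; rewrite /y /y'; apply/andP; split; lra.
have h1 := steady_osc sf t0 (tflow x t (introT andP (conj t0 (lexx t)))).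
have h2 := steady_osc sf t0 yy'.
(* With exactly one jump, the error regroups into one increment along the drift without the jump and
   one for the path shifted by the jump; both cover a drift time at most t. *)
rewrite (_ : _ - _ = (f (flow t x) - f x) - (f y' - f y)); last by ring.
by rewrite (le_trans (ler_normB _ _))// lerD.
Qed.

(** Divide [flow_increment_bound] by t: the jump probability over t tends to [lam] and the remaining
    bracket vanishes. No derivative of f is required, so discontinuous test functions are
    allowed. *)
Theorem flow_increment_cvg a b C f : steady a b C f ->
  (tn n)^-1 * Ex mu (fun x => f (flow (tn n) x) - f x) @[n --> \oo] -->
  lam * (Ex mu f - Ex mu (after f)).
Proof.
move=> sf; set L := Ex mu f - _.
have lam0 := jump_rate_gt0 rho_ge0 ES.
pose q n := (1 - expR (- lam * tn n)) / tn n.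
have qlam : q n @[n --> \oo] --> lam by exact: cvg_exp_rate.
pose om n := Ex mu (osc a b C (tn n)) + Ex (mu \x muS)%E (fun p => osc a b C (tn n) (jump p)) +
     4 * C * (1 - expR (- lam * tn n)).
have om0 : om n @[n --> \oo] --> 0.
  rewrite -[X in _ --> X](_ : 0 + 0 + 4 * C * (lam * 0) = 0); last by ring.
  apply: cvgD.
    by apply: cvgD; [exact: (Ex_osc _ _ _ _ (@measurable_id _ R setT))|exact: Ex_osc measurable_jump].
  apply: cvgM; first exact: cvg_cst.
  rewrite (_ : (fun n => _) = (fun n => q n * tn n)); last first.
    by apply/funext => n; rewrite /q divfK// gt_eqF// tn_gt0.
  by apply: cvgM => //; exact: cvg_tn.
apply/cvgrPdist_le => e e0.
have : q n * om n @[n --> \oo] --> lam * 0 by exact: cvgM.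
rewrite mulr0 => /cvgr0Pnorm_le/(_ (e / 2)).
rewrite divr_gt0// => /(_ isT) H1.
have : (q n - lam) * L @[n --> \oo] --> (lam - lam) * L.
  by apply: cvgM; [apply: cvgB => //; exact: cvg_cst|exact: cvg_cst].
rewrite subrr mul0r => /cvgr0Pnorm_le/(_ (e / 2)).
rewrite divr_gt0// => /(_ isT) H2.
near=> n.
have n1 : `|q n * om n| <= e / 2 by near: n.
have n2 : `|(q n - lam) * L| <= e / 2 by near: n.
have H := flow_increment_bound (tn_ge0 n) sf.
set D := Ex mu (fun x => f (flow (tn n) x) - f x) in H *.
rewrite (_ : _ - _ = - ((tn n)^-1 * D - q n * L) - (q n - lam) * L); last by ring.
rewrite (le_trans (ler_normB _ _))// [leRHS](splitr e) lerD// normrN.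
apply: le_trans n1; apply: le_trans (ler_norm _).
rewrite (_ : _ - _ = (tn n)^-1 * (D - (1 - expR (- lam * tn n)) * L)); last first.
  by rewrite /q; ring.
rewrite normrM gtr0_norm ?invr_gt0 ?tn_gt0// /q mulrAC [leRHS]mulrC.
by rewrite ler_wpM2l// invr_ge0 tn_ge0.
Unshelve. all: by end_near.
Qed.

End generator.

(** * Level fluxes and the identity for truncated test functions *)

Section balance.
Context {R : realType} (am ap : R) (rho : R -> R).
Hypotheses (ap_gt0 : 0 < ap) (ap_lt_am : ap < am).
Context {d : measure_display} {T : measurableType d} (P : probability T R).
Variables E S : nat -> {RV P >-> R}.
Hypothesis ES : compound_poisson rho E S.
Variable eta : R -> R -> T -> R.
Hypothesis eta_refracted : refracted am ap E S eta.
Variable nu : probability (measurableTypeR R) R.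
Hypothesis nu_inv : invariant_law P eta nu.
Hypothesis rho_ge0 : forall s : R, 0 <= s <= 1 -> 0 <= rho s.

Local Notation lam := (jump_rate rho).
Local Notation mu := (log_law nu).
Local Notation flow := (flow am ap).

Let am_gt0 : 0 < am. Proof. exact: lt_trans ap_lt_am. Qed.
Let M := (mu \x P)%E.
Local Notation jmp p := (p.1 + ln (S 0 p.2)).

Lemma measurable_mark : measurable_fun setT (fun p : R * T => jmp p).
Proof.
apply: measurable_funD => //; apply: measurableT_comp; first exact: measurable_ln.
exact: measurableT_comp.
Qed.

Lemma ln_factor_lt0 w : ln (S 0 w) < 0.
Proof. exact/ln_lt0/(jump_factor_itv ES). Qed.

Definition gap (f : R -> R) : R := Ex M (fun p => f p.1 - f (jmp p)).

Lemma gapE f : bmf f -> gap f = Ex mu f - Ex mu (after S f).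
Proof.
move=> bf.
have b1 : bmf (fun p : R * T => f p.1) := bmf_comp bf measurable_fst.
have b2 : bmf (fun p : R * T => f (jmp p)) := bmf_comp bf measurable_mark.
rewrite /gap ExB// !Ex_fubini1//; congr (_ - _).
  by apply: Ex_ext => x /=; rewrite Ex_cst.
apply: Ex_ext => x; apply/esym/Ex_pushforward => //.
apply: (bmf_comp bf); apply: measurable_funD; first exact: measurable_cst.
exact: measurable_ln.
Qed.

Lemma flow_increment_gap a b C f : steady a b C f ->
  (tn n)^-1 * Ex mu (fun x => f (flow (tn n) x) - f x) @[n --> \oo] -->
  lam * gap f.
Proof.
move=> sf; rewrite gapE; last exact: steady_bmf sf.
exact: (flow_increment_cvg ap_gt0 ap_lt_am ES eta_refracted nu_inv rho_ge0 sf).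
Qed.

(** The stationary rate of downward crossings of l by jumps; [flux_cvg] equates it with the rate of
    upward crossings by drift. *)
Definition flux (l : R) : R := lam * gap (fun x => ind (l <= x)).

Lemma steady_ge (l : R) : steady l l 1 (fun x : R => ind (l <= x) : R).
Proof.
split.
- by apply: measurable_ind; apply: measurable_fun_ler => //; exact: measurable_cst.
- by move=> x; case: (l <= x); rewrite ?normr1 ?normr0.
- move=> x x' xx'; rewrite !mul1r orbb.
  have xx0 : 0 <= x' - x by rewrite subr_ge0.
  case: (leP l x) => lx.
    by rewrite (le_trans lx xx') /= subrr normr0 addr0.
  by case: (leP l x') => lx'; rewrite /= subr0 ?normr0 ?normr1 ?lerDr ?addr0.
Qed.

Lemma flux_cvg l :
  (tn n)^-1 * Ex mu (fun x => ind (x < l <= flow (tn n) x)) @[n --> \oo] --> flux l.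
Proof.
rewrite [X in X @ _ --> _](_ : _ = (fun n => (tn n)^-1 *
    Ex mu (fun x => ind (l <= flow (tn n) x) - ind (l <= x)))); last first.
  apply/funext => n; congr (_ * _); apply: Ex_ext => x.
  have := flow_ge ap_gt0 ap_lt_am x (tn_ge0 n).
  case: (leP l x) => lx xf; first by rewrite (le_trans lx xf)/= subrr.
  by rewrite subr0.
exact: flow_increment_gap (steady_ge l).
Qed.

(** Composition with it turns a function Lipschitz on [u, v] into a steady one, whose rate along the
    flow vanishes off [u, v). *)
Definition clamp (u v x : R) : R := Num.min (Num.max x u) v.

Lemma measurable_clamp u v : measurable_fun setT (clamp u v).
Proof.
apply: measurable_minr; last exact: measurable_cst.
by apply: measurable_maxr => //; exact: measurable_cst.
Qed.

Lemma clamp_itv u v x : u <= v -> u <= clamp u v x <= v.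
Proof. by move=> uv; rewrite /clamp le_min uv andbT le_max lexx orbT ge_min lexx orbT. Qed.

Lemma clamp_id u v x : u <= x <= v -> clamp u v x = x.
Proof. by move=> /andP[ux xv]; rewrite /clamp max_l// min_l. Qed.

Lemma clamp_lip u v x y : x <= y -> 0 <= clamp u v y - clamp u v x <= y - x.
Proof.
rewrite /clamp => xy.
by have [?|?] := leP x u; have [?|?] := leP y u; (try have [?|?] := leP u v);
  (try have [?|?] := leP x v); (try have [?|?] := leP y v); apply/andP; split; lra.
Qed.

Section balance_lemma.
Variables (u v L : R) (h D : R -> R).
Hypothesis uv : u <= v.
Hypothesis mh : measurable_fun setT h.
Hypothesis h_lip : forall x y, u <= x -> x <= y -> y <= v -> `|h y - h x| <= L * (y - x).
Hypothesis hD : forall x, u <= x < v ->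
  (tn n)^-1 * (h (flow (tn n) x) - h x) @[n --> \oo] --> D x.
Let h_clamp x y : x <= y -> `|h (clamp u v y) - h (clamp u v x)| <= Num.max L 0 * (y - x).
Proof.
move=> xy; have /andP[c0 c1] := clamp_lip u v xy.
have /andP[ux _] := clamp_itv x uv; have /andP[_ yv] := clamp_itv y uv.
apply: le_trans (h_lip ux _ yv) _; first by rewrite -subr_ge0.
apply: (@le_trans _ _ (Num.max L 0 * (clamp u v y - clamp u v x))).
  by rewrite ler_wpM2r// le_max lexx.
by rewrite ler_wpM2l// le_max lexx orbT.
Qed.

Lemma steady_clamp : exists C, steady 0 0 C (fun x => h (clamp u v x)).
Proof.
pose C := `|h u| + Num.max L 0 * (v - u) + Num.max L 0.
have m0 : 0 <= Num.max L 0 by rewrite le_max lexx orbT.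
have mL : 0 <= Num.max L 0 * (v - u) by rewrite mulr_ge0// subr_ge0.
have C0 : 0 <= C by rewrite !addr_ge0.
exists C; split.
- exact: measurableT_comp mh (measurable_clamp u v).
- move=> x; have /andP[ux xv] := clamp_itv x uv.
  have := h_clamp ux; rewrite (clamp_id (x := u)) ?lexx//.
  rewrite [clamp u v (clamp u v x)]clamp_id ?ux// => H.
  rewrite -(subrK (h u) (h (clamp u v x))) (le_trans (ler_normD _ _))//.
  rewrite /C addrC -addrA lerD2l (le_trans H)//.
  apply: (@le_trans _ _ (Num.max L 0 * (v - u))); last by rewrite lerDl.
  by rewrite ler_wpM2l// lerD2r.
- move=> x x' xx'; rewrite (le_trans (h_clamp xx'))//.
  apply: (@le_trans _ _ (C * (x' - x))); last by rewrite lerDl mulr_ge0.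
  by rewrite ler_wpM2r ?subr_ge0// /C lerDr addr_ge0.
Qed.

(** The clamped difference quotients are bounded by the Lipschitz constant times am and converge
    pointwise, so bounded convergence identifies the limit in [flow_increment_gap]. The interval is
    half-open because the flow moves upwards. *)
Lemma balance : bmf (fun x => D x * ind (u <= x < v)) /\
  Ex mu (fun x => D x * ind (u <= x < v)) = lam * gap (fun x => h (clamp u v x)).
Proof.
have [C sf] := steady_clamp; have bf := steady_bmf sf.
have p := flow_increment_gap sf.
have bff n : bmf (fun x => h (clamp u v (flow (tn n) x)) - h (clamp u v x)).
  apply: bmfB => //; apply: bmf_comp bf _.
  by apply: measurable_flow => //; exact: measurable_cst.
have [n|n x|x|bD H1] := @Ex_dct _ _ _ mu
    (fun n x => (tn n)^-1 * (h (clamp u v (flow (tn n) x)) - h (clamp u v x)))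
    (fun x => D x * ind (u <= x < v)) (Num.max L 0 * am).
- by have [] := bmfZ (tn n)^-1 (bff n).
- have t0 : 0 < tn n :> R := tn_gt0 n; have xf := flow_ge ap_gt0 ap_lt_am x (ltW t0).
  rewrite normrM gtr0_norm ?invr_gt0// mulrC ler_pdivrMr// (le_trans (h_clamp xf))//.
  rewrite -mulrA ler_wpM2l ?le_max ?lexx ?orbT//.
  by have /andP[_] := flow_bounds ap_gt0 ap_lt_am x (ltW t0); rewrite lerBlDl.
- have flow_cvg : flow (tn n) x @[n --> \oo] --> x.
    apply: (@squeeze_cvgr _ _ _ _ (fun=> x) (fun n => x + am * tn n)).
    + apply: nearW => n; rewrite flow_ge ?tn_ge0//=.
      by have /andP[] := flow_bounds ap_gt0 ap_lt_am x (tn_ge0 n).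
    + exact: cvg_cst.
    + rewrite -[X in _ --> X]addr0 -[X in _ + X](mulr0 am); apply: cvgD; first exact: cvg_cst.
      by apply: cvgM; [exact: cvg_cst|exact: cvg_tn].
  have xf n : x <= flow (tn n) x by rewrite flow_ge ?tn_ge0.
  have [xu|ux] := ltP x u.
    rewrite mulr0; apply: cvg_near_cst.
    have /cvgr_lt/(_ u xu) := flow_cvg; apply: filterS => n fu.
    by rewrite /clamp (max_r (ltW xu)) (max_r (ltW fu)) subrr mulr0.
  have [xv|vx] := ltP x v; last first.
    rewrite mulr0; apply: cvg_near_cst; apply: nearW => n.
    by rewrite /clamp !min_r ?subrr ?mulr0// le_max ?vx// (le_trans vx).
  rewrite mulr1; have xuv : u <= x < v by rewrite ux.
  apply: cvg_trans (hD xuv); apply: near_eq_cvg.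
  have /cvgr_lt/(_ v xv) := flow_cvg; apply: filterS => n fv.
  by rewrite !clamp_id ?ux ?(ltW xv)// (le_trans ux)//= ltW.
split=> //; apply: (cvg_unique _ H1) => //.
apply: cvg_trans p; apply: near_eq_cvg; apply: nearW => n.
by rewrite ExZ.
Qed.

End balance_lemma.

End balance.

(** * The identity for unbounded test functions; mass above zero *)

Section normalization.
Context {R : realType} (am ap : R) (rho : R -> R).
Hypotheses (ap_gt0 : 0 < ap) (ap_lt_am : ap < am).
Context {d : measure_display} {T : measurableType d} (P : probability T R).
Variables E S : nat -> {RV P >-> R}.
Hypothesis ES : compound_poisson rho E S.
Variable eta : R -> R -> T -> R.
Hypothesis eta_refracted : refracted am ap E S eta.
Variable nu : probability (measurableTypeR R) R.
Hypothesis nu_inv : invariant_law P eta nu.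
Hypothesis rho_meas : measurable_fun (`[0, 1] : set R) rho.
Hypothesis rho_ge0 : forall s : R, 0 <= s <= 1 -> 0 <= rho s.

Local Notation lam := (jump_rate rho).
Local Notation mu := (log_law nu).
Local Notation flow := (flow am ap).

Let am_gt0 : 0 < am. Proof. exact: lt_trans ap_lt_am. Qed.
Local Notation M := (mu \x P)%E.
Local Notation jmp p := (p.1 + ln (S 0 p.2)).
Local Notation gap := (gap S nu).
Local Notation leb := (@lebesgue_measure R).
Local Notation kappa := (- \int[leb]_(s in `[0, 1]) (ln s * rho s)).
Hypothesis rho_log : ap < kappa < am.

Let loss (s : R) : R := Num.max (- ln s) 0.

Let loss_ge0 s : 0 <= loss s. Proof. by rewrite le_max lexx orbT. Qed.

Let measurable_loss : measurable_fun setT loss.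
Proof.
apply: measurable_maxr; last exact: measurable_cst.
by apply: measurableT_comp => //; exact: measurable_ln.
Qed.

Let lossE w : loss (S 0 w) = - ln (S 0 w).
Proof. by rewrite /loss max_l// oppr_ge0 ltW// (ln_factor_lt0 ES). Qed.

Lemma mark_loss : (\int[P]_w (- ln (S 0 w))%:E = (kappa / lam)%:E)%E.
Proof.
have lam0 := jump_rate_gt0 rho_ge0 ES.
have := factor_density rho_meas rho_ge0 ES measurable_loss loss_ge0.
set I := (\int[P]_w _)%E; set I' := (\int[leb]_(s in _) _)%E => II'.
have IE : (\int[P]_w (- ln (S 0 w))%:E = I)%E.
  by apply: eq_integral => w _; rewrite lossE.
have I'E : (\int[leb]_(s in `[0%R, 1%R]) (ln s * rho s)%:E = - I')%E.
  rewrite -integral_ge0N.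
    apply: eq_integral => s; rewrite inE/= in_itv/= => /andP[s0 s1].
    by rewrite /loss max_l ?oppr_ge0 ?ln_le0// mulNr opprK.
  move=> s /=; rewrite in_itv/= => s01.
  by rewrite lee_fin mulr_ge0// rho_ge0.
have I'0 : (0 <= I')%E.
  apply: integral_ge0 => s /=; rewrite in_itv/= => s01.
  by rewrite lee_fin mulr_ge0// rho_ge0.
(* A priori the integral may be infinite. Its real version would then be 0 by convention, against
   the lower bound ap > 0. *)
have I'k : I' = kappa%:E.
  move: rho_log; rewrite /Rintegral I'E; case: (I') I'0 => [r|_|//] /=.
    by rewrite opprK.
  by rewrite oppr0 => /andP[/ltW]; rewrite leNgt ap_gt0.
rewrite IE; have : (lam%:E * I = kappa%:E)%E by rewrite II'.
have : (0 <= I)%E by apply: integral_ge0 => w _; rewrite lee_fin.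
case: (I) => [r _|_|//].
  by rewrite -EFinM => -[<-]; rewrite mulrAC divff ?mul1r// gt_eqF.
by rewrite mulry gtr0_sg// mul1e.
Qed.

Lemma integrable_loss : M.-integrable setT (fun p : R * T => (- ln (S 0 p.2))%:E).
Proof.
apply/integrableP; split.
  apply/measurable_EFinP; apply: measurableT_comp => //.
  by apply: measurableT_comp; [exact: measurable_ln|exact: measurableT_comp].
rewrite (_ : (fun x => _) = (fun p : R * T => (- ln (S 0 p.2))%:E)); last first.
  by apply/funext => p /=; rewrite ger0_norm// oppr_ge0 ltW// (ln_factor_lt0 ES).
rewrite fubini_tonelli1//=; last 2 first.
- apply/measurable_EFinP; apply: measurableT_comp => //.
  by apply: measurableT_comp; [exact: measurable_ln|exact: measurableT_comp].
- by move=> p; rewrite lee_fin oppr_ge0 ltW// (ln_factor_lt0 ES).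
rewrite /fubini_F/=; under eq_integral do rewrite mark_loss.
by rewrite integral_cst// [X in (_ * X)%E]probability_setT mule1 ltry.
Qed.

(** Remove the clamp by letting [-n, n] grow: the loss at a jump is dominated by L times -ln S,
    which is integrable by [mark_loss]. *)
Lemma gap_limit (L : R) (h D : R -> R) :
  measurable_fun setT h -> (forall x y, x <= y -> `|h y - h x| <= L * (y - x)) ->
  bmf D ->
  (forall x, (tn n)^-1 * (h (flow (tn n) x) - h x) @[n --> \oo] --> D x) ->
  M.-integrable setT (fun p : R * T => (h p.1 - h (jmp p))%:E) /\
  lam * gap h = Ex mu D.
Proof.
move=> mh hL bD hD.
have bal n := @balance _ _ _ _ ap_gt0 ap_lt_am _ _ _ _ _ ES _ eta_refracted _ nu_inv
   rho_ge0 (- n%:R) n%:R L h D _ mh (fun x y _ xy _ => hL x y xy) (fun x _ => hD x).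
have near_itv (x : R) : \forall n \near \oo, - n%:R <= x < n%:R.
  near=> n; have : `|x| < n%:R by near: n; exact: nbhs_infty_gtr.
  by rewrite ltr_norml => /andP[/ltW -> ->].
have L0 : 0 <= L.
  by have := hL 0 1 ler01; rewrite subr0 mulr1; exact: le_trans.
have nN (n : nat) : - n%:R <= n%:R :> R by rewrite (@le_trans _ _ 0) ?oppr_le0.
have H1 : Ex mu (fun x => D x * ind (- n%:R <= x < n%:R)) @[n --> \oo] --> Ex mu D.
  have [mD [C DC]] := bD.
  have [n|n x|x|//] := @Ex_dct _ _ _ mu
    (fun n x => D x * ind (- n%:R <= x < n%:R)) D C.
  - apply: measurable_funM => //; apply: measurable_ind; apply: measurable_and.
      by apply: measurable_fun_ler => //; exact: measurable_cst.
    by apply: measurable_fun_ltr => //; exact: measurable_cst.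
  - rewrite normrM; case: (_ && _); rewrite ?normr1 ?mulr1// normr0 mulr0.
    exact: le_trans (DC x).
  - apply: cvg_near_cst; near=> n.
    have -> : - n%:R <= x < n%:R by near: n; exact: near_itv.
    by rewrite mulr1.
have mm := measurable_mark S.
have mhc n : measurable_fun setT (fun x => h (clamp (- n%:R) n%:R x)).
  by apply: measurableT_comp => //; exact: measurable_clamp.
have jle (p : R * T) : jmp p <= p.1 by rewrite gerDl ltW// (ln_factor_lt0 ES).
have [|||||iH _ H2] := @dominated_convergence _ _ _ M setT measurableT
  (fun n p => (h (clamp (- n%:R) n%:R p.1) - h (clamp (- n%:R) n%:R (jmp p)))%:E)
  (fun p => (h p.1 - h (jmp p))%:E) (fun p => (L * - ln (S 0 p.2))%:E).
- move=> n; apply/measurable_EFinP; apply: measurable_funB.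
    exact: measurableT_comp (mhc n) measurable_fst.
  exact: measurableT_comp (mhc n) mm.
- apply/measurable_EFinP; apply: measurable_funB; exact: measurableT_comp.
- apply: aeW => p _; apply: cvg_near_cst; near=> n.
  have /andP[h1 /ltW h2] : - n%:R <= p.1 < n%:R by near: n; exact: near_itv.
  have /andP[h3 /ltW h4] : - n%:R <= jmp p < n%:R by near: n; exact: near_itv.
  by rewrite !clamp_id ?h1 ?h3.
- rewrite (_ : (fun p => _) = (fun p : R * T => L%:E * (- ln (S 0 p.2))%:E)%E).
    by apply: integrableZl => //; exact: integrable_loss.
  by apply/funext => p; rewrite EFinM.
- apply: aeW => p n _; rewrite /= lee_fin.
  have /andP[c0 c1] := clamp_lip (- n%:R) n%:R (jle p).
  apply: le_trans (hL _ _ _) _; first by rewrite -subr_ge0.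
  by rewrite ler_wpM2l// (le_trans c1)// opprD addNKr.
split=> //; apply: (cvg_unique _ _ H1) => //.
rewrite (_ : (fun n => _) = (fun n => lam * gap (fun x => h (clamp (- n%:R) n%:R x)))).
  apply: cvgM; first exact: cvg_cst.
  apply: fine_cvg; rewrite fineK//; exact: integrable_fin_num.
by apply/funext => n; have [] := bal nN n.
Unshelve. all: by end_near.
Qed.

Lemma flow_rate x : (tn n)^-1 * (flow (tn n) x - x) @[n --> \oo] --> slope am ap x.
Proof.
apply: cvg_near_cst; have [x0|x0] := leP 0 x.
  apply: nearW => n; rewrite flow_nneg ?tn_ge0// /slope x0 addrC addKr mulrCA.
  by rewrite mulVf ?mulr1// gt_eqF// tn_gt0.
have x0' : 0 < - x / am by rewrite divr_gt0// oppr_gt0.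
have /cvgr_lt/(_ _ x0') := @cvg_tn R; apply: filterS => n /=.
rewrite ltr_pdivlMr// => H; rewrite flow_neg//; last by move: H; lra.
by rewrite /slope leNgt x0/= addrC addKr mulrCA mulVf ?mulr1// gt_eqF// tn_gt0.
Qed.

Lemma bmf_slope : bmf (slope am ap).
Proof.
split; first exact: measurable_slope.
exists am => x; have /andP[h1 h2] := slope_bounds ap_lt_am x.
by rewrite ger0_norm// (le_trans _ h1)// ltW.
Qed.

(** The identity as test function: mean drift balances mean jump loss. *)
Lemma mean_slope : Ex mu (slope am ap) = kappa.
Proof.
have lip (x y : R) : x <= y -> `|y - x| <= 1 * (y - x).
  by move=> xy; rewrite mul1r ger0_norm// subr_ge0.
have [_ <-] := gap_limit (h := id) (@measurable_id _ R setT) lip bmf_slope flow_rate.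
have lam0 := jump_rate_gt0 rho_ge0 ES.
rewrite /gap (_ : Ex _ _ = kappa / lam); first by rewrite mulrC divfK// gt_eqF.
rewrite /Ex /Rintegral (eq_integral (fun p : R * T => (- ln (S 0 p.2))%:E)); last first.
  by move=> p _; rewrite opprD addNKr.
rewrite fubini_tonelli1//=; last 2 first.
- apply/measurable_EFinP; apply: measurableT_comp => //.
  by apply: measurableT_comp; [exact: measurable_ln|exact: measurableT_comp].
- by move=> p; rewrite lee_fin oppr_ge0 ltW// (ln_factor_lt0 ES).
rewrite /fubini_F/=; under eq_integral do rewrite mark_loss.
by rewrite integral_cst// [X in (_ * X)%E]probability_setT mule1.
Qed.

Lemma mean_positive :
  Ex mu (fun x => ind (0 <= x)) = (am - kappa) / (am - ap).
Proof.
have := mean_slope.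
rewrite (@Ex_ext _ _ _ _ _ (fun x : R => am - (am - ap) * ind (0 <= x))); last first.
  by move=> x; rewrite /slope; case: (0 <= x); rewrite ?mulr1 ?mulr0 ?subr0// subKr.
have b0 : bmf (fun x : R => ind (0 <= x) : R).
  by apply: bmf_bool; apply: measurable_fun_ler => //; exact: measurable_cst.
rewrite ExB; [|exact: bmf_cst|exact: bmfZ]; rewrite Ex_cst ExZ// => <-.
by field; rewrite gt_eqF// subr_gt0.
Qed.

(** [tau] grows at unit rate along the flow. The extended-real form is the one met after Tonelli in
    the mass computation. *)
Lemma gap_tau :
  (lam%:E * \int[M]_p (tau am ap p.1 - tau am ap (jmp p))%:E = 1)%E.
Proof.
have lip (x y : R) : x <= y -> `|tau am ap y - tau am ap x| <= ap^-1 * (y - x).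
  move=> xy; have H := tau_bound ap_gt0 ap_lt_am xy.
  rewrite -(tau_mono ap_gt0 ap_lt_am) in xy.
  by rewrite ger0_norm ?subr_ge0// [leRHS]mulrC ler_pdivlMr// mulrC.
have rate x : (tn n)^-1 * (tau am ap (flow (tn n) x) - tau am ap x) @[n --> \oo] --> (1 : R).
  apply: cvg_near_cst; apply: nearW => n; rewrite tau_flow//.
  by rewrite addrC addKr mulVf// gt_eqF// tn_gt0.
have [iH H] := gap_limit (@measurable_tau _ am ap) lip (bmf_cst _ 1) rate.
rewrite -[X in (_ * X)%E]fineK; last exact: integrable_fin_num.
by rewrite -EFinM [X in X%:E]H Ex_cst.
Qed.

End normalization.

(** * Exponential tail of the logarithmic law *)

Section tail.
Context {R : realType} (am ap : R) (rho : R -> R).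
Hypotheses (ap_gt0 : 0 < ap) (ap_lt_am : ap < am).
Context {d : measure_display} {T : measurableType d} (P : probability T R).
Variables E S : nat -> {RV P >-> R}.
Hypothesis ES : compound_poisson rho E S.
Variable eta : R -> R -> T -> R.
Hypothesis eta_refracted : refracted am ap E S eta.
Variable nu : probability (measurableTypeR R) R.
Hypothesis nu_inv : invariant_law P eta nu.
Hypothesis rho_ge0 : forall s : R, 0 <= s <= 1 -> 0 <= rho s.

Local Notation lam := (jump_rate rho).
Local Notation mu := (log_law nu).
Local Notation muS := (distribution P (S 0)).
Local Notation flow := (flow am ap).

Local Notation M := (mu \x P)%E.
Local Notation jmp p := (p.1 + ln (S 0 p.2)).
Local Notation gap := (gap S nu).
Local Notation muE := (distribution P (E 0)).
Variable beta : R.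
Hypothesis beta_gt0 : 0 < beta.
Hypothesis beta_root :
  lam * Ex P (fun w => 1 - expR (beta * ln (S 0 w))) = ap * beta.

Let lam_gt0 : 0 < lam. Proof. exact: jump_rate_gt0 rho_ge0 ES. Qed.

Let pos (y : R) : R := Num.max y 0.

Let waiting_cdf_lt (c : R) :
  Ex muE (fun e => ind (e < c)) = pos (1 - expR (- lam * c)).
Proof.
have me (b : R) : measurable_fun setT (fun e : R => e == b).
  by apply: measurable_fun_eqr => //; exact: measurable_cst.
have ml (b : R) : measurable_fun setT (fun e : R => e <= b).
  by apply: measurable_fun_ler => //; exact: measurable_cst.
have H0 : Ex muE (fun e => ind (e == c)) = 0.
  apply: EFin_inj; rewrite -prob_Ex//.
  transitivity (distribution P (E 0) [set c]).
    by congr (P _); apply/seteqP; split=> w /= /eqP.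
  transitivity (exponential_prob lam [set c]); first exact: (waiting_time_law ES).
  by rewrite /exponential_prob integral_set1.
rewrite (@Ex_ext _ _ _ _ _ (fun e : R => ind (e <= c) - ind (e == c))); last first.
  by move=> e; rewrite le_eqVlt; case: eqVneq => [->|] /=; rewrite ?ltxx ?subrr ?subr0.
rewrite ExB; [|exact: bmf_bool (ml c)|exact: bmf_bool (me c)].
rewrite H0 subr0 /pos; have [c0|c0] := leP 0 c.
  rewrite (waiting_time_cdf ES)// max_l// subr_ge0 -expR0 ler_expR mulNr oppr_le0.
  by rewrite mulr_ge0// ltW.
rewrite max_r; last first.
  by rewrite subr_le0 -expR0 ler_expR mulNr oppr_ge0 mulr_ge0_le0// ltW.
have := waiting_time_cdf ES 0 (lexx 0); rewrite mulr0 expR0 subrr => H.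
apply/eqP; rewrite eq_le Ex_ge0// andbT -[leRHS]H.
apply: Ex_le; [exact: bmf_bool (ml c)|exact: bmf_bool (ml 0)|move=> e].
by rewrite ler_nat; case: (leP e c) => // ec; rewrite (le_trans ec (ltW c0)).
Qed.

Definition upper (u : R) : R := Ex mu (fun x => ind (u <= x)).
Local Notation F := upper.

(** The positive part of 1 - exp(-beta o) is the probability that an exponential of rate beta is
    below o. So Z(u) is the stationary probability of jumping from above u to below u by more than
    an independent such exponential. *)
Let Z (u : R) : R :=
  Ex M (fun p => ind (u <= p.1) * pos (1 - expR (beta * (jmp p - u)))).

Let exp_lip (u x y : R) : x <= y -> y <= u ->
  `|expR (beta * y) - expR (beta * x)| <= beta * expR (beta * u) * (y - x).
Proof.
move=> xy yu; rewrite ger0_norm; last by rewrite subr_ge0 ler_expR ler_wpM2l// ltW.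
have -> : expR (beta * x) = expR (beta * y) * expR (- (beta * (y - x))).
  by rewrite -expRD; congr expR; ring.
have h1 := expR_ge1Dx (- (beta * (y - x))).
have h2 : expR (beta * y) <= expR (beta * u) by rewrite ler_expR ler_wpM2l// ltW.
have h3 : 0 < expR (beta * y) by exact: expR_gt0.
have h4 : 0 <= beta * (y - x) by rewrite mulr_ge0 ?subr_ge0// ltW.
have h5 : expR (beta * y) * (1 - expR (- (beta * (y - x)))) <= expR (beta * y) * (beta * (y - x)).
  by rewrite ler_pM2l//; lra.
have h6 : expR (beta * y) * (beta * (y - x)) <= expR (beta * u) * (beta * (y - x)).
  by rewrite ler_wpM2r.
lra.
Qed.

Let exp_rate (k : R) : 0 < k -> (tn n)^-1 * (expR (k * tn n) - 1) @[n --> \oo] --> k.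
Proof.
move=> k0; rewrite (_ : (fun n => _) = fun n => expR (k * tn n) * ((1 - expR (- k * tn n)) / tn n)); last first.
  apply/funext => n; rewrite [RHS]mulrA [in RHS]mulrBr mulr1 -expRD.
  by rewrite [k * _ + _](_ : _ = 0); [rewrite expR0 mulrC|ring].
rewrite -[X in _ --> X]mul1r; apply: cvgM; last exact: cvg_exp_rate.
rewrite -[X in _ --> X]expR0; apply: continuous_cvg; first exact: continuous_expR.
rewrite -[X in _ --> X](mulr0 k); apply: cvgM; [exact: cvg_cst|exact: cvg_tn].
Qed.

Let measurable_decr : measurable_fun setT (fun p : R * T => jmp p).
Proof. exact: measurable_mark. Qed.

Let bmf_pos (u : R) : bmf (fun p : R * T => pos (1 - expR (beta * (jmp p - u)))).
Proof.
split.
  apply: measurable_maxr; last exact: measurable_cst.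
  apply: measurable_funB; first exact: measurable_cst.
  apply: measurableT_comp; first exact: measurable_expR.
  apply: measurable_funM; first exact: measurable_cst.
  by apply: measurable_funB => //; exact: measurable_cst.
exists 1 => p; rewrite /pos ger0_norm ?le_max ?lexx ?orbT// ge_max ler01 andbT.
Qed.

Let bmf_ge (u : R) : bmf (fun p : R * T => ind (u <= p.1) : R).
Proof.
by apply: bmf_bool; apply: measurable_fun_ler => //; exact: measurable_cst.
Qed.

Let pos_expN (y : R) : pos (1 - expR (beta * y)) = if y < 0 then 1 - expR (beta * y) else 0.
Proof.
rewrite /pos; case: ltP => y0.
  by rewrite max_l// subr_ge0 -expR0 ler_expR mulr_ge0_le0// ltW.
by rewrite max_r// subr_le0 -expR0 ler_expR mulr_ge0// ltW.
Qed.

Let exp_clamp (u y : R) : 0 <= u -> expR (beta * clamp 0 u y) =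
  expR (beta * u) - expR (beta * u) * pos (1 - expR (beta * (y - u))) +
  pos (1 - expR (beta * y)).
Proof.
move=> u0; rewrite !pos_expN subr_lt0 mulrBr expRD expRN.
have e0 : expR (beta * u) != 0 by rewrite gt_eqF// expR_gt0.
have [y0|y0] := ltP y 0.
  rewrite (lt_le_trans y0 u0) /clamp (max_r (ltW y0)) min_l// mulr0 expR0.
  by field.
have [yu|uy] := ltP y u; first by rewrite clamp_id ?y0 ?(ltW yu)//; field.
by rewrite /clamp max_l// min_r//; ring.
Qed.

Let bmf_decay : bmf (fun w => 1 - expR (beta * ln (S 0 w))).
Proof.
split.
  apply: measurable_funB; first exact: measurable_cst.
  apply: measurableT_comp; first exact: measurable_expR.
  apply: measurable_funM; first exact: measurable_cst.
  by apply: measurableT_comp => //; exact: measurable_ln.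
exists 1 => w; have H : expR (beta * ln (S 0 w)) <= 1.
  by rewrite -expR0 ler_expR mulr_ge0_le0 ?ltW// (ln_factor_lt0 ES).
by rewrite ger0_norm ?subr_ge0// gerBl expR_ge0.
Qed.

(** Balance for exp(beta x) on [0, u]: in the interior the drift term ap beta exp(beta x) cancels
    the jump term by [beta_root]. What clamping leaves is exp(beta u) Z(u) from the top and Z(0)
    from the bottom. *)
Let Z_scale u : 0 <= u -> expR (beta * u) * Z u = Z 0.
Proof.
move=> u0.
have rate x : 0 <= x < u -> (tn n)^-1 * (expR (beta * flow (tn n) x) - expR (beta * x))
    @[n --> \oo] --> ap * beta * expR (beta * x).
  move=> /andP[x0 xu].
  rewrite (_ : (fun n => _) = (fun n => expR (beta * x) * ((tn n)^-1 * (expR (beta * ap * tn n) - 1)))).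
    rewrite [X in _ --> X](_ : _ = expR (beta * x) * (beta * ap)); last by ring.
    by apply: cvgM; [exact: cvg_cst|apply: exp_rate; rewrite mulr_gt0].
  apply/funext => n; rewrite flow_nneg ?tn_ge0// (_ : beta * _ = beta * x + beta * ap * tn n); last by ring.
  by rewrite expRD; ring.
have [_ bal] := @balance _ _ _ _ ap_gt0 ap_lt_am _ _ _ _ _ ES _ eta_refracted _ nu_inv
   rho_ge0 0 u (beta * expR (beta * u)) (fun x => expR (beta * x))
   (fun x => ap * beta * expR (beta * x)) u0
   (measurableT_comp (@measurable_expR R) (@mulrl_measurable R setT beta))
   (fun x y _ => @exp_lip u x y) rate.
have b1 : bmf (fun p : R * T => ind (0 <= p.1 < u) * expR (beta * p.1)).
  split.
    apply: measurable_funM.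
      apply: measurable_ind; apply: measurable_and.
        by apply: measurable_fun_ler => //; exact: measurable_cst.
      by apply: measurable_fun_ltr => //; exact: measurable_cst.
    apply: measurableT_comp; first exact: measurable_expR.
    by apply: measurable_funM => //; exact: measurable_cst.
  exists (expR (beta * u)) => p; case: (leP 0 p.1) => p0 /=; last by rewrite mul0r normr0 expR_ge0.
  case: (ltP p.1 u) => pu /=; last by rewrite mul0r normr0 expR_ge0.
  by rewrite mul1r ger0_norm ?expR_ge0// ler_expR ler_wpM2l// ltW.
have b2' : bmf (fun p : R * T => 1 - expR (beta * ln (S 0 p.2))).
  exact: bmf_comp bmf_decay measurable_snd.
(* Start below 0: no loss. Start in [0, u): the full exponential loss, corrected at the bottom.
   Start above u: only the part of the jump below u counts. *)
have gapE : gap (fun x => expR (beta * clamp 0 u x)) =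
  Ex M (fun p => ind (0 <= p.1 < u) * expR (beta * p.1) * (1 - expR (beta * ln (S 0 p.2)))) +
  expR (beta * u) * Z u - Z 0.
  rewrite /Z -ExZ; last exact: bmfM.
  rewrite -ExD; [|exact: bmfM|by apply/bmfZ/bmfM].
  rewrite -ExB; [|by apply: bmfD; [exact: bmfM|by apply/bmfZ/bmfM]|exact: bmfM].
  apply: Ex_ext => -[x w] /=; have l0 := ln_factor_lt0 ES w; set l := ln _ in l0 *.
  rewrite subr0; have [x0|x0] := ltP x 0.
    have xl0 : x + l < 0 by lra.
    rewrite leNgt (lt_le_trans x0 u0) /= !mul0r mulr0 addr0 subr0.
    by rewrite /clamp !max_r ?ltW// subrr.
  have [xu|ux] := ltP x u.
    rewrite /= !mul1r mul0r mulr0 addr0 [in X in _ - X]exp_clamp// clamp_id ?x0 ?ltW//.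
    rewrite (pos_expN (x + l - u)) ifT; last by lra.
    have E1 : expR (beta * u) * expR (beta * (x + l - u)) = expR (beta * x) * expR (beta * l).
      by rewrite -!expRD; congr expR; ring.
    lra.
  rewrite /= !mul0r !mul1r add0r [in X in _ - X]exp_clamp//.
  by rewrite /clamp (max_l x0) min_r//; ring.
have first_term : lam * Ex M (fun p => ind (0 <= p.1 < u) * expR (beta * p.1) * (1 - expR (beta * ln (S 0 p.2)))) =
   Ex mu (fun x => ap * beta * expR (beta * x) * ind (0 <= x < u)).
  rewrite Ex_fubini1; last exact: bmfM.
  rewrite -ExZ; last exact: (bmf_Ex2 P (bmfM b1 b2')).
  apply: Ex_ext => x /=; rewrite ExZ// mulrCA beta_root; ring.
move: bal; rewrite gapE mulrBr mulrDr first_term => H.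
have : lam * (expR (beta * u) * Z u) = lam * Z 0.
  by move: H; rewrite -addrA -[LHS]addr0 => /addrI/esym/subr0_eq.
by move/(mulfI (lt0r_neq0 lam_gt0)).
Qed.

Local Notation Lam := (muE \x muS)%E.

(* [- ln s - (lam / beta) * e] is the overshoot below the starting level, if
   positive: [(lam / beta) * e] is an independent exponential of rate [beta]. *)
Let over (q : R * R) : R := - ln q.2 - lam / beta * q.1.

Let measurable_over : measurable_fun setT over.
Proof.
apply: measurable_funB.
  by apply: measurableT_comp => //; apply: measurableT_comp => //; exact: measurable_ln.
by apply: measurable_funM => //; exact: measurable_cst.
Qed.

Let bmf_upper : bmf F.
Proof.
apply: (@bmf_Ex2 _ _ _ _ _ mu (fun p : R * R => ind (p.1 <= p.2))).
by apply: bmf_bool; exact: measurable_fun_ler.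
Qed.

Let bmf_geR (u : R) : bmf (fun x : R => ind (u <= x) : R).
Proof. by apply: bmf_bool; apply: measurable_fun_ler => //; exact: measurable_cst. Qed.

Lemma upper_le (u v : R) : u <= v -> F v <= F u.
Proof.
move=> uv; apply: Ex_le => // x; rewrite ler_nat.
by case: (leP v x) => // vx; rewrite (le_trans uv vx).
Qed.

Lemma upper_ge0 u : 0 <= F u. Proof. exact: Ex_ge0. Qed.

Let over_cdf v s :
  pos (1 - expR (beta * (v + ln s))) = Ex muE (fun e => ind (v < over (e, s))).
Proof.
transitivity (Ex muE (fun e => ind (e < - (beta / lam) * (v + ln s)))).
  rewrite waiting_cdf_lt; congr (pos (1 - expR _)).
  by field; rewrite gt_eqF.
apply: Ex_ext => e; congr (nat_of_bool _)%:R; rewrite /over/=.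
rewrite -(ltr_pM2l (divr_gt0 lam_gt0 beta_gt0)).
rewrite (_ : lam / beta * (- (beta / lam) * _) = - (v + ln s)); last by field; rewrite !gt_eqF.
by apply/idP/idP; lra.
Qed.

Let mlt (u : R) : measurable_fun setT (fun q : R * R => u < over q).
Proof. by apply: measurable_fun_ltr => //; exact: measurable_cst. Qed.

Let bmf_over (u : R) : bmf (fun q : R * R => ind (u < over q) : R).
Proof. exact: bmf_bool. Qed.

(** The event behind Z(u) reads u <= x < u + [over]; integrating x first turns it into a difference
    of tails. *)
Let ZE u : Z u = Ex Lam (fun q => ind (0 < over q) * (F u - F (u + over q))).
Proof.
have bx : bmf (fun p : R * (R * R) => ind (u <= p.1 < u + over p.2) : R).
  apply: bmf_bool; apply: measurable_and.
    by apply: measurable_fun_ler => //; exact: measurable_cst.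
  apply: measurable_fun_ltr => //; apply: measurable_funD; first exact: measurable_cst.
  exact: measurableT_comp.
transitivity (Ex (mu \x Lam)%E (fun p => ind (u <= p.1 < u + over p.2))); last first.
  rewrite Ex_fubini2//; apply: Ex_ext => q.
  case: (ltP 0 (over q)) => o0; last first.
    rewrite mul0r (@Ex_ext _ _ _ _ _ (fun=> 0)) ?Ex_cst// => x.
    by case: (leP u x) => //= ux; case: ltP => // /(le_lt_trans ux); lra.
  rewrite mul1r -ExB//; apply: Ex_ext => x /=.
  case: (leP u x) => ux /=.
    by rewrite ltNge; case: (u + over q <= x); rewrite ?subrr ?subr0.
  by rewrite leNgt (lt_le_trans ux) ?subrr// lerDl ltW.
rewrite /Z Ex_fubini1; last exact: bmfM.
rewrite Ex_fubini1//; apply: Ex_ext => x /=.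
rewrite ExZ; last exact: (bmf_pair1 x (bmf_pos u)).
have bq : bmf (fun q : R * R => ind (x < u + over q) : R).
  apply: bmf_bool; apply: measurable_fun_ltr; first exact: measurable_cst.
  by apply: measurable_funD => //; exact: measurable_cst.
case: (leP u x) => ux; last by rewrite mul0r (@Ex_ext _ _ _ _ _ (fun=> 0)) ?Ex_cst.
rewrite mul1r Ex_fubini2; last exact: bq.
rewrite [RHS](@Ex_pushforward _ _ _ _ _ P muS (S 0))//; last first.
  exact: (bmf_Ex1 _ bq).
apply: Ex_ext => w; rewrite /= addrAC over_cdf.
by apply: Ex_ext => e; congr (nat_of_bool _)%:R; rewrite ltrBlDl.
Qed.

Let over_gt0 : Ex Lam (fun q => ind (0 < over q)) = ap * beta / lam.
Proof.
rewrite Ex_fubini2//.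
rewrite (@Ex_pushforward _ _ _ _ _ P muS (S 0))//; last first.
  exact: (bmf_Ex1 _ (bmf_over 0)).
rewrite -beta_root [RHS]mulrAC divff ?gt_eqF// mul1r; apply: Ex_ext => w.
rewrite -over_cdf add0r pos_expN ifT//.
exact: (ln_factor_lt0 ES).
Qed.

Let upper_cvg0 : F n%:R @[n --> \oo] --> 0.
Proof.
have [n|n x|x|_] := @Ex_dct _ _ _ mu (fun n x => ind (n%:R <= x)) (fun=> 0) 1.
- by have [] := bmf_geR n%:R.
- by case: (_ <= x); rewrite ?normr1 ?normr0.
- apply: cvg_near_cst; near=> n; rewrite leNgt (_ : x < n%:R)//.
  by near: n; exact: nbhs_infty_gtr.
- by rewrite Ex_cst.
Unshelve. all: by end_near.
Qed.

(* Maximum principle: [G] averages its own values further to the right,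
   and vanishes at infinity. *)
Let max_principle (G : R -> R) (B : R) : 0 <= B -> bmf G ->
  (forall u, `|G u| <= B * F u) ->
  (forall u, 0 <= u -> Ex Lam (fun q => ind (0 < over q) * (G u - G (u + over q))) = 0) ->
  forall u, 0 <= u -> G u = 0.
Proof.
move=> B0 bG GB Gavg.
pose s u := sup [set `|G v| | v in [set v | u <= v]].
have [C GC] : exists C, forall u, `|G u| <= C by case: bG.
have has_ub u : has_ubound [set `|G v| | v in [set v | u <= v]].
  by exists C => _ [v _ <-].
have G_le_s u v : u <= v -> `|G v| <= s u.
  by move=> uv; apply: ub_le_sup => //; exists v.
have s_le u c : (forall v, u <= v -> `|G v| <= c) -> s u <= c.
  move=> H; apply: ge_sup; first by exists `|G u|; exists u => /=.
  by move=> _ [v uv <-]; exact: H.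
(* Some fixed distance w is exceeded with positive probability, since a positive overshoot has
   positive probability. *)
have [w [w0 pw]] : exists w, 0 < w /\ 0 < Ex Lam (fun q => ind (w < over q)).
  have [|n x|x|_ H] := @Ex_dct _ _ _ Lam (fun n q => ind (tn n < over q))
    (fun q => ind (0 < over q)) 1.
  - by move=> n; have [] := bmf_over (tn n).
  - by case: (_ < over _); rewrite ?normr1 ?normr0.
  - apply: cvg_near_cst; case: (ltP 0 (over x)) => o0.
      have /cvgr_lt/(_ _ o0) := @cvg_tn R; apply: filterS => n.
      by move=> ->.
    by apply: nearW => n; rewrite ltNge (le_trans o0) ?tn_ge0.
  rewrite over_gt0 in H.
  have p0 : 0 < ap * beta / lam by rewrite divr_gt0// mulr_gt0.
  have /cvgr_gt/(_ _ p0) [N _ /(_ N (leqnn N))] := H.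
  by exists (tn N); split => //; exact: tn_gt0.
have s_ge0 u : 0 <= s u by exact: le_trans (G_le_s u u (lexx u)).
(* A fixed share of the averaging weight sits beyond u + w. Were the supremum smaller there, every
   value beyond u would stay below s(u) by a fixed amount. *)
have step u : 0 <= u -> s u <= s (u + w).
  move=> u0; set pi := Ex Lam (fun q => ind (0 < over q)).
  set pi' := Ex Lam _ in pw.
  have pi0 : 0 < pi by rewrite /pi over_gt0 divr_gt0// mulr_gt0.
  have s_nincr : s (u + w) <= s u.
    by apply: s_le => v uv; apply: G_le_s; rewrite (le_trans _ uv)// lerDl ltW.
  have Gv v : u <= v -> `|G v| <= s u - pi' / pi * (s u - s (u + w)).
    move=> uv; have v0 := le_trans u0 uv.
    have bGo : bmf (fun q : R * R => ind (0 < over q) * G (v + over q)).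
      apply: bmfM => //; apply: (bmf_comp bG).
      by apply: measurable_funD => //; exact: measurable_cst.
    have : pi * `|G v| <= pi * s u - pi' * (s u - s (u + w)).
      have -> : pi * `|G v| = `|Ex Lam (fun q => ind (0 < over q) * G (v + over q))|.
        rewrite -{1}(gtr0_norm pi0) -normrM; congr `| _ |.
        apply/eqP; rewrite -subr_eq0 mulrC; apply/eqP; rewrite -[RHS](Gavg v v0).
        transitivity (Ex Lam (fun q => G v * ind (0 < over q) - ind (0 < over q) * G (v + over q))).
          by rewrite ExB//; [rewrite ExZ|exact: bmfZ (bmf_over 0)].
        by apply: Ex_ext => q; ring.
      rewrite ![_ * s u]mulrC ![_ * (s u - _)]mulrC /pi /pi' -!ExZ// -ExB; last 2 first.
      - exact: bmfZ.
      - exact: bmfZ.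
      apply: le_trans (Ex_norm _ bGo) _; apply: Ex_le.
      - exact: bmf_norm.
      - by apply: bmfB; exact: bmfZ.
      move=> q; case: (ltP 0 (over q)) => o0; last first.
        rewrite mul0r normr0 (_ : (w < over q) = false) ?mulr0 ?subr0//.
        by apply/negbTE; rewrite -leNgt (le_trans o0)// ltW.
      rewrite mul1r mulr1; case: (ltP w (over q)) => ow.
        rewrite mulr1 subKr; apply: G_le_s.
        by rewrite lerD// ltW.
      by rewrite mulr0 subr0; apply: G_le_s; rewrite (le_trans uv)// lerDl ltW.
    rewrite -ler_pdivlMl// => H; apply: le_trans H _.
    by rewrite mulrBr mulKf ?gt_eqF// mulrA (mulrC pi^-1).
  have := s_le u _ Gv.
  rewrite lerBrDl -lerBrDr subrr pmulr_rle0; last by rewrite divr_gt0.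
  by rewrite subr_le0.
have iter u n : 0 <= u -> s u <= s (u + n%:R * w).
  move=> u0; elim: n => [|n IH]; first by rewrite mul0r addr0.
  apply: le_trans IH _; apply: le_trans (step _ _) _.
    by rewrite addr_ge0// mulr_ge0// ltW.
  by rewrite -addrA -natr1 mulrDl mul1r.
move=> u u0; apply/eqP; rewrite -normr_eq0 eq_le normr_ge0 andbT.
apply/ler_addgt0Pr => e e0; rewrite add0r.
(* B + 1 in place of B keeps the divisor positive. *)
have /cvgr0Pnorm_le/(_ _ (divr_gt0 e0 (ltr_wpDl B0 ltr01)))[N _ /(_ N (leqnn N)) FN] := upper_cvg0.
have [n Nn] : exists n : nat, N%:R <= n%:R * w.
  exists (Num.trunc (N%:R / w)).+1; rewrite -ler_pdivrMr//.
  by apply: ltW; exact: truncnS_gt.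
apply: le_trans (G_le_s u u (lexx u)) _; apply: le_trans (iter u n u0) _.
apply: s_le => v uv; apply: le_trans (GB v) _.
have Fv : F v <= e / (B + 1).
  apply: le_trans FN; rewrite ger0_norm ?upper_ge0//; apply: upper_le.
  by rewrite (le_trans Nn)// (le_trans _ uv)// lerDr.
have B1 : 0 < B + 1 by rewrite ltr_wpDl.
apply: le_trans (_ : (B + 1) * F v <= _).
  by rewrite ler_wpM2r ?upper_ge0// lerDl.
by rewrite mulrC -ler_pdivlMr.
Qed.

(** For G(u) = exp(beta h) F(u + h) - F(u), the average required by the maximum principle is
    exp(beta h) Z(u + h) - Z(u), which is 0 by [Z_scale]. Hence G(0) = 0. *)
Lemma upper_exp (h : R) : 0 <= h -> F h = expR (- (beta * h)) * F 0.
Proof.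
move=> h0.
suff H : expR (beta * h) * F h - F 0 = 0.
  by move/subr0_eq : H => <-; rewrite mulrA -expRD addNr expR0 mul1r.
pose G u := expR (beta * h) * F (u + h) - F u.
have bFh : bmf (fun u : R => F (u + h)).
  by apply: (bmf_comp bmf_upper); apply: measurable_funD => //; exact: measurable_cst.
have -> : expR (beta * h) * F h - F 0 = G 0 by rewrite /G add0r.
apply: (max_principle (B := expR (beta * h) + 1)) => //; rewrite /G.
- by apply: bmfB; [exact: bmfZ|exact: bmf_upper].
- move=> u; rewrite (le_trans (ler_normB _ _))// mulrDl mul1r lerD//.
    rewrite ger0_norm ?mulr_ge0 ?expR_ge0 ?upper_ge0//.
    by rewrite ler_wpM2l ?expR_ge0// upper_le// lerDl.
  by rewrite ger0_norm ?upper_ge0.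
- move=> u u0.
  have bo k : bmf (fun q : R * R => ind (0 < over q) * (F (u + k) - F (u + k + over q))).
    apply: bmfM => //; apply: bmfB; first exact: bmf_cst.
    apply: (bmf_comp bmf_upper); apply: measurable_funD => //; exact: measurable_cst.
  rewrite (@Ex_ext _ _ _ _ _ (fun q : R * R =>
     expR (beta * h) * (ind (0 < over q) * (F (u + h) - F (u + h + over q))) -
     ind (0 < over q) * (F (u + 0) - F (u + 0 + over q)))); last first.
    by move=> q; rewrite addr0 [u + _ + h]addrAC; ring.
  rewrite ExB//; last exact: bmfZ.
  rewrite ExZ// -!ZE addr0.
  apply: (mulfI (lt0r_neq0 (expR_gt0 (beta * u)))).
  rewrite mulr0 mulrBr mulrA -expRD -mulrDr Z_scale ?addr_ge0//.
  by rewrite Z_scale// subrr.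
Qed.

(** A jump by ln S crosses 0 with probability F(0) - F(-ln S); [upper_exp] makes this F(0) (1 -
    S^beta), whose mean is given by [beta_root]. *)
Lemma flux0 : flux rho S nu 0 = ap * beta * F 0.
Proof.
rewrite /flux -beta_root -mulrA; congr (_ * _).
have bg : bmf (fun p : R * T => ind (0 <= p.1) - ind (0 <= jmp p) : R).
  apply: bmfB; first exact: bmf_ge.
  exact: bmf_comp (bmf_geR 0) measurable_decr.
rewrite /gap Ex_fubini2// mulrC -ExZ//; apply: Ex_ext => w /=.
have l0 := ln_factor_lt0 ES w; set l := ln _ in l0 *.
have bj : bmf (fun x : R => ind (0 <= x + l) : R).
  apply: bmf_comp (bmf_geR 0) _.
  by apply: measurable_funD => //; exact: measurable_cst.
rewrite ExB// (_ : Ex mu (fun x => ind (0 <= x + l)) = F (- l)); last first.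
  by apply: Ex_ext => x; rewrite -lerBlDr sub0r.
rewrite upper_exp ?oppr_ge0 ?(ltW l0)// mulrN opprK -/(upper 0); ring.
Qed.

End tail.

(** * Hits of two levels within one period *)

Section reaching.
Context {R : realType} (am ap a b : R).
Local Notation flow := (flow am ap).
Local Notation state := (state am ap).

(** The flag [c] is false for the period starting at time 0, which hitting times exclude, and true
    after a jump, when the starting point itself counts as a hit. *)
Definition before (c : bool) (x l : R) : bool := if c then x <= l else x < l.

(** The right inequality is strict because at the end of the period the jump has already
    happened. *)
Definition reach (c : bool) (l x e : R) : bool := before c x l && (l < flow e x).

(** Within a period the path increases, so [a] precedes [b] exactly when it lies between the start
    and [b]. *)
Definition direct (c : bool) (x e : R) : bool :=
  reach c b x e && ~~ (before c x a && (a < b)).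

Definition live (c : bool) (x e : R) : bool := ~~ reach c a x e && ~~ reach c b x e.

Fixpoint live_upto (e s : nat -> R) (x : R) (k : nat) : bool :=
  if k is k'.+1 then live_upto e s x k' && live (0 < k')%N (state e s x k') (e k')
  else true.

Lemma live_uptoP e s x k : reflect
  (forall i, (i < k)%N -> live (0 < i)%N (state e s x i) (e i)) (live_upto e s x k).
Proof.
elim: k => [|k IH] /=; first by apply: ReflectT.
apply: (iffP andP) => [[/IH H Hk] i|H].
  by rewrite ltnS leq_eqVlt => /orP[/eqP->//|]; exact: H.
by split; [apply/IH => i ik; apply: H; exact: ltnW|exact: H].
Qed.

Lemma direct_not_live c x e : direct c x e -> live c x e = false.
Proof. by move=> /andP[rb _]; rewrite /live rb andbF. Qed.

Section measurability.
Context d (T : measurableType d).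

Lemma measurable_before c (x l : T -> R) : measurable_fun setT x -> measurable_fun setT l ->
  measurable_fun setT (fun w => before c (x w) (l w)).
Proof.
by move=> mx ml; case: c; [exact: measurable_fun_ler|exact: measurable_fun_ltr].
Qed.

Lemma measurable_reach c l (x e : T -> R) : measurable_fun setT x -> measurable_fun setT e ->
  measurable_fun setT (fun w => reach c l (x w) (e w)).
Proof.
move=> mx me; apply: measurable_and.
  by apply: measurable_before => //; exact: measurable_cst.
by apply: measurable_fun_ltr; [exact: measurable_cst|exact: measurable_flow].
Qed.

Lemma measurable_direct c (x e : T -> R) : measurable_fun setT x -> measurable_fun setT e ->
  measurable_fun setT (fun w => direct c (x w) (e w)).
Proof.
move=> mx me; apply: measurable_and; first exact: measurable_reach.
apply: measurable_neg; apply: measurable_and; last exact: measurable_cst.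
by apply: measurable_before => //; exact: measurable_cst.
Qed.

Lemma measurable_live c (x e : T -> R) : measurable_fun setT x -> measurable_fun setT e ->
  measurable_fun setT (fun w => live c (x w) (e w)).
Proof.
by move=> mx me; apply: measurable_and; apply: measurable_neg; exact: measurable_reach.
Qed.

Lemma measurable_live_upto (e s : nat -> T -> R) (x : R) k :
  (forall i, (i < k)%N -> measurable_fun setT (e i)) ->
  (forall i, (i < k)%N -> measurable_fun setT (s i)) ->
  measurable_fun setT (fun w => live_upto (e^~ w) (s^~ w) x k).
Proof.
elim: k => [|k IH] me ms /=; first exact: measurable_cst.
apply: measurable_and.
  by apply: IH => i ik; [apply: me|apply: ms]; exact: ltnW.
apply: measurable_live; last exact: me.
apply: (@measurable_state _ _ _ _ _ e s (fun=> x) k); last exact: measurable_cst.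
  by move=> i ik; apply: me; exact: ltnW.
by move=> i ik; apply: ms; exact: ltnW.
Qed.

End measurability.
End reaching.

(** * The probability of hitting one level before another *)

Section hitting.
Context {R : realType} (am ap : R) (rho : R -> R).
Hypotheses (ap_gt0 : 0 < ap) (ap_lt_am : ap < am).
Context {d : measure_display} {T : measurableType d} (P : probability T R).
Variables E S : nat -> {RV P >-> R}.
Hypothesis ES : compound_poisson rho E S.
Variable eta : R -> R -> T -> R.
Hypothesis eta_refracted : refracted am ap E S eta.

Local Notation muS := (distribution P (S 0)).
Local Notation flow := (flow am ap).

Local Notation muE := (distribution P (E 0)).
Variables a b : R.
Hypothesis ab : a != b.

Local Notation J n w := (jump_time E n w).
Local Notation St x w k := (state am ap (E^~ w) (S^~ w) x k).
Local Notation V x w k := (live_upto am ap a b (E^~ w) (S^~ w) x k).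
Local Notation direct := (direct am ap a b).
Local Notation live := (live am ap a b).
Local Notation reach := (reach am ap).

Definition hits_first (x : R) (w : T) : Prop :=
  exists k, V x w k && direct (0 < k)%N (St x w k) (E k w).

Section path.
Variables (x : R) (w : T).

Let hit_reach k l t : J k w <= t < J k.+1 w -> 0 < t -> eta (expR x) t w = l ->
  reach (0 < k)%N l (St x w k) (E k w) /\ t = J k w + (tau am ap l - tau am ap (St x w k)).
Proof.
move=> tJ t0; have /andP[Jt tJ1] := tJ; rewrite (eta_flow ap_gt0 ap_lt_am ES eta_refracted _ tJ) ?expR_gt0// expRK => <-.
split; last by rewrite tau_flow//; ring.
apply/andP; split.
  case: k tJ Jt tJ1 => [|k] tJ Jt tJ1 /=; last by rewrite flow_ge// subr_ge0.
  by rewrite flow_gt// jump_time0 subr0.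
rewrite lt_flowE// tau_flow// ltrD2l ltrBlDl -jump_timeS//.
Qed.

Let reach_hit k l : reach (0 < k)%N l (St x w k) (E k w) ->
  let t := J k w + (tau am ap l - tau am ap (St x w k)) in
  [/\ J k w <= t < J k.+1 w, 0 < t & eta (expR x) t w = l].
Proof.
move=> /andP[bl]; rewrite lt_flowE// -ltrBlDl => lf t.
have tk : tau am ap (St x w k) <= tau am ap l.
  by rewrite tau_mono//; move: bl; rewrite /before; case: ifP => // _ /ltW.
have tJ : J k w <= t < J k.+1 w.
  by rewrite /t jump_timeS lerDl subr_ge0 tk /= ltrD2l.
split=> //.
  case: k bl {lf tk} @t tJ => [|k] bl t tJ.
    by rewrite /t jump_time0 add0r subr_gt0 tau_mono_lt.
  case/andP: tJ => + _; apply: lt_le_trans.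
  by rewrite (le_lt_trans (jump_time_ge0 ES k w))// (jump_time_lt ES).
rewrite (eta_flow ap_gt0 ap_lt_am ES eta_refracted _ tJ) ?expR_gt0// expRK.
by rewrite /t addrC addKr flow_tau.
Qed.

(** In each period a level is hit at most once, at a time read off from [tau], so the comparison of
    two infima becomes a statement about the first period that reaches [b]. *)
Lemma hitting_lt :
  (hitting_time eta (expR x) (expR b) w < hitting_time eta (expR x) (expR a) w)%E <->
  hits_first x w.
Proof.
have Yeq t l : (Y eta (expR x) t w = expR l) <-> (eta (expR x) t w = l).
  by rewrite /Y; split=> [/expR_inj|->].
split.
  move=> /ereal_inf_lt [_ [t [t0 /Yeq tb] <-]] tla.
  have ta t' : 0 < t' -> eta (expR x) t' w = a -> t < t'.
    move=> t'0 t'a; rewrite -lte_fin; apply: lt_le_trans tla _.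
    by apply: ereal_inf_lbound; exists t' => //; split => //; exact/Yeq.
  have [k0 tk0] := jump_time_itv ES w (ltW t0).
  have [rb0 _] := hit_reach tk0 t0 tb.
  have exb : exists k, reach (0 < k)%N b (St x w k) (E k w) by exists k0.
  (* The given hit of [b] need not be the first one; the least period is the one that meets no level
     earlier. *)
  have [k rbk kmin] := ex_minnP exb; have kk0 := kmin _ rb0.
  have [tkJ tk_gt0 tkb] := reach_hit rbk; set tk := _ + _ in tkJ tk_gt0 tkb.
  have tkt : tk <= t.
    move: kk0; rewrite leq_eqVlt => /orP[/eqP kk0|kk0].
      have [_ ->] := hit_reach tk0 t0 tb; by rewrite /tk kk0.
    have /andP[_ /ltW h] := tkJ; apply: le_trans h _.
    by apply: le_trans (le_jump_time ES w kk0) _; case/andP: tk0.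
  exists k; apply/andP; split.
    apply/live_uptoP => i ik; apply/andP; split; apply/negP => ri.
      have [/andP[_ h] h0 /(ta _ h0)] := reach_hit ri.
      have := le_jump_time ES w ik; have /andP[+ _] := tkJ; lra.
    by have := kmin _ ri; rewrite leqNgt ik.
  apply/andP; split=> //; apply/negP => /andP[ba ltab].
  have ra : reach (0 < k)%N a (St x w k) (E k w).
    by rewrite /reach ba /= (lt_trans ltab)//; case/andP: rbk.
  have [_ h0 /(ta _ h0)] := reach_hit ra.
  move: ltab; rewrite -(tau_mono_lt ap_gt0 ap_lt_am); rewrite /tk in tkt; lra.
move=> [k /andP[/live_uptoP Vk /andP[rb nab]]].
have [tJ t0 tb] := reach_hit rb; set t := _ + _ in tJ t0 tb.
have /andP[Jt tJ1] := tJ.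
(* A strict inequality against an infimum needs a bound larger than t for all hits of [a]: either
   later in the same period, or not before the next jump. *)
pose m := if b < a then Num.min (t + (tau am ap a - tau am ap b)) (J k.+1 w) else J k.+1 w.
have tm : t < m.
  rewrite /m; case: ifP => // ba; rewrite lt_min tJ1 andbT ltrDl subr_gt0.
  by rewrite tau_mono_lt.
apply: (@le_lt_trans _ _ t%:E).
  by apply: ereal_inf_lbound; exists t => //; split => //; exact/Yeq.
apply: (@lt_le_trans _ _ m%:E); first by rewrite lte_fin.
apply: le_ereal_inf_tmp => _ [t' [t'0 /Yeq t'a] <-]; rewrite lee_fin.
have [i iJ] := jump_time_itv ES w (ltW t'0).
have [ra t'E] := hit_reach iJ t'0 t'a.
have [ik|ki|ik] := ltngtP i k.
- by have := Vk i ik; rewrite /live ra.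
- apply: (@le_trans _ _ (J k.+1 w)).
    by rewrite /m; case: ifP => // _; rewrite ge_min lexx orbT.
  by apply: le_trans (le_jump_time ES w ki) _; case/andP: iJ.
- subst i; have ba : b < a.
    rewrite lt_neqAle eq_sym ab leNgt; apply/negP => ltab; move: nab.
    by rewrite ltab andbT => /negP; apply; case/andP: ra.
  by rewrite /m ba t'E ge_min /t; apply/orP; left; lra.
Qed.

End path.
Let mE : forall i, measurable_fun setT (E i : T -> R). Proof. by []. Qed.

Let chain_past x j :
  measurable_fun (setT : set (g_sigma_algebraType (past (marks E S) j.*2)))
    ((fun w => (St x w j, V x w j)) : _ -> (R * bool)%type).
Proof.
have mEi i : (i < j)%N ->
    measurable_fun (setT : set (g_sigma_algebraType (past (marks E S) j.*2))) (E i : _ -> R).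
  move=> ij; have -> : E i = marks E S i.*2 by rewrite /marks odd_double doubleK.
  by apply: measurable_past; rewrite ltn_double.
have mSi i : (i < j)%N ->
    measurable_fun (setT : set (g_sigma_algebraType (past (marks E S) j.*2))) (S i : _ -> R).
  move=> ij; have -> : S i = marks E S i.*2.+1 by rewrite /marks/= odd_double/= uphalf_double.
  by apply: measurable_past; rewrite -doubleS leq_double.
pose T' := g_sigma_algebraType (past (marks E S) j.*2).
apply: measurable_fun_pair.
  exact: (@measurable_state _ am ap _ T' (fun i w => E i w) (fun i w => S i w) (fun=> x) j
    mEi mSi (measurable_cst _)).
exact: (@measurable_live_upto _ am ap a b _ T' (fun i w => E i w) (fun i w => S i w) x j mEi mSi).
Qed.

(** The probability of success within N periods, by conditioning on the first one. *)
Fixpoint hit_within (N : nat) (c : bool) (x : R) : R :=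
  if N is N'.+1 then Ex muE (fun e => Ex muS (fun s =>
    ind (direct c x e) + ind (live c x e) * hit_within N' true (flow e x + ln s)))
  else 0.

Lemma hit_within_bmf N c : bmf (hit_within N c) /\ forall x, 0 <= hit_within N c x <= 1.
Proof.
elim: N c => [|N IH] c; first by split; [exact: bmf_cst|move=> x; rewrite lexx ler01].
have [bN N01] := IH true.
pose f (p : (R * R) * R) := ind (direct c p.1.1 p.1.2) +
  ind (live c p.1.1 p.1.2) * hit_within N true (flow p.1.2 p.1.1 + ln p.2).
have m11 : measurable_fun setT (fun p : (R * R) * R => p.1.1) by exact: measurableT_comp.
have m12 : measurable_fun setT (fun p : (R * R) * R => p.1.2) by exact: measurableT_comp.
have bf : bmf f.
  apply: bmfD; first by apply: bmf_bool; exact: measurable_direct.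
  apply: bmfM; first by apply: bmf_bool; exact: measurable_live.
  apply: (bmf_comp bN); apply: measurable_funD; first exact: measurable_flow.
  by apply: measurableT_comp => //; exact: measurable_ln.
have f01 p : 0 <= f p <= 1.
  rewrite /f; have /andP[h0 h1] := N01 (flow p.1.2 p.1.1 + ln p.2).
  have := @direct_not_live _ am ap a b c p.1.1 p.1.2.
  case: (direct _ _ _) => [/(_ isT) ->|_]; first by rewrite mul0r addr0 ler01 lexx.
  by case: (live _ _ _); rewrite ?mul0r ?mul1r add0r ?h0 ?h1 ?lexx ?ler01.
have b2 : bmf (fun p : R * R => Ex muS (fun s => f (p, s))) := bmf_Ex2 muS bf.
split; first exact: (bmf_Ex2 muE b2).
move=> x /=; apply/andP; split.
  by apply: Ex_ge0 => e; apply: Ex_ge0 => s; case/andP: (f01 ((x, e), s)).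
apply: Ex_le_cst => [|e]; first exact: (bmf_pair1 x b2).
apply: Ex_le_cst => [|s]; first exact: (bmf_pair1 (x, e) bf).
by case/andP: (f01 ((x, e), s)).
Qed.

Fixpoint hit_sum (x : R) (N j : nat) (w : T) : R :=
  if N is N'.+1 then ind (V x w j && direct (0 < j)%N (St x w j) (E j w)) +
                     hit_sum x N' j.+1 w
  else 0.

Let hit_sum_live x N j w : V x w j = false -> hit_sum x N j w = 0.
Proof.
elim: N j => [//|N IH] j Vj /=; rewrite Vj/= add0r; apply: IH.
by rewrite /= Vj.
Qed.

(** Markov property at the j-th jump, by [mark_Ex]: the state and the flag of survival depend only
    on earlier marks. *)
Lemma hit_sum_Ex x N j : bmf (hit_sum x N j) /\
  Ex P (hit_sum x N j) = Ex P (fun w => ind (V x w j) * hit_within N (0 < j)%N (St x w j)).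
Proof.
have mSt k : measurable_fun setT (fun w => St x w k).
  by apply: (@measurable_state _ _ _ _ _ (fun i w => E i w) (fun i w => S i w) (fun=> x)) => //; exact: measurable_cst.
have mV k : measurable_fun setT (fun w => V x w k).
  exact: (@measurable_live_upto _ am ap a b _ _ (fun i w => E i w) (fun i w => S i w)).
elim: N j => [|N IH] j.
  split; first exact: bmf_cst.
  by rewrite /= Ex_cst; apply/esym; rewrite (@Ex_ext _ _ _ _ _ (fun=> 0)) ?Ex_cst// => w; rewrite mulr0.
have [bs sE] := IH j.+1.
have bd : bmf (fun w => ind (V x w j && direct (0 < j)%N (St x w j) (E j w)) : R).
  by apply: bmf_bool; apply: measurable_and => //; exact: measurable_direct.
have bVh : bmf (fun w => ind (V x w j.+1) * hit_within N (0 < j.+1)%N (St x w j.+1)).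
  apply: bmfM; first by apply: bmf_bool; exact: mV.
  by apply: bmf_comp (mSt j.+1); have [] := hit_within_bmf N true.
split; first exact: bmfD.
rewrite /= ExD// sE -ExD//.
have [bN _] := hit_within_bmf N true.
pose f (p : ((R * bool) * R) * R) := ind p.1.1.2 * (ind (direct (0 < j)%N p.1.1.1 p.1.2) +
  ind (live (0 < j)%N p.1.1.1 p.1.2) * hit_within N true (flow p.1.2 p.1.1.1 + ln p.2)).
have m111 : measurable_fun setT (fun p : ((R * bool) * R) * R => p.1.1.1).
  by do 2 apply: measurableT_comp => //.
have m112 : measurable_fun setT (fun p : ((R * bool) * R) * R => p.1.1.2).
  by do 2 apply: measurableT_comp => //.
have m12 : measurable_fun setT (fun p : ((R * bool) * R) * R => p.1.2) by exact: measurableT_comp.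
have bf : bmf f.
  apply: bmfM; first exact: bmf_bool.
  apply: bmfD; first by apply: bmf_bool; exact: measurable_direct.
  apply: bmfM; first by apply: bmf_bool; exact: measurable_live.
  apply: (bmf_comp bN); apply: measurable_funD; first exact: measurable_flow.
  by apply: measurableT_comp => //; exact: measurable_ln.
transitivity (Ex P (fun w => f (((St x w j, V x w j), E j w), S j w))).
  apply: Ex_ext => w; rewrite /f /=; case: (V x w j) => /=; last by rewrite !mul0r addr0.
  by rewrite mul1r.
rewrite (mark_Ex ES (@chain_past x j) bf); apply: Ex_ext => w; rewrite /f/=.
have b2 : bmf (fun p : (R * bool) * R => Ex muS (fun s => f (p, s))) := bmf_Ex2 muS bf.
case: (V x w j); last first.
  rewrite mul0r (@Ex_ext _ _ _ _ _ (fun=> 0)) ?Ex_cst// => e.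
  by rewrite (@Ex_ext _ _ _ _ _ (fun=> 0)) ?Ex_cst// => s; rewrite mul0r.
by rewrite mul1r; apply: Ex_ext => e; apply: Ex_ext => s; rewrite mul1r.
Qed.

(** A direct hit ends survival, so at most one period succeeds and the sum is an indicator. *)
Let hit_sumE x w N j : hit_sum x N j w =
  ind `[< exists k, [&& (j <= k < j + N)%N, V x w k & direct (0 < k)%N (St x w k) (E k w)] >].
Proof.
elim: N j => [|N IH] j /=.
  rewrite asboolF// => -[k]; rewrite addn0 => /andP[/andP[jk kj] _].
  by move: (leq_ltn_trans jk kj); rewrite ltnn.
have [Dj|Dj] := boolP (V x w j && _).
  rewrite hit_sum_live ?addr0; last first.
    by move: Dj => /andP[Vj /direct_not_live H]; rewrite /= H andbF.
  rewrite asboolT//; exists j; rewrite leqnn addnS ltnS leq_addr/=.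
  exact: Dj.
rewrite add0r IH; congr (nat_of_bool _)%:R; apply: asbool_equiv_eq; split.
  move=> [k /andP[/andP[jk kN] H]]; exists k.
  by rewrite (ltnW jk) -addSnnS kN H.
move=> [k /andP[/andP[jk kN] H]]; exists k; rewrite addSnnS kN H !andbT.
rewrite ltn_neqAle jk andbT; apply/eqP => jE; move: Dj; rewrite jE.
by move: H => /andP[-> ->].
Qed.

Definition hit_law (x : R) : R := Ex P (fun w => ind `[< hits_first x w >]).

(** The event is the pointwise limit of success within N periods; its measurability comes out of
    that limit. *)
Lemma hit_law_cvg x : measurable_fun setT (fun w => `[< hits_first x w >]) /\
  hit_within N false x @[N --> \oo] --> hit_law x.
Proof.
have [N|N w|w|bh] := @Ex_dct _ _ _ P (fun N => hit_sum x N 0)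
    (fun w => ind `[< hits_first x w >]) 1.
- by have [[]] := hit_sum_Ex x N 0.
- by rewrite hit_sumE; case: (asbool _); rewrite ?normr1 ?normr0.
- apply: cvg_near_cst; have [[k H]|nH] := pselect (hits_first x w).
    exists k.+1 => // N /= kN; rewrite hit_sumE !asboolT//.
      by exists k.
    by exists k; rewrite add0n kN.
  apply: nearW => N; rewrite hit_sumE !asboolF// => -[k /andP[_ H]].
  by apply: nH; exists k.
rewrite (_ : (fun N => Ex P _) = fun N => hit_within N false x); last first.
  apply/funext => N; have [_ ->] := hit_sum_Ex x N 0.
  rewrite -[RHS](Ex_cst P); apply: Ex_ext => w /=; by rewrite mul1r.
split=> //; have [mh _] := bh.
apply: (measurable_fun_bool true).
rewrite (_ : _ @^-1` _ = (fun w => ind `[< hits_first x w >] : R) @^-1` [set 1]).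
  by have := mh measurableT [set 1] (measurable_set1 1); rewrite setTI.
apply/seteqP; split=> w /=; first by move=> ->.
by case: (asbool _) => // /esym/eqP; rewrite oner_eq0.
Qed.

Lemma hit_law01 x : 0 <= hit_law x <= 1.
Proof.
have [mh _] := hit_law_cvg x; apply/andP; split; first exact: Ex_ge0.
apply: Ex_le_cst; first exact: bmf_bool.
by move=> w; case: (asbool _); rewrite ?ler01.
Qed.

Lemma bmf_hit_law : bmf hit_law.
Proof.
have [N|N x|x|//] := @Ex_dct _ _ _ muS (fun N => hit_within N false) hit_law 1.
- by have [[]] := hit_within_bmf N false.
- by have [_ /(_ x)/andP[h0 h1]] := hit_within_bmf N false; rewrite ger0_norm.
- by have [] := hit_law_cvg x.
Qed.

Lemma hit_prob_law x :
  fine (P [set w | (hitting_time eta (expR x) (expR b) w <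
                    hitting_time eta (expR x) (expR a) w)%E]) = hit_law x.
Proof.
have [mh _] := hit_law_cvg x.
rewrite [X in P X](_ : _ = [set w | `[< hits_first x w >]]); first by rewrite prob_Ex.
by apply/seteqP; split=> w /= H; [apply/asboolP/hitting_lt|apply/hitting_lt/asboolP].
Qed.

Let level_null y l : Ex muS (fun s => ind (y + ln s == l)) = 0.
Proof.
rewrite -(factor_singleton ES (l - y)); apply: Ex_ext => s.
by congr (nat_of_bool _)%:R; apply/eqP/eqP => H; lra.
Qed.

Let hit_within_off N x : x != a -> x != b -> hit_within N true x = hit_within N false x.
Proof.
case: N => [|N] xa xb; first by [].
apply: Ex_ext => e; apply: Ex_ext => s.
rewrite /direct/live/reach/before ![x <= _]le_eqVlt.
by rewrite (negbTE xa) (negbTE xb).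
Qed.

(** The flag matters only for a start exactly on a level, and a jump lands there with probability 0.
    Hence one function describes both kinds of period. *)
Let hit_within_after N y :
  Ex muS (fun s => hit_within N true (y + ln s)) = Ex muS (fun s => hit_within N false (y + ln s)).
Proof.
have mj : measurable_fun setT (fun s : R => y + ln s).
  by apply: measurable_funD; [exact: measurable_cst|exact: measurable_ln].
have me (l : R) : bmf (fun s : R => ind (y + ln s == l) : R).
  by apply: bmf_bool; apply: measurable_fun_eqr => //; exact: measurable_cst.
have bw c : bmf (fun s : R => hit_within N c (y + ln s)).
  by apply: (bmf_comp _ mj); have [] := hit_within_bmf N c.
apply/eqP; rewrite -subr_eq0 -normr_eq0 eq_le normr_ge0 andbT.
rewrite -[leRHS](_ : Ex muS (fun s => ind (y + ln s == a) + ind (y + ln s == b)) = 0); last first.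
  by rewrite ExD// !level_null addr0.
apply: Ex_normB => //; first exact: bmfD.
move=> s; have [ya|ya] := eqVneq (y + ln s) a; last first.
  have [yb|yb] := eqVneq (y + ln s) b; last by rewrite hit_within_off// subrr normr0 addr0.
  rewrite add0r /= mulr1n; have [_ /(_ (y + ln s))/andP[h1 h2]] := hit_within_bmf N true.
  have [_ /(_ (y + ln s))/andP[h3 h4]] := hit_within_bmf N false.
  by rewrite ler_norml; apply/andP; split; lra.
apply: (@le_trans _ _ 1); last by rewrite lerDl.
have [_ /(_ (y + ln s))/andP[h1 h2]] := hit_within_bmf N true.
have [_ /(_ (y + ln s))/andP[h3 h4]] := hit_within_bmf N false.
by rewrite ler_norml; apply/andP; split; lra.
Qed.

Definition first_step (x e : R) : R :=
  ind (direct false x e) + ind (live false x e) * after S hit_law (flow e x).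

Let after_unit f y : bmf f -> (forall x, 0 <= f x <= 1) -> 0 <= after S f y <= 1.
Proof.
move=> bf f01; have bj : bmf (fun s : R => f (y + ln s)).
  apply: (bmf_comp bf).
  by apply: measurable_funD; [exact: measurable_cst|exact: measurable_ln].
apply/andP; split; first by apply: Ex_ge0 => s; case/andP: (f01 (y + ln s)).
by apply: Ex_le_cst => // s; case/andP: (f01 (y + ln s)).
Qed.

Let step_unit (r x e : R) : 0 <= r <= 1 ->
  0 <= ind (direct false x e) + ind (live false x e) * r <= 1.
Proof.
move=> /andP[h0 h1]; have := @direct_not_live _ am ap a b false x e.
case: (direct _ _ _) => [/(_ isT) ->|_]; first by rewrite mul0r addr0 ler01 lexx.
by case: (live _ _ _); rewrite ?mul0r ?mul1r add0r ?h0 ?h1 ?lexx ?ler01.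
Qed.

Lemma first_step01 x e : 0 <= first_step x e <= 1.
Proof.
by apply/step_unit/after_unit; [exact: bmf_hit_law|exact: hit_law01].
Qed.

Lemma bmf_first_step x : bmf (first_step x).
Proof.
apply: bmfD.
  by apply: bmf_bool; apply: measurable_direct => //; exact: measurable_cst.
apply: bmfM.
  by apply: bmf_bool; apply: measurable_live => //; exact: measurable_cst.
apply: (bmf_comp (bmf_after _ bmf_hit_law)).
by apply: measurable_flow => //; exact: measurable_cst.
Qed.

(** The limit of the recursion for [hit_within], after dropping the flag behind the jump. *)
Lemma hit_law_step x : hit_law x = Ex muE (first_step x).
Proof.
have [_ cx] := hit_law_cvg x.
pose g N e := ind (direct false x e) + ind (live false x e) *
   after S (hit_within N false) (flow e x).
have mj y : measurable_fun setT (fun s : R => y + ln s).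
  by apply: measurable_funD; [exact: measurable_cst|exact: measurable_ln].
have hE N : hit_within N.+1 false x = Ex muE (g N).
  rewrite /=; apply: Ex_ext => e; rewrite /g /after -hit_within_after.
  have bh : bmf (fun s : R => hit_within N true (flow e x + ln s)).
    by apply: (bmf_comp _ (mj (flow e x))); have [] := hit_within_bmf N true.
  by rewrite ExD; [rewrite Ex_cst ExZ|exact: bmf_cst|exact: bmfZ].
have [N|N e|e|_ H] := @Ex_dct _ _ _ muE g (first_step x) 1.
- apply: measurable_funD.
    by apply: measurable_ind; apply: measurable_direct => //; exact: measurable_cst.
  apply: measurable_funM.
    by apply: measurable_ind; apply: measurable_live => //; exact: measurable_cst.
  have [mw _] : bmf (after S (hit_within N false)).
    by apply: bmf_after; have [] := hit_within_bmf N false.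
  apply: measurableT_comp => //; apply: measurable_flow => //; exact: measurable_cst.
- have [bN N01] := hit_within_bmf N false.
  by have /andP[h0 h1] := step_unit x e (after_unit (flow e x) bN N01); rewrite ger0_norm.
- apply: cvgD; first exact: cvg_cst.
  apply: cvgM; first exact: cvg_cst.
  have [N|N s|s|_ //] := @Ex_dct _ _ _ muS
    (fun N s => hit_within N false (flow e x + ln s)) (fun s => hit_law (flow e x + ln s)) 1.
  + by apply: measurableT_comp (mj _); have [[]] := hit_within_bmf N false.
  + by have [_ /(_ (flow e x + ln s))/andP[h0 h1]] := hit_within_bmf N false; rewrite ger0_norm.
  + by have [] := hit_law_cvg (flow e x + ln s).
apply: (cvg_unique _ _ H) => //.
rewrite (_ : (fun N => Ex muE (g N)) = fun N => hit_within N.+1 false x).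
  by move: cx; rewrite -cvg_shiftS.
by apply/funext => N; rewrite hE.
Qed.

End hitting.

Lemma cvg_dist {R : realType} (u v w : nat -> R) (l : R) :
  (\forall n \near \oo, `|u n - v n| <= w n) ->
  w n @[n --> \oo] --> 0 -> v n @[n --> \oo] --> l -> u n @[n --> \oo] --> l.
Proof.
move=> uvw w0 vl; have : u n - v n @[n --> \oo] --> 0.
  apply: norm_cvg0; apply: (squeeze_cvgr _ (cvg_cst 0) w0).
  by apply: filterS uvw => n ->; rewrite normr_ge0.
move=> uv; rewrite -[X in _ --> X]add0r.
rewrite (_ : u = fun n => (u n - v n) + v n); first exact: cvgD.
by apply/funext => n; rewrite subrK.
Qed.

(** * Balance of fluxes between two levels *)

Section cycle.
Context {R : realType} (am ap : R) (rho : R -> R).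
Hypotheses (ap_gt0 : 0 < ap) (ap_lt_am : ap < am).
Context {d : measure_display} {T : measurableType d} (P : probability T R).
Variables E S : nat -> {RV P >-> R}.
Hypothesis ES : compound_poisson rho E S.
Variable eta : R -> R -> T -> R.
Hypothesis eta_refracted : refracted am ap E S eta.
Variable nu : probability (measurableTypeR R) R.
Hypothesis nu_inv : invariant_law P eta nu.
Hypothesis rho_ge0 : forall s : R, 0 <= s <= 1 -> 0 <= rho s.

Local Notation lam := (jump_rate rho).
Local Notation mu := (log_law nu).
Local Notation muS := (distribution P (S 0)).
Local Notation flow := (flow am ap).

Let am_gt0 : 0 < am. Proof. exact: lt_trans ap_lt_am. Qed.
Local Notation muE := (distribution P (E 0)).
Variables a b : R.
Hypothesis ab : a != b.
Local Notation Q := (hit_law am ap E S a b).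
Local Notation loss t := (1 - expR (- lam * t)).

Let lam_gt0 : 0 < lam. Proof. exact: jump_rate_gt0 rho_ge0 ES. Qed.

Let bQ : bmf Q. Proof. exact: (bmf_hit_law am ap ES). Qed.

Let Q01 x : 0 <= Q x <= 1. Proof. exact: (hit_law01 am ap ES). Qed.

Let jump_arrow y : measurable_fun setT (fun s : R => y + ln s).
Proof. by apply: measurable_funD; [exact: measurable_cst|exact: measurable_ln]. Qed.

Let after01 x : 0 <= after S Q x <= 1.
Proof.
have bj : bmf (fun s : R => Q (x + ln s)) by exact: bmf_comp bQ (jump_arrow x).
apply/andP; split; first by apply: Ex_ge0 => s; case/andP: (Q01 (x + ln s)).
by apply: Ex_le_cst => // s; case/andP: (Q01 (x + ln s)).
Qed.

Let loss_ge0 t : 0 <= t -> 0 <= loss t.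
Proof.
by move=> t0; rewrite subr_ge0 -expR0 ler_expR mulNr oppr_le0 mulr_ge0// ltW.
Qed.

Let loss_le t : loss t <= lam * t.
Proof. by have := expR_ge1Dx (- lam * t); lra. Qed.

Let loss_mono s t : s <= t -> loss s <= loss t.
Proof. by move=> st; rewrite lerB// ler_expR !mulNr lerN2 ler_wpM2l// ltW. Qed.

Let bmf_early t : bmf (fun e : R => ind (e <= t) : R).
Proof. by apply: bmf_bool; apply: measurable_fun_ler => //; exact: measurable_cst. Qed.

Let bmf_late t : bmf (fun e : R => ind (t < e) : R).
Proof. by apply: bmf_bool; apply: measurable_fun_ltr => //; exact: measurable_cst. Qed.

Let bmf_jump_early t x : bmf (fun e : R => ind (e <= t) * after S Q (flow e x)).
Proof.
apply: bmfM => //; apply: (bmf_comp (bmf_after S bQ)).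
by apply: measurable_flow => //; exact: measurable_cst.
Qed.

(** If no level lies on the drift path up to time t, surviving t without a jump amounts to
    restarting at the endpoint, by lack of memory. *)
Lemma hit_law_off t x : 0 <= t ->
  (x < a <= flow t x) = false -> (x < b <= flow t x) = false ->
  Q x = Ex muE (fun e => ind (e <= t) * after S Q (flow e x)) +
        expR (- lam * t) * Q (flow t x).
Proof.
move=> t0 xa xb; have xf := flow_ge ap_gt0 ap_lt_am x t0.
have bs y := bmf_first_step am ap ES a b y.
rewrite (hit_law_step _ _ ES) (hit_law_step _ _ ES a b (flow t x)) -(memoryless ES t0)//.
rewrite -ExD//; last first.
  apply: bmfM => //; apply: (bmf_comp (bs (flow t x))).
  by apply: measurable_funB => //; exact: measurable_cst.
apply: Ex_ext => e; case: (leP e t) => et; last first.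
  rewrite mul0r add0r mul1r /first_step -(flowD ap_gt0 ap_lt_am) (addrC t) subrK.
  have off l : (x < l <= flow t x) = false -> (x < l) = (flow t x < l).
    move=> xl; apply/idP/idP => [xl'|]; last exact: le_lt_trans xf.
    by rewrite ltNge; apply/negP => h; move: xl; rewrite xl' h.
  by rewrite /direct/live/reach/before -(flowD ap_gt0 ap_lt_am) (addrC t) subrK (off _ xa) (off _ xb).
rewrite mul1r mul0r addr0 /first_step.
have off l : (x < l <= flow t x) = false -> reach am ap false l x e = false.
  move=> xl; apply/negP => /andP[/= xl' le]; move: xl; rewrite xl' (le_trans (ltW le))//.
  exact: le_flow.
by rewrite /direct /live !off// add0r mul1r.
Qed.

Let early_sum t x : 0 <= t ->
  0 <= Ex muE (fun e => ind (e <= t) * after S Q (flow e x)) <= loss t.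
Proof.
move=> t0; rewrite -(waiting_time_cdf ES 0 t0); apply/andP; split.
  by apply: Ex_ge0 => e; rewrite mulr_ge0//; case/andP: (after01 (flow e x)).
apply: Ex_le => // e; rewrite -[leRHS]mulr1 ler_wpM2l//.
by case/andP: (after01 (flow e x)).
Qed.

Lemma hit_law_flow t x : 0 <= t ->
  (x < a <= flow t x) = false -> (x < b <= flow t x) = false ->
  `|Q (flow t x) - Q x| <= loss t.
Proof.
move=> t0 xa xb; rewrite (hit_law_off t0 xa xb).
have /andP[h1 h2] := early_sum x t0; have /andP[h3 h4] := Q01 (flow t x).
have p0 := loss_ge0 t0.
have h5 : 0 <= loss t * Q (flow t x) by rewrite mulr_ge0.
have h6 : loss t * Q (flow t x) <= loss t * 1 by rewrite ler_wpM2l.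
by rewrite ler_norml; apply/andP; split; lra.
Qed.

(** Between levels Q changes by at most the probability of a jump during the travel time, and the
    drift covers a distance in at most that distance over ap. The term 1 covers the jumps at the
    levels. *)
Lemma steady_hit_law : steady a b (1 + lam / ap) Q.
Proof.
have C0 : 0 <= lam / ap by rewrite divr_ge0// ltW.
have C1 : 1 <= 1 + lam / ap by rewrite lerDl.
split; first by case: bQ.
  by move=> x; have /andP[h0 h1] := Q01 x; rewrite ger0_norm// (le_trans h1).
move=> x x' xx'; have : 0 <= (1 + lam / ap) * (x' - x).
  by rewrite mulr_ge0 ?subr_ge0// (le_trans _ C1).
have [|] := boolP (_ || _) => [_|/norP[/negbTE xa /negbTE xb]] CC.
  rewrite mulr1; have /andP[? ?] := Q01 x; have /andP[? ?] := Q01 x'.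
  by rewrite ler_norml; apply/andP; split; lra.
have t0 : 0 <= tau am ap x' - tau am ap x by rewrite subr_ge0 tau_mono.
have := @hit_law_flow _ x t0; rewrite flow_tau// => /(_ xa xb) H.
rewrite mulr0 addr0; apply: le_trans H _; apply: le_trans (loss_le _) _.
rewrite mulrDl mul1r -[leLHS]add0r lerD ?subr_ge0// -mulrA ler_wpM2l// ?(ltW lam_gt0)//.
by rewrite ler_pdivlMl// (tau_bound ap_gt0).
Qed.

(** Without a jump before t the path meets [a] first, so success requires a jump. In [hit_law_catch]
    it is failure that requires one. *)
Lemma hit_law_avoid t x : 0 <= t ->
  x < a <= flow t x -> (x < b <= flow t x) = false -> Q x <= loss t.
Proof.
move=> t0 /andP[xa af] xb; rewrite (hit_law_step _ _ ES) -(waiting_time_cdf ES 0 t0).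
apply: Ex_le => //; first exact: (bmf_first_step am ap ES).
move=> e; case: (leP e t) => et.
  by case/andP: (first_step01 am ap ES a b x e).
rewrite /first_step.
have -> : live am ap a b false x e = false.
  rewrite /live /reach /= xa /= (le_lt_trans af)//.
  by rewrite lt_flowE// tau_flow// ltrD2l.
rewrite mul0r addr0 /direct /= xa /=.
case: (ltP a b) => ba; rewrite ?andbF//= andbT /reach /=.
case: (ltP x b) => xb' //=.
by move: xb; rewrite xb' (le_trans ba).
Qed.

Lemma hit_law_catch t x : 0 <= t ->
  x < b <= flow t x -> (x < a <= flow t x) = false -> 1 - Q x <= loss t.
Proof.
move=> t0 /andP[xb bf] xa; rewrite (hit_law_step _ _ ES) -(waiting_time_cdf ES 0 t0).
have bs := bmf_first_step am ap ES a b x.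
rewrite -[X in X - _](Ex_cst muE) -ExB//; last exact: bmf_cst.
apply: Ex_le => //; first by apply: bmfB => //; exact: bmf_cst.
move=> e; case: (leP e t) => et.
  by rewrite lerBlDr lerDl; case/andP: (first_step01 am ap ES a b x e).
rewrite /first_step.
have -> : direct am ap a b false x e = true.
  rewrite /direct /reach /= xb /= (le_lt_trans bf)/=; last first.
    by rewrite lt_flowE// tau_flow// ltrD2l.
  apply/negP => /andP[xa' ab']; move: xa; rewrite xa' (le_trans (ltW ab'))//.
rewrite lerBlDr add0r lerDl mulr_ge0//.
by case/andP: (after01 (flow e x)).
Qed.

Local Notation cross l t x := (x < l <= flow t x).

Let measurable_cross l t : measurable_fun setT (fun x : R => cross l t x).
Proof.
apply: measurable_and.
  by apply: measurable_fun_ltr => //; exact: measurable_cst.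
by apply: measurable_fun_ler; [exact: measurable_cst|apply: measurable_flow => //; exact: measurable_cst].
Qed.

Let bmf_Qflow t : bmf (fun x => Q (flow t x)).
Proof. by apply: (bmf_comp bQ); apply: measurable_flow => //; exact: measurable_cst. Qed.

Let jumpM (p : R * R) : R := p.1 + ln p.2.

Let measurable_jumpM : measurable_fun setT jumpM.
Proof.
by apply: measurable_funD => //; apply: measurableT_comp => //; exact: measurable_ln.
Qed.

Local Notation C := (1 + lam / ap).
Local Notation os t y := (osc am a b C t y).

Let C_ge1 : 1 <= C. Proof. by rewrite lerDl divr_ge0// ltW. Qed.

Let cross_osc t x : 0 <= t -> cross a t x || cross b t x -> 1 <= os t x.
Proof.
move=> t0 h; have C0 : 0 <= C by rewrite (le_trans _ C_ge1).
have /andP[_ fx] := flow_bounds ap_gt0 ap_lt_am x t0.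
have w l : cross l t x -> (x < l <= x + am * t) by move=> /andP[-> /le_trans ->].
have : 1 <= ind (x < a <= x + am * t) + ind (x < b <= x + am * t) :> R.
  by case/orP: h => /w ->; rewrite ?lerDl ?lerDr.
rewrite /osc => h1; have : 0 <= C * (am * t) by rewrite !mulr_ge0// ltW.
have : C * 1 <= C * (ind (x < a <= x + am * t) + ind (x < b <= x + am * t)) by rewrite ler_wpM2l.
move: C_ge1; lra.
Qed.

Let osc_ge0 t x : 0 <= t -> 0 <= os t x.
Proof.
move=> t0; have C0 : 0 <= C by rewrite (le_trans _ C_ge1).
by apply: addr_ge0; apply: mulr_ge0 => //; rewrite mulr_ge0// ltW.
Qed.

Let off (t x : R) : bool := ~~ (cross a t x || cross b t x).

(** Harmonicity: for a start about to cross no level, the change of Q along the drift compensates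
    the mean loss at a jump, to first order in t. Near the levels the oscillation term absorbs the
    error. *)
Let off_increment t x : 0 <= t ->
  `|ind (off t x) * (Q (flow t x) - Q x) - loss t * (Q x - after S Q x)| <=
  loss t * (2 * os t x + Ex muS (fun s => os t (x + ln s))).
Proof.
move=> t0; have p0 := loss_ge0 t0.
have bo : bmf (fun s : R => os t (x + ln s)) by exact: bmf_comp (bmf_osc am a b C t) (jump_arrow x).
have G0 : 0 <= Ex muS (fun s => os t (x + ln s)) by apply: Ex_ge0 => s; exact: osc_ge0.
have o0 := osc_ge0 x t0.
rewrite /off; set G := Ex muS _ in G0 *.
have [c|] := boolP (_ || _).
  rewrite mul0r sub0r normrN normrM (ger0_norm p0) ler_wpM2l//.
  have := cross_osc t0 c; have /andP[? ?] := Q01 x; have /andP[? ?] := after01 x.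
  by move=> ?; rewrite ler_norml; apply/andP; split; lra.
move=> /norP[/negbTE xa /negbTE xb]; rewrite mul1r [X in Q (flow t x) - X](hit_law_off t0 xa xb).
set A := Ex muE _.
have HA : `|A - loss t * after S Q x| <= loss t * G.
  have onE (f : R -> R) : bmf f -> Ex muE f = Ex P (fun w => f (E 0 w)).
    by move=> bf; exact: Ex_pushforward.
  rewrite /A -(waiting_time_cdf ES 0 t0) mulrC [X in _ <= X]mulrC -!ExZ//.
  have b1 : bmf (fun e : R => ind (e <= t) * after S Q (flow e x)) := bmf_jump_early t x.
  have b2 (c : R) : bmf (fun e : R => c * ind (e <= t)) := bmfZ c (bmf_early t).
  have bE (f : R -> R) : bmf f -> bmf (fun w => f (E 0 w)) by move=> bf; exact: bmf_comp bf _.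
  rewrite !onE//; apply: Ex_normB; [exact: bE b1|exact: bE (b2 _)|exact: bE (b2 _)|].
  move=> w; set e := E 0 w; rewrite [_ * ind _]mulrC -mulrBr normrM normr_nat [X in _ <= X]mulrC.
  have e0 : 0 <= e by rewrite ltW// (waiting_time_gt0 ES).
  case: (leP e t) => et; rewrite ?mul0r// !mul1r.
  apply: Ex_normB => //; [exact: bmf_comp bQ (jump_arrow _)|exact: bmf_comp bQ (jump_arrow _)|].
  move=> s; apply: (steady_osc steady_hit_law t0).
  have /andP[_ f2] := flow_bounds ap_gt0 ap_lt_am x e0.
  have : am * e <= am * t by rewrite ler_wpM2l// ltW.
  have := flow_ge ap_gt0 ap_lt_am x e0 => ? ?.
  by apply/andP; split; lra.
have HQ : `|loss t * Q (flow t x) - loss t * Q x| <= loss t * os t x.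
  rewrite -mulrBr normrM (ger0_norm p0) ler_wpM2l//.
  apply: (steady_osc steady_hit_law t0); have /andP[_ ->] := flow_bounds ap_gt0 ap_lt_am x t0.
  by rewrite flow_ge.
have : 0 <= loss t * os t x by rewrite mulr_ge0.
move: HA HQ; rewrite !ler_norml => /andP[? ?] /andP[? ?] ?; apply/andP; split; lra.
Qed.

Let cvg_loss : loss (tn n) @[n --> \oo] --> (0 : R).
Proof.
rewrite (_ : (fun n => _) = (fun n => (1 - expR (- lam * tn n)) / tn n * tn n)); last first.
  by apply/funext => n; rewrite divfK// gt_eqF// tn_gt0.
rewrite -[X in _ --> X](mulr0 lam); apply: cvgM; [exact: cvg_exp_rate|exact: cvg_tn].
Qed.

(** Starts outside the windows already produce the whole limit [lam * gap Q]. Against the generator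
    identity for Q, this leaves 0 for the windows. *)
Let cvg_off : (tn n)^-1 * Ex mu (fun x => ind (off (tn n) x) * (Q (flow (tn n) x) - Q x))
  @[n --> \oo] --> lam * gap S nu Q.
Proof.
rewrite gapE//; set L := _ - _.
have bg := bmf_after S bQ.
pose q n := (1 - expR (- lam * tn n)) / tn n.
have qlam : q n @[n --> \oo] --> lam by exact: cvg_exp_rate.
pose om n := 2 * Ex mu (osc am a b C (tn n)) +
  Ex mu (fun x => Ex muS (fun s => os (tn n) (x + ln s))).
have bos n : bmf (fun p : R * R => os (tn n) (jumpM p)).
  exact: bmf_comp (bmf_osc am a b C (tn n)) measurable_jumpM.
have om0 : om n @[n --> \oo] --> (0 : R).
  rewrite -[X in _ --> X](_ : 2 * 0 + 0 = 0); last by ring.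
  apply: cvgD.
    apply: cvgM; first exact: cvg_cst.
    exact: (Ex_osc ap_gt0 ap_lt_am _ _ _ _ (@measurable_id _ R setT)).
  have := @Ex_osc _ _ _ ap_gt0 ap_lt_am a b C _ _ (mu \x muS)%E _ measurable_jumpM.
  apply: cvg_trans; apply: near_eq_cvg; apply: nearW => n.
  exact: (Ex_fubini1 mu muS (bos n)).
have qL : q n * L @[n --> \oo] --> lam * L by apply: cvgM => //; exact: cvg_cst.
have qom : q n * om n @[n --> \oo] --> (0 : R) by rewrite -[X in _ --> X](mulr0 lam); exact: cvgM.
apply: (cvg_dist _ qom qL); apply: nearW => n.
have t0 : 0 < tn n :> R := tn_gt0 n; have bosn := bmf_osc am a b C (tn n).
have bG : bmf (fun x : R => Ex muS (fun s => os (tn n) (x + ln s))) := bmf_Ex2 muS (bos n).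
have boff : bmf (fun x => ind (off (tn n) x) * (Q (flow (tn n) x) - Q x)).
  apply: bmfM; last exact: bmfB.
  by apply: bmf_bool; apply: measurable_neg; exact: measurable_or.
have -> : q n * om n = (tn n)^-1 * (loss (tn n) * om n) by rewrite /q; ring.
have -> : q n * L = (tn n)^-1 * (loss (tn n) * L) by rewrite /q; ring.
rewrite -mulrBr normrM gtr0_norm ?invr_gt0// ler_wpM2l ?invr_ge0 ?(ltW t0)//.
have bos2 : bmf (fun x => 2 * os (tn n) x) by exact: bmfZ.
have -> : loss (tn n) * om n = Ex mu (fun x => loss (tn n) *
    (2 * os (tn n) x + Ex muS (fun s => os (tn n) (x + ln s)))).
  by rewrite ExZ; [rewrite ExD// ExZ|exact: bmfD].
rewrite /L -ExB// -ExZ; last exact: bmfB.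
apply: Ex_normB => //; [by apply/bmfZ/bmfB|by apply/bmfZ/bmfD|].
by move=> x; exact: off_increment (ltW t0).
Qed.

Let hit_law_near l t x : 0 <= t -> cross l t x ->
  (l < a <= flow t x) = false -> (l < b <= flow t x) = false ->
  `|Q (flow t x) - Q l| <= loss t.
Proof.
move=> t0 /andP[xl lf] la lb.
have s0 : 0 <= tau am ap (flow t x) - tau am ap l by rewrite subr_ge0 tau_mono.
have := @hit_law_flow _ l s0; rewrite flow_tau// => /(_ la lb) H.
apply: le_trans H _; apply: loss_mono; rewrite tau_flow// lerBlDr addrC lerD2l.
by rewrite tau_mono// ltW.
Qed.

(** Crossing [a], Q passes from about 0 to about Q(a); crossing [b], from about 1 to about Q(b). The
    bound on t prevents both crossings at once. *)
Let level_increment t x : 0 <= t -> am * t < `|a - b| ->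
  `|ind (~~ off t x) * (Q (flow t x) - Q x) -
    (Q a * ind (cross a t x) - (1 - Q b) * ind (cross b t x))| <=
  2 * loss t * (ind (cross a t x) + ind (cross b t x)).
Proof.
move=> t0 tab; rewrite /off negbK.
have /andP[_ fx] := flow_bounds ap_gt0 ap_lt_am x t0.
have [ca|/negbTE ca] := boolP (cross a t x); have [cb|/negbTE cb] := boolP (cross b t x).
- case/andP: ca cb => xa af /andP[xb bf]; move: tab.
  by rewrite ltNge ler_norml => /negP[]; apply/andP; split; lra.
- have := ca => /andP[xa af].
  have lb : (a < b <= flow t x) = false.
    by apply/negP => /andP[h1 h2]; move: cb; rewrite (lt_trans xa h1) h2.
  have := hit_law_near t0 ca _ lb; rewrite ltxx/= => /(_ erefl) H.
  have := hit_law_avoid t0 ca cb; move: H (Q01 x); rewrite !ler_norml.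
  move: (Q x) (Q a) (Q b) (Q (flow t x)) (loss t) => q qa qb qf r /= /andP[? ?] /andP[? ?] ?.
  by apply/andP; split; lra.
- have := cb => /andP[xb bf].
  have la : (b < a <= flow t x) = false.
    by apply/negP => /andP[h1 h2]; move: ca; rewrite (lt_trans xb h1) h2.
  have := hit_law_near t0 cb la; rewrite ltxx/= => /(_ erefl) H.
  have := hit_law_catch t0 cb ca; move: H (Q01 x); rewrite !ler_norml.
  move: (Q x) (Q a) (Q b) (Q (flow t x)) (loss t) => q qa qb qf r /= /andP[? ?] /andP[? ?] ?.
  by apply/andP; split; lra.
- by rewrite /= !(mul0r, mulr0, addr0, subr0, normr0).
Qed.

(** The window contributions are the jumps of Q weighted by the crossing rates, and their limit is
    0. *)
Lemma flux_balance : flux rho S nu a * Q a = flux rho S nu b * (1 - Q b).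
Proof.
have boff c n : bmf (fun x => ind (c (+) off (tn n) x) * (Q (flow (tn n) x) - Q x)).
  apply: bmfM; last exact: bmfB.
  apply: bmf_bool; rewrite /off; case: c => /=.
    by under eq_fun do rewrite negbK; exact: measurable_or.
  by apply: measurable_neg; exact: measurable_or.
have lim_window : (tn n)^-1 * Ex mu (fun x => ind (~~ off (tn n) x) * (Q (flow (tn n) x) - Q x))
    @[n --> \oo] --> (0 : R).
  have h := flow_increment_gap ap_gt0 ap_lt_am ES eta_refracted nu_inv rho_ge0 steady_hit_law.
  rewrite [X in X @ _ --> _](_ : _ = fun n =>
      (tn n)^-1 * Ex mu (fun x => Q (flow (tn n) x) - Q x) -
      (tn n)^-1 * Ex mu (fun x => ind (off (tn n) x) * (Q (flow (tn n) x) - Q x))).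
    by rewrite -[X in _ --> X](subrr (lam * gap S nu Q)); exact: cvgB cvg_off.
  apply/funext => n; rewrite -mulrBr -ExB//; [|exact: bmfB|exact: (boff false)].
  by congr (_ * _); apply: Ex_ext => x; case: (off _ x); rewrite ?mul1r ?mul0r ?subr0 ?subrr.
apply/eqP; rewrite -subr_eq0; apply/eqP; apply: cvg_unique lim_window => //.
have fc l := @flux_cvg _ _ _ _ ap_gt0 ap_lt_am _ _ _ _ _ ES _ eta_refracted _ nu_inv rho_ge0 l.
have fca := fc a; have fcb := fc b.
apply: (cvg_dist (v := fun n => (tn n)^-1 * Ex mu (fun x => ind (cross a (tn n) x)) * Q a -
    (tn n)^-1 * Ex mu (fun x => ind (cross b (tn n) x)) * (1 - Q b))
  (w := fun n => 2 * loss (tn n) * ((tn n)^-1 * Ex mu (fun x => ind (cross a (tn n) x)) +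
    (tn n)^-1 * Ex mu (fun x => ind (cross b (tn n) x))))); last 2 first.
- rewrite -[X in _ --> X](_ : 2 * 0 * (flux rho S nu a + flux rho S nu b) = 0); last by ring.
  apply: cvgM; last exact: cvgD.
  by apply: cvgM => //; exact: cvg_cst.
- by apply: cvgB; apply: cvgM => //; exact: cvg_cst.
have ab0 : 0 < `|a - b| / am by rewrite divr_gt0// normr_gt0 subr_eq0.
have /cvgr_lt/(_ _ ab0) := @cvg_tn R; apply: filterS => n /=.
rewrite ltr_pdivlMr// mulrC => tab.
have t0 : 0 < tn n :> R := tn_gt0 n.
have bc l : bmf (fun x : R => ind (cross l (tn n) x) : R) by exact: bmf_bool.
set Wa := Ex mu (fun x => ind (cross a _ x)); set Wb := Ex mu (fun x => ind (cross b _ x)).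
have -> : (tn n)^-1 * Wa * Q a - (tn n)^-1 * Wb * (1 - Q b) =
   (tn n)^-1 * (Q a * Wa - (1 - Q b) * Wb) by ring.
have -> : 2 * loss (tn n) * ((tn n)^-1 * Wa + (tn n)^-1 * Wb) =
   (tn n)^-1 * (2 * loss (tn n) * (Wa + Wb)) by ring.
rewrite -mulrBr normrM gtr0_norm ?invr_gt0// ler_wpM2l ?invr_ge0 ?(ltW t0)//.
rewrite /Wa /Wb -ExD// -!ExZ//; last exact: bmfD.
rewrite -ExB; [|exact: bmfZ|exact: bmfZ].
apply: Ex_normB; [exact: (boff true)|by apply: bmfB; exact: bmfZ|by apply/bmfZ/bmfD|].
by move=> x; exact: level_increment (ltW t0) tab.
Qed.
End cycle.

Lemma integral_oc {R : realType} (F f : R -> R) (u v : R) : 0 < u -> u <= v ->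
  (forall x : R, 0 < x -> is_derive x 1 F (f x)) ->
  (forall x : R, 0 < x -> {for x, continuous f}) ->
  (\int[lebesgue_measure]_(x in `]u, v]) (f x)%:E = (F v - F u)%:E)%E.
Proof.
move=> u0; rewrite le_eqVlt => /predU1P[->|uv] dF cf.
  by rewrite set_itvoc0 integral_set0 subrr.
have pos (x : R) : u <= x -> 0 < x by exact: lt_le_trans.
have cF (x : R) : 0 < x -> {for x, continuous F}.
  by move=> x0; apply/differentiable_continuous/derivable1_diffP; case: (dF x x0).
have cfw : {within `[u, v], continuous f}.
  by apply: continuous_in_subspaceT => x; rewrite inE/= in_itv/= => /andP[/pos x0 _]; exact: cf.
rewrite integral_itv_obnd_cbnd; last first.
  apply/measurable_EFinP; apply: (@measurable_funS _ _ _ _ `[u, v]) => //.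
    exact: subset_itv_oc_cc.
  exact: subspace_continuous_measurable_fun.
rewrite (@continuous_FTC2 _ f F _ _ uv cfw)//.
- split.
  + by move=> x; rewrite in_itv/= => /andP[/ltW/pos x0 _]; case: (dF x x0).
  + exact/cvg_at_right_filter/cF.
  + exact/cvg_at_left_filter/cF/pos/ltW.
- move=> x; rewrite in_itv/= => /andP[/ltW/pos x0 _].
  by rewrite derive1E; case: (dF x x0) => _ ->.
Qed.

Lemma tonelli_lebesgue {R : realType} d (T : measurableType d) (M : probability T R)
    (F : R * T -> R) : measurable_fun setT F -> (forall q, 0 <= F q) ->
  (\int[lebesgue_measure]_x \int[M]_p (F (x, p))%:E =
   \int[M]_p \int[lebesgue_measure]_x (F (x, p))%:E)%E.
Proof.
move=> mF F0; apply: (@fubini_tonelli _ _ _ _ _ (@lebesgue_measure R) M (EFin \o F)).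
  exact/measurable_EFinP.
by move=> q; rewrite lee_fin.
Qed.

(** * Density and total mass of the measure built from hitting probabilities *)

Section mass.
Context {R : realType} (am ap : R) (rho : R -> R).
Hypotheses (ap_gt0 : 0 < ap) (ap_lt_am : ap < am).
Context {d : measure_display} {T : measurableType d} (P : probability T R).
Variables E S : nat -> {RV P >-> R}.
Hypothesis ES : compound_poisson rho E S.
Variable eta : R -> R -> T -> R.
Hypothesis eta_refracted : refracted am ap E S eta.
Variable nu : probability (measurableTypeR R) R.
Hypothesis nu_inv : invariant_law P eta nu.
Hypothesis rho_meas : measurable_fun (`[0, 1] : set R) rho.
Hypothesis rho_ge0 : forall s : R, 0 <= s <= 1 -> 0 <= rho s.

Local Notation lam := (jump_rate rho).
Local Notation mu := (log_law nu).
Local Notation flow := (flow am ap).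

Local Notation M := (mu \x P)%E.
Local Notation jmp p := (p.1 + ln (S 0 p.2)).
Local Notation leb := (@lebesgue_measure R).
Local Notation gap := (gap S nu).
Local Notation fx := (flux rho S nu).
Hypothesis flux0_gt0 : 0 < fx 0.
Local Notation kappa := (- \int[leb]_(s in `[0, 1]) (ln s * rho s)).
Hypothesis rho_log : ap < kappa < am.

Local Notation Q := (hit_law am ap E S).

Let jmp_lt (p : R * T) : jmp p < p.1.
Proof. by rewrite gtrDl (ln_factor_lt0 ES). Qed.

Lemma flux_Ex l : fx l = lam * Ex M (fun p => ind (jmp p < l <= p.1)).
Proof.
congr (_ * _); apply: Ex_ext => p; have := jmp_lt p.
case: (ltP (jmp p) l) => jl h /=; first by rewrite subr0.
by rewrite (le_trans jl (ltW h))/= subrr.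
Qed.

Lemma flux_ge0 l : 0 <= fx l.
Proof. by rewrite flux_Ex mulr_ge0 ?Ex_ge0// ltW// (jump_rate_gt0 rho_ge0 ES). Qed.

Lemma hit_law_disjoint a b x : a != b -> Q a b x + Q b a x <= 1.
Proof.
move=> ab; have [m1 _] := hit_law_cvg am ap ES a b x; have [m2 _] := hit_law_cvg am ap ES b a x.
rewrite -ExD; [|exact: bmf_bool|exact: bmf_bool].
apply: Ex_le_cst => [|w]; first by apply: bmfD; exact: bmf_bool.
have [h1|h1] := pselect (hits_first am ap E S a b x w); last first.
  by rewrite (asboolF h1) add0r lern1 leq_b1.
rewrite (asboolT h1) asboolF ?addr0// => h2.
have ba : b != a by rewrite eq_sym.
have := (hitting_lt ap_gt0 ap_lt_am ES eta_refracted ab x w).2 h1.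
have := (hitting_lt ap_gt0 ap_lt_am ES eta_refracted ba x w).2 h2.
by move=> /lt_trans H /H; rewrite ltxx.
Qed.

(** From b, the event of returning before a and its opposite are disjoint, so [flux_balance] gives
    one inequality; exchanging the levels gives the other. *)
Lemma flux_symmetry a b : a != b -> fx a * Q a b a = fx b * Q b a b.
Proof.
move=> ab; have ba : b != a by rewrite eq_sym.
have h1 := flux_balance ap_gt0 ap_lt_am ES eta_refracted nu_inv rho_ge0 ab.
have h2 := flux_balance ap_gt0 ap_lt_am ES eta_refracted nu_inv rho_ge0 ba.
apply/eqP; rewrite eq_le; apply/andP; split.
  rewrite h2 ler_wpM2l ?flux_ge0//.
  by have := hit_law_disjoint a ab; lra.
rewrite h1 ler_wpM2l ?flux_ge0//.
by have := hit_law_disjoint b ab; lra.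
Qed.

Lemma hit_law_up_gt0 a b : a < b -> 0 < Q a b a.
Proof.
move=> ab; have t0 : 0 <= tau am ap b - tau am ap a by rewrite subr_ge0 tau_mono// ltW.
rewrite (hit_law_step _ _ ES); apply: (@lt_le_trans _ _ (expR (- lam * (tau am ap b - tau am ap a)))).
  exact: expR_gt0.
rewrite -(waiting_time_ccdf ES 0 t0); apply: Ex_le.
- by apply: bmf_bool; apply: measurable_fun_ltr => //; exact: measurable_cst.
- exact: (bmf_first_step am ap ES).
move=> e; case: (ltP _ e) => et; last by case/andP: (first_step01 am ap ES a b a e).
rewrite /first_step /direct /reach /= ab ltxx/= lt_flowE// -ltrBlDl et /=.
by rewrite lerDl mulr_ge0// Ex_ge0// => s; case/andP: (hit_law01 am ap ES a b (flow e a + ln s)).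
Qed.

(** [flux_symmetry] between the levels 0 and ln x turns the quotient of hitting probabilities into a
    quotient of fluxes. *)
Lemma m_density_flux x : 0 < x -> x != 1 ->
  m_density am ap P eta x = fx (ln x) / fx 0 * (expR (- ln x) / slope am ap (ln x)).
Proof.
move=> x0 x1; have l0 : ln x != 0.
  by apply/eqP => /(congr1 (@expR R)); rewrite lnK ?posrE// expR0; exact/eqP.
have ol : 0 != ln x by rewrite eq_sym.
have h1 : hit_prob P eta 1 x = Q 0 (ln x) 0.
  have := hit_prob_law ap_gt0 ap_lt_am ES eta_refracted ol 0.
  by rewrite /hit_prob expR0 lnK ?posrE.
have h2 : hit_prob P eta x 1 = Q (ln x) 0 (ln x).
  have := hit_prob_law ap_gt0 ap_lt_am ES eta_refracted l0 (ln x).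
  by rewrite /hit_prob expR0 lnK ?posrE.
have dE : drift am ap x = slope am ap (ln x) * x.
  by rewrite /drift /slope; case: (ltP x 1) => h;
    [rewrite leNgt ln_lt0// x0|rewrite ln_ge0].
rewrite /m_density h1 h2 dE expRN lnK ?posrE//.
have sym := flux_symmetry ol; have s0 := slope_gt0 ap_gt0 ap_lt_am (ln x).
(* An upward passage succeeds when no jump interferes. A downward one gets its positivity from the
   upward one through [flux_symmetry] and flux(0) > 0. *)
have Q0 : 0 < Q (ln x) 0 (ln x).
  have : (ln x < 0) || (0 < ln x) by rewrite -neq_lt.
  case/orP => [/hit_law_up_gt0//|/hit_law_up_gt0 h].
  have h' : 0 < fx (ln x) * Q (ln x) 0 (ln x) by rewrite -sym mulr_gt0.
  have /andP[q0 _] := hit_law01 am ap ES (ln x) 0 (ln x).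
  rewrite lt_neqAle q0 andbT eq_sym; apply/eqP => q; move: h'.
  by rewrite q mulr0 ltxx.
have -> : Q 0 (ln x) 0 = fx (ln x) * Q (ln x) 0 (ln x) / fx 0.
  by rewrite -sym mulrC mulKf// gt_eqF.
by field; rewrite !gt_eqF.
Qed.

(** The inverse of the drift of Y on (0, oo), in a form nonnegative and measurable on the whole
    line. *)
Let k x : R := expR (- ln x) * (if 0 <= ln x then ap^-1 else am^-1).

Let kE x : k x = expR (- ln x) / slope am ap (ln x).
Proof. by rewrite /k /slope; case: ifP. Qed.

Let measurable_k : measurable_fun setT k.
Proof.
apply: measurable_funM.
  apply: measurableT_comp; first exact: measurable_expR.
  by apply: measurableT_comp => //; exact: measurable_ln.
apply: measurable_fun_ifT; try exact: measurable_cst.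
by apply: measurable_fun_ler; [exact: measurable_cst|exact: measurable_ln].
Qed.

Let k_ge0 x : 0 <= k x.
Proof. by rewrite kE mulr_ge0 ?expR_ge0// invr_ge0 ltW// slope_gt0. Qed.

Let integral_inv (c u v : R) : 0 < u -> u <= v ->
  (\int[leb]_(x in `]u, v]) (expR (- ln x) * c)%:E = ((ln v - ln u) * c)%:E)%E.
Proof.
move=> u0 uv; rewrite (_ : (ln v - ln u) * c = ln v * c - ln u * c); last by rewrite mulrBl.
apply: (integral_oc (F := fun x => ln x * c)) => // x x0.
  apply: is_derive_eq; first by apply: is_deriveM; exact: is_derive1_ln.
  by rewrite scaler0 add0r expRN lnK ?posrE// /GRing.scale/= mulrC.
apply: continuousM; last exact: cst_continuous.
apply: (@continuous_comp _ _ _ (fun x => - ln x) expR); last exact: continuous_expR.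
by apply: continuousN; exact: continuous_ln.
Qed.

(** [tau] of [ln] is an antiderivative of the inverse drift; its derivative jumps at 1, so the
    interval is cut there. *)
Lemma integral_inv_slope u v : 0 < u -> u <= v ->
  (\int[leb]_(x in `]u, v]) (k x)%:E = (tau am ap (ln v) - tau am ap (ln u))%:E)%E.
Proof.
have low u' v' : 0 < u' -> u' <= v' -> v' <= 1 ->
    (\int[leb]_(x in `]u', v']) (k x)%:E = (tau am ap (ln v') - tau am ap (ln u'))%:E)%E.
  move=> u0 uv v1; rewrite -integral_itv_bndo_bndc; last first.
    exact/measurable_EFinP/measurable_funTS.
  transitivity (\int[leb]_(x in `]u', v'[) (expR (- ln x) * am^-1)%:E)%E.
    apply: eq_integral => x; rewrite inE/= in_itv/= => /andP[ux xv].
    rewrite /k leNgt ln_lt0//= (lt_trans u0 ux)/=; exact: lt_le_trans v1.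
  rewrite integral_itv_bndo_bndc; last first.
    apply/measurable_EFinP/measurable_funTS; apply: measurable_funM => //.
    apply: measurableT_comp; first exact: measurable_expR.
    by apply: measurableT_comp => //; exact: measurable_ln.
  rewrite integral_inv//; congr EFin.
  have t y : 0 < y -> y <= 1 -> tau am ap (ln y) = ln y / am.
    move=> y0; rewrite le_eqVlt => /predU1P[->|y1]; first by rewrite ln1 /tau !mul0r.
    by rewrite /tau /slope leNgt ln_lt0 ?y0.
  by rewrite !t ?(le_trans uv)//; [rewrite mulrBl|exact: lt_le_trans uv].
have high u' v' : 1 <= u' -> u' <= v' ->
    (\int[leb]_(x in `]u', v']) (k x)%:E = (tau am ap (ln v') - tau am ap (ln u'))%:E)%E.
  move=> u1 uv; have u0 : 0 < u' by exact: lt_le_trans u1.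
  transitivity (\int[leb]_(x in `]u', v']) (expR (- ln x) * ap^-1)%:E)%E.
    apply: eq_integral => x; rewrite inE/= in_itv/= => /andP[/ltW ux xv].
    by rewrite /k ln_ge0// (le_trans u1).
  rewrite integral_inv//; congr EFin.
  by rewrite /tau /slope !ln_ge0 ?(le_trans u1)// mulrBl.
move=> u0 uv; have [v1|v1] := leP v 1; first exact: low.
have [u1|u1] := leP 1 u; first exact: high.
rewrite (_ : `]u, v]%classic = `]u, 1] `|` `]1, v]); last first.
  by rewrite -itv_bndbnd_setU// bnd_simp ltW.
rewrite ge0_integral_setU//=.
- rewrite low ?high ?lexx ?(ltW u1) ?(ltW v1)// -EFinD; congr EFin; ring.
- exact/measurable_EFinP/measurable_funTS.
- by move=> x _; rewrite lee_fin.
- apply/eqP/seteqP; split=> // x [] /=; rewrite !in_itv/= => /andP[_ h1] /andP[h2 _].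
  by move: (le_lt_trans h1 h2); rewrite ltxx.
Qed.

(** Write flux(ln x) as a crossing probability and exchange the integrals. The inner one is the time
    the drift needs to make up for a jump, a difference of [tau], and [gap_tau] gives its mean. *)
Theorem mass_flux : m_mass am ap P eta = ((fx 0)^-1)%:E.
Proof.
have lam0 : 0 < lam := jump_rate_gt0 rho_ge0 ES.
pose c := lam / fx 0; have c0 : 0 <= c by rewrite divr_ge0// ltW.
have mj : measurable_fun setT (fun p : R * T => jmp p) := measurable_mark S.
have mcr : measurable_fun setT (fun q : R * (R * T) => jmp q.2 < ln q.1 <= q.2.1).
  have ml : measurable_fun setT (fun q : R * (R * T) => ln q.1).
    by apply: measurableT_comp; first exact: measurable_ln.
  apply: measurable_and.
    by apply: measurable_fun_ltr => //; exact: measurableT_comp mj _.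
  by apply: measurable_fun_ler => //; exact: measurableT_comp.
have bcr x : bmf (fun p : R * T => ind (jmp p < ln x <= p.1) : R).
  exact: (@bmf_pair1 _ _ _ _ _ (fun q : R * (R * T) => ind (jmp q.2 < ln q.1 <= q.2.1)) x (bmf_bool mcr)).
pose g x := c * k x * Ex M (fun p => ind (jmp p < ln x <= p.1)).
have mg : measurable_fun setT g.
  apply: measurable_funM; first by apply: measurable_funM => //; exact: measurable_cst.
  by have [] := bmf_Ex2 M (bmf_bool mcr).
have mE x : 0 < x -> x != 1 -> m_density am ap P eta x = g x.
  by move=> x0 x1; rewrite m_density_flux// flux_Ex /g kE /c; ring.
(* The formula for the density excludes x = 1, a null set. *)
rewrite /m_mass -(@integral_setD1 _ _ 1)//; last 2 first.
- exact: measurableD.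
- apply: (@eq_measurable_fun _ _ _ _ _ (EFin \o g)).
    move=> x; rewrite inE/= in_itv/= andbT => -[x0 /eqP x1].
    by rewrite mE.
  exact/measurable_EFinP/measurable_funTS.
transitivity (\int[leb]_(x in `]0%R, +oo[ `\ 1%R) (g x)%:E)%E.
  by apply: eq_integral => x; rewrite inE/= in_itv/= andbT => -[x0 /eqP x1]; rewrite mE.
rewrite integral_setD1; last 2 first.
- exact: measurableD.
- exact/measurable_EFinP/measurable_funTS.
(* Positivity of x is part of the event, since [ln] is 0 at nonpositive arguments. *)
pose F (q : R * (R * T)) := c * (k q.1 * (ind ((0 < q.1) && (jmp q.2 < ln q.1 <= q.2.1)))).
have mF : measurable_fun setT F.
  apply: measurable_funM; first exact: measurable_cst.
  apply: measurable_funM; first exact: measurableT_comp.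
  apply: measurable_ind; apply: measurable_and => //.
  by apply: measurable_fun_ltr => //; exact: measurable_cst.
have F0 q : 0 <= F q by rewrite /F mulr_ge0// mulr_ge0.
transitivity (\int[leb]_x \int[M]_p (F (x, p))%:E)%E.
  rewrite integral_mkcond; apply: eq_integral => x _; rewrite patchE.
  have -> : (x \in `]0, +oo[%classic) = (0 < x).
    by apply/idP/idP; rewrite inE/= in_itv/= andbT.
  case: (ltP 0 x) => x0; last first.
    rewrite integral0_eq// => p _; rewrite /F /= (_ : (0 < x) = false) ?mulr0//.
    by apply/negbTE; rewrite -leNgt.
  rewrite /g EFinM ExE// -ge0_integralZl//.
  - by apply: eq_integral => p _; rewrite /F/= x0/= -EFinM mulrA.
  - by have [mb _] := bcr x; exact/measurable_EFinP.
  - by rewrite lee_fin mulr_ge0.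
etransitivity; first exact: (@tonelli_lebesgue R _ _ (mu \x P)%E F mF F0).
transitivity (\int[M]_p (c%:E * (tau am ap p.1 - tau am ap (jmp p))%:E))%E.
  apply: eq_integral => p _.
  have jp : expR (jmp p) <= expR p.1 by rewrite ler_expR ltW.
  have -> : ((tau am ap p.1 - tau am ap (jmp p))%:E =
      \int[leb]_(x in `](expR (jmp p)), (expR p.1)]) (k x)%:E)%E.
    by rewrite integral_inv_slope ?expR_gt0// !expRK.
  rewrite [X in (_ * X)%E]integral_mkcond -ge0_integralZl//.
  - apply: eq_integral => x _; rewrite patchE /F/= EFinM; congr (_ * _)%E.
    have [x0|x0] := ltP 0 x; last first.
      rewrite mulr0 ifF//; apply/negP; rewrite inE/= in_itv/= => /andP[h _].
      by move: (lt_le_trans h x0); rewrite ltNge expR_ge0.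
    have -> : (x \in `](expR (jmp p)), (expR p.1)]%classic) = (jmp p < ln x <= p.1).
      rewrite -[jmp p < _]ltr_expR -[ln x <= _]ler_expR lnK ?posrE//.
      by apply/idP/idP; rewrite inE/= in_itv.
    by rewrite /=; case: ifP => _; rewrite ?mulr1 ?mulr0.
  - apply/measurable_restrict => //; exact/measurable_EFinP/measurable_funTS.
  - by move=> x _; rewrite patchE; case: ifP => _; rewrite lee_fin.
have mt := @measurable_tau R am ap.
rewrite ge0_integralZl//; last 2 first.
- apply/measurable_EFinP; apply: measurable_funB; exact: measurableT_comp.
- by move=> p _; rewrite lee_fin subr_ge0 tau_mono// ltW.
rewrite /c mulrC EFinM -muleA.
by rewrite (gap_tau ap_gt0 ap_lt_am ES eta_refracted nu_inv rho_meas rho_ge0 rho_log) mule1.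
Qed.

End mass.

(** k q - l g(q) is negative at c and nonnegative at c + l/k because g <= 1, so there is a root
    beyond c; nonnegative roots are at most l/k. Continuity on [c, oo) makes the supremum a root.
    Negative members of A, about which nothing is assumed, cannot affect it. *)
Lemma sup_of_roots {R : realType} (k l : R) (g : R -> R) (A : set R) :
  0 < k -> 0 < l -> (forall q, 0 <= q -> 0 <= g q <= 1) ->
  (forall c p q, 0 < c -> c <= p -> p <= q -> `|g q - g p| <= c^-1 * (q - p)) ->
  (exists2 c, 0 < c & k * c < l * g c) ->
  (forall q, 0 <= q -> A q <-> k * q = l * g q) ->
  [/\ ubound A (sup A), A (sup A) & 0 < sup A].
Proof.
move=> k0 l0 g01 g_lip [c c0 gc] AE; pose phi q := k * q - l * g q.
have pc : phi c < 0 by rewrite subr_lt0.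
have phi_lip p q : c <= p -> p <= q -> `|phi q - phi p| <= (k + l / c) * (q - p).
  move=> cp pq; have H := g_lip _ _ _ c0 cp pq.
  rewrite (_ : phi q - phi p = k * (q - p) - l * (g q - g p)); last by rewrite /phi; ring.
  rewrite (le_trans (ler_normB _ _))// mulrDl lerD//.
    by rewrite normrM !ger0_norm ?subr_ge0// ltW.
  by rewrite normrM gtr0_norm// -mulrA ler_wpM2l// ltW.
have A_ub : ubound A (l / k).
  move=> q Aq; have [q0|/ltW q0] := leP 0 q; last by rewrite (le_trans q0)// divr_ge0// ltW.
  rewrite ler_pdivlMr// mulrC (AE _ q0).1// -[leRHS]mulr1 ler_pM2l//.
  by case/andP: (g01 q q0).
have K0 : 0 < k + l / c by rewrite addr_gt0// divr_gt0.
have [b cb Ab] : exists2 b, c < b & A b.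
  pose K := c + l / k.
  have lk : 0 <= l / k by rewrite divr_ge0// ltW.
  have cK : c <= K by rewrite lerDl.
  have pK : 0 <= phi K.
    have KK : 0 <= K by rewrite (le_trans (ltW c0)).
    have : l <= k * K by rewrite mulrDr mulrCA divff ?mulr1 ?gt_eqF// lerDr mulr_ge0// ltW.
    have /andP[_ h] := g01 _ KK; have : l * g K <= l * 1 by rewrite ler_pM2l.
    by rewrite mulr1 subr_ge0; exact: le_trans.
  have cphi : {within `[c, K], continuous phi}.
    apply/subspace_continuousP => x /=; rewrite in_itv/= => /andP[cx xK].
    apply/cvgrPdist_le => e e0.
    have eL : 0 < e / (k + l / c) by rewrite divr_gt0.
    apply/nbhs_ballP; exists (e / (k + l / c)) => //= y /ltW xy /=.
    rewrite in_itv/= => /andP[cy _].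
    have {xy} : (k + l / c) * `|x - y| <= e by rewrite mulrC -ler_pdivlMr.
    apply: le_trans; have [yx|/ltW xy] := leP y x.
      by rewrite (ger0_norm (x := x - y)) ?subr_ge0// phi_lip.
    by rewrite distrC (distrC x y) (ger0_norm (x := y - x)) ?subr_ge0// phi_lip.
  have [|b] := @IVT _ phi c K 0 cK cphi.
    by rewrite ge_min le_max (ltW pc) pK orbT.
  rewrite in_itv/= => /andP[cb _] pb; exists b.
    by rewrite lt_neqAle cb andbT; apply/eqP => cE; move: pc; rewrite cE pb ltxx.
  by apply/AE; [rewrite (le_trans (ltW c0))|exact: subr0_eq].
have hs : has_sup A by split; [exists b|exists (l / k)].
have uA : ubound A (sup A) by exact: sup_upper_bound.
have b0 : 0 < sup A by rewrite (lt_le_trans (lt_trans c0 cb))// uA.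
split=> //; apply/(AE _ (ltW b0))/subr0_eq; rewrite -/(phi (sup A)).
set B := sup A in uA b0 *; have cB : c < B by rewrite (lt_le_trans cb)// uA.
apply/eqP; rewrite -normr_eq0 -[_ == 0]negbK; apply/negP => p0.
have {}p0 : 0 < `|phi B| by rewrite lt0r p0 normr_ge0.
(* A root this close to B, and still beyond c, would force |phi B| < |phi B| by the Lipschitz
   bound. *)
pose e := Num.min (`|phi B| / (k + l / c)) (B - c).
have e0 : 0 < e by rewrite lt_min divr_gt0// subr_gt0.
have [x Ax] := sup_adherent e0 hs; rewrite -/B => ex.
have cx : c <= x by have : e <= B - c; [rewrite ge_min lexx orbT|lra].
have := phi_lip _ _ cx (uA _ Ax).
have -> : phi x = 0 by apply/eqP; rewrite subr_eq0; apply/eqP/AE => //; rewrite (le_trans (ltW c0)).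
rewrite subr0; apply/negP; rewrite -ltNge.
apply: (@lt_le_trans _ _ ((k + l / c) * e)).
  by rewrite ltr_pM2l// ltrBlDl -ltrBlDr.
by rewrite mulrC -ler_pdivlMr// ge_min lexx.
Qed.

Lemma level_shift (R : realFieldType) (a l x y q : R) :
  a * q - l * x + l * y = a * - 1 - l * 0 + l * y <-> a * (q + 1) - l * x = 0.
Proof. by split=> ?; lra. Qed.

(** * The Laplace exponents and their roots *)

Section exponents.
Context {R : realType} (am ap : R) (rho : R -> R).
Hypotheses (ap_gt0 : 0 < ap) (ap_lt_am : ap < am).
Context {d : measure_display} {T : measurableType d} (P : probability T R).
Variables E S : nat -> {RV P >-> R}.
Hypothesis ES : compound_poisson rho E S.
Hypothesis rho_meas : measurable_fun (`[0, 1] : set R) rho.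
Hypothesis rho_ge0 : forall s : R, 0 <= s <= 1 -> 0 <= rho s.
Local Notation lam := (jump_rate rho).
Local Notation leb := (@lebesgue_measure R).
Local Notation kappa := (- \int[leb]_(s in `[0, 1]) (ln s * rho s)).
Hypothesis rho_log : ap < kappa < am.
Hypothesis rho_moment : exists2 eps0 : R, 0 < eps0 &
    ((\int[leb]_(s in `[0%R, 1%R]) (s `^ (- eps0) * rho s)%:E) < +oo)%E.

Let lam_gt0 : 0 < lam. Proof. exact: jump_rate_gt0 rho_ge0 ES. Qed.

Let missing (c s : R) : R := 1 - expR (- (c * Num.max (- ln s) 0)).

Let missing_bmf c : 0 <= c -> bmf (missing c) /\ forall s, 0 <= missing c s <= 1.
Proof.
move=> c0; have h s : 0 <= missing c s <= 1.
  rewrite /missing lerBlDr lerDl expR_ge0 subr_ge0 -expR0 ler_expR oppr_le0.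
  by rewrite mulr_ge0// le_max lexx orbT.
split=> //; split; last by exists 1 => s; have /andP[h1 h2] := h s; rewrite ger0_norm.
apply: measurable_funB; first exact: measurable_cst.
apply: measurableT_comp; first exact: measurable_expR.
apply: measurableT_comp => //; apply: measurable_funM; first exact: measurable_cst.
apply: measurable_maxr; last exact: measurable_cst.
by apply: measurableT_comp => //; exact: measurable_ln.
Qed.

Let missing_powR c s : 0 < s <= 1 -> missing c s = 1 - s `^ c.
Proof.
move=> /andP[s0 s1]; rewrite /missing max_l ?oppr_ge0 ?ln_le0//.
by rewrite mulrN opprK /powR gt_eqF.
Qed.

(** The mean of 1 - S^q: up to the sign and the factor [lam], the jump part of [tildePsi]. *)
Definition thinning (q : R) : R := Ex P (fun w => 1 - expR (q * ln (S 0 w))).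

Let missing_factor c w : missing c (S 0 w) = 1 - expR (c * ln (S 0 w)).
Proof.
by rewrite /missing max_l ?mulrN ?opprK// oppr_ge0 ltW// (ln_factor_lt0 ES).
Qed.

Let missing_integral c : 0 <= c ->
  leb.-integrable `]0, 1] (EFin \o (fun s => missing c s * rho s)) /\
  \int[leb]_(s in `]0, 1]) (missing c s * rho s) = lam * thinning c.
Proof.
move=> c0; have [bm m01] := missing_bmf c0; have [mm _] := bm.
have := factor_density rho_meas rho_ge0 ES mm (fun s => (andP (m01 s)).1).
rewrite -ExE; last by apply: (bmf_comp bm).
rewrite -EFinM => H.
have mf : measurable_fun (`[0, 1] : set R) (fun s => (missing c s * rho s)%:E).
  by apply/measurable_EFinP/measurable_funM => //; exact: measurable_funTS.
have mf' : measurable_fun (`]0, 1] : set R) (fun s => (missing c s * rho s)%:E).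
  by apply: measurable_funS mf => //; exact: subset_itv_oc_cc.
split.
  apply/integrableP; split => //.
  rewrite [ltLHS](_ : _ = \int[leb]_(s in `]0%R, 1%R]) (missing c s * rho s)%:E)%E; last first.
    apply: eq_integral => s; rewrite inE/= in_itv/= => /andP[/ltW s0 s1].
    have /andP[h _] := m01 s.
    by rewrite ger0_norm// mulr_ge0// rho_ge0// s0.
  by rewrite integral_itv_obnd_cbnd// -H ltry.
rewrite /Rintegral integral_itv_obnd_cbnd// -H /=; congr (_ * _).
by apply: Ex_ext => w; exact: missing_factor.
Qed.

(** Dropping the endpoint 0 avoids the conventional values of powers and logarithms there. *)
Let Rintegral01 (h : R -> R) : measurable_fun (`]0, 1] : set R) h ->
  \int[leb]_(s in `[0, 1]) h s = \int[leb]_(s in `]0, 1]) h s.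
Proof.
by move=> mh; rewrite /Rintegral -integral_itv_obnd_cbnd//; exact/measurable_EFinP.
Qed.

Let measurable_power (q : R) : measurable_fun (`]0, 1] : set R) (fun s => s `^ q).
Proof. exact: measurable_funTS. Qed.

Let measurable_rate : measurable_fun (`]0, 1] : set R) rho.
Proof. by apply: measurable_funS rho_meas => //; exact: subset_itv_oc_cc. Qed.

Lemma thinning0 : thinning 0 = 0.
Proof.
rewrite /thinning (@Ex_ext _ _ _ _ _ (fun=> 0)) ?Ex_cst// => w.
by rewrite mul0r expR0 subrr.
Qed.

Lemma tildePsi_thinning a q : 0 <= q -> tildePsi a rho q = a * q - lam * thinning q.
Proof.
move=> q0; have [iq <-] := missing_integral q0; congr (_ + _).
rewrite Rintegral01; last first.
  by apply: measurable_funM => //; apply: measurable_funB => //; exact: measurable_cst.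
rewrite -[RHS]mulN1r -(RintegralZl (-1) _ iq)//; apply: eq_Rintegral => s.
by rewrite inE/= in_itv/= => s01; rewrite missing_powR//; ring.
Qed.

(** Since (s^q - 1) s = (1 - s) - (1 - s^(q + 1)), [Psi] is a shift of [tildePsi] by one, up to an
    affine term. *)
Lemma Psi_thinning a q : - 1 <= q ->
  Psi a rho q = a * q - lam * thinning (q + 1) + lam * thinning 1.
Proof.
move=> q1; have q0 : 0 <= q + 1 by lra.
have [iq <-] := missing_integral q0; have [i1 <-] := missing_integral ler01.
rewrite -addrA; congr (_ + _); rewrite addrC -RintegralB//.
rewrite Rintegral01; last first.
  apply: measurable_funM => //; apply: measurable_funM => //.
  by apply: measurable_funB => //; exact: measurable_cst.
apply: eq_Rintegral => s; rewrite inE/= in_itv/= => s01; have /andP[s0 _] := s01.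
rewrite !missing_powR// powRD ?(gt_eqF s0) ?implybT// powRr1 ?(ltW s0)//; ring.
Qed.

Lemma thinning01 q : 0 <= q -> 0 <= thinning q <= 1.
Proof.
move=> q0; have [bm m01] := missing_bmf q0.
rewrite /thinning -(@Ex_ext _ _ _ _ (fun w => missing q (S 0 w))); last exact: missing_factor.
apply/andP; split; first by apply: Ex_ge0 => w; case/andP: (m01 (S 0 w)).
by apply: Ex_le_cst => [|w]; [exact: bmf_comp bm _|case/andP: (m01 (S 0 w))].
Qed.

Let bmf_thin q : 0 <= q -> bmf (fun w => 1 - expR (q * ln (S 0 w))).
Proof.
move=> q0; have [bm _] := missing_bmf q0.
rewrite (_ : (fun w => _) = (fun w => missing q (S 0 w))); first exact: bmf_comp bm _.
by apply/funext => w; rewrite missing_factor.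
Qed.

(* On [[c, +oo[], [c > 0], the slope of [q |-> s ^ q] is at most [max_m m e^(-cm) <= 1/c]. *)
Lemma thinning_lip c p q : 0 < c -> c <= p -> p <= q ->
  `|thinning q - thinning p| <= c^-1 * (q - p).
Proof.
move=> c0 cp pq; have p0 : 0 <= p by rewrite (le_trans _ cp)// ltW.
have q0 : 0 <= q by exact: le_trans pq.
rewrite -[leRHS](Ex_cst P); apply: Ex_normB; [exact: bmf_thin|exact: bmf_thin|exact: bmf_cst|].
move=> w; set m := - ln (S 0 w); have m0 : 0 < m by rewrite oppr_gt0 (ln_factor_lt0 ES).
have lE : ln (S 0 w) = - m by rewrite opprK.
rewrite lE; clearbody m; rewrite !mulrN.
have -> : 1 - expR (- (q * m)) - (1 - expR (- (p * m))) =
    expR (- (p * m)) * (1 - expR (- ((q - p) * m))).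
  by rewrite mulrBr mulr1 -expRD (_ : - (p * m) + - ((q - p) * m) = - (q * m)); ring.
have h1 : 0 <= 1 - expR (- ((q - p) * m)) <= (q - p) * m.
  have := expR_ge1Dx (- ((q - p) * m)).
  have : expR (- ((q - p) * m)) <= expR 0.
    by rewrite ler_expR oppr_le0 mulr_ge0 ?subr_ge0// ltW.
  by rewrite expR0 => ? ?; apply/andP; split; lra.
have h2 : expR (- (p * m)) * m <= c^-1.
  rewrite expRN mulrC ler_pdivrMr ?expR_gt0// mulrC ler_pdivlMr//.
  have := expR_ge1Dx (p * m); have : c * m <= p * m by rewrite ler_wpM2r// ltW.
  by rewrite [m * c]mulrC; lra.
have /andP[h3 h4] := h1.
rewrite ger0_norm ?mulr_ge0 ?expR_ge0//.
apply: (@le_trans _ _ (expR (- (p * m)) * ((q - p) * m))).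
  by rewrite ler_wpM2l// expR_ge0.
rewrite mulrCA mulrC ler_wpM2r ?subr_ge0//.
Qed.

(** The derivative at 0, by domination with -ln S. As kappa > ap, [tildePsi] is negative at some
    points right of 0, which starts the search for a positive root. *)
Lemma thinning_rate : thinning (tn n) / tn n @[n --> \oo] --> kappa / lam.
Proof.
have mk := mark_loss ap_gt0 ES rho_meas rho_ge0 rho_log.
have ml : measurable_fun setT (fun w => (- ln (S 0 w))%:E).
  apply/measurable_EFinP; apply: measurableT_comp => //.
  by apply: measurableT_comp => //; exact: measurable_ln.
have m0 w : 0 < - ln (S 0 w) by rewrite oppr_gt0 (ln_factor_lt0 ES).
have int : P.-integrable setT (fun w => (- ln (S 0 w))%:E).
  apply/integrableP; split=> //.
  rewrite (_ : (fun x => _) = (fun w => (- ln (S 0 w))%:E)) ?mk ?ltry//.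
  by apply/funext => w /=; rewrite gtr0_norm.
have [|||||_ _ H] := @dominated_convergence _ _ _ P setT measurableT
  (fun n w => ((tn n)^-1 * (1 - expR (tn n * ln (S 0 w))))%:E)
  (fun w => (- ln (S 0 w))%:E) (fun w => (- ln (S 0 w))%:E).
- by move=> n; apply/measurable_EFinP; have [] := bmfZ (tn n)^-1 (bmf_thin (tn_ge0 n)).
- by [].
- apply: aeW => w _; apply: cvg_EFin; first exact: nearW.
  have := cvg_exp_rate (m0 w); apply: cvg_trans; apply: near_eq_cvg; apply: nearW => n /=.
  by rewrite opprK mulrC [tn n * _]mulrC.
- by [].
- apply: aeW => w n _; rewrite lee_fin.
  have t0 : 0 < tn n :> R := tn_gt0 n.
  have h := expR_ge1Dx (tn n * ln (S 0 w)).
  have h' : expR (tn n * ln (S 0 w)) <= expR 0.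
    by rewrite ler_expR nmulr_lle0 ?(ln_factor_lt0 ES)// ltW.
  rewrite expR0 in h'; rewrite ger0_norm; last by rewrite mulr_ge0 ?subr_ge0// invr_ge0 ltW.
  by rewrite [leLHS]mulrC ler_pdivrMr// mulNr [ln _ * _]mulrC; lra.
rewrite mk in H; rewrite (_ : (fun n => _) = (fun n => Ex P (fun w =>
    (tn n)^-1 * (1 - expR (tn n * ln (S 0 w)))))); first exact: fine_cvg H.
by apply/funext => n; rewrite ExZ 1?mulrC//; exact: bmf_thin (tn_ge0 n).
Qed.

Local Notation beta := (beta ap rho).
Local Notation roots := [set q | tildePsi ap rho q = 0].

Let root_sup : [/\ ubound roots beta, roots beta & 0 < beta].
Proof.
apply: (sup_of_roots ap_gt0 lam_gt0 thinning01 thinning_lip).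
  have h : ap / lam < kappa / lam by rewrite ltr_pM2r ?invr_gt0//; case/andP: rho_log.
  have /cvgr_gt/(_ _ h)[n _ /(_ n (leqnn n))/=] := thinning_rate.
  have t0 : 0 < tn n :> R := tn_gt0 n.
  rewrite ltr_pdivlMr// mulrAC ltr_pdivrMr// => H; exists (tn n) => //.
  by rewrite [lam * _]mulrC.
move=> q q0 /=; rewrite tildePsi_thinning//; split=> [/eqP|->]; last by rewrite subrr.
by rewrite subr_eq0 => /eqP.
Qed.

Lemma beta_gt0 : 0 < beta. Proof. by case: root_sup. Qed.

Lemma beta_root : lam * thinning beta = ap * beta.
Proof.
have [_ /= + _] := root_sup; rewrite tildePsi_thinning ?(ltW beta_gt0)//.
by move=> /eqP; rewrite subr_eq0 => /eqP.
Qed.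

(** On q >= -1 the level set of [Psi] through -1 is the zero set of [tildePsi] moved by one;
    solutions below -1 do not reach the supremum, which is beta - 1 > -1. *)
Lemma Phi_beta : Phi ap rho (Psi ap rho (- 1)) + 1 = beta.
Proof.
have [ub rb b0] := root_sup.
have levelE q : - 1 <= q -> Psi ap rho q = Psi ap rho (- 1) <-> tildePsi ap rho (q + 1) = 0.
  move=> q1; have q0 : 0 <= q + 1 by rewrite -lerBlDr sub0r.
  rewrite (Psi_thinning ap q1) (Psi_thinning ap (lexx (- 1))) addNr thinning0.
  rewrite (tildePsi_thinning ap q0).
  exact: level_shift.
have Ab : Psi ap rho (beta - 1) = Psi ap rho (- 1).
  by apply/levelE; [rewrite lerBrDr addNr (ltW b0)|rewrite subrK].
have uA : ubound [set q | Psi ap rho q = Psi ap rho (- 1)] (beta - 1).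
  move=> q /= Aq; have [q1|/ltW q1] := leP (- 1) q; last first.
    by apply: le_trans q1 _; rewrite lerBrDr addNr (ltW b0).
  by rewrite lerBrDr; apply: ub; apply/levelE.
apply/eqP; rewrite eq_sym -subr_eq eq_le /Phi; apply/andP; split.
  by apply: ub_le_sup Ab; exists (beta - 1).
by apply: ge_sup uA; exists (beta - 1).
Qed.

Let power_expR (c s : R) : 0 < s -> s `^ c = expR (c * ln s).
Proof. by move=> s0; rewrite /powR gt_eqF. Qed.

(** Differentiation under the integral, where s^(-1) s = 1 leaves the integral of ln(s) rho(s). For
    q within e/2 of -1, s^q s is at most s^(-e/2), so the moment of order -e dominates. *)
Lemma derive1_Psi : derive1 (Psi am rho) (- 1) = am - kappa.
Proof.
have [e e0 He] := rho_moment.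
pose W s := `|s `^ (- e) * rho s|.
have W0 s : 0 <= W s by exact: normr_ge0.
have mW : measurable_fun (`]0, 1] : set R) (fun s => s `^ (- e) * rho s).
  exact: measurable_funM.
have m01 : measurable (`]0, 1] : set R) by exact: measurable_itv.
have iW : leb.-integrable `]0, 1] (EFin \o W).
  apply/integrableP; split; first by apply/measurable_EFinP; exact: measurableT_comp.
  apply: le_lt_trans He; rewrite -integral_itv_obnd_cbnd; last exact/measurable_EFinP.
  rewrite le_eqVlt; apply/orP; left; apply/eqP.
  apply: eq_integral => s; rewrite inE/= in_itv/= => /andP[/ltW s0 s1].
  by rewrite /W normr_id ger0_norm// mulr_ge0 ?powR_ge0// rho_ge0// s0.
pose f q s := (expR (q * ln s) - 1) * s * rho s.
have Wpos s : 0 < s <= 1 -> W s = expR (e * - ln s) * rho s.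
  move=> /andP[s0 s1]; rewrite /W ger0_norm ?power_expR ?mulrN ?mulNr//.
  by rewrite mulr_ge0 ?expR_ge0// rho_ge0// (ltW s0).
have FE : Psi am rho = (fun q => am * q + \int[leb]_(s in `]0, 1]) f q s).
  apply/funext => q; rewrite /Psi Rintegral01; last first.
    apply: measurable_funM => //; apply: measurable_funM => //.
    by apply: measurable_funB => //; exact: measurable_cst.
  congr (_ + _); apply: eq_Rintegral => s; rewrite inE/= in_itv/= => /andP[s0 _].
  by rewrite /f power_expR.
pose u : R := - 1 - e / 2; pose v : R := - 1 + e / 2.
have I1 : `]u, v[%classic (- 1 : R) by rewrite /= in_itv/= /u /v; apply/andP; split; lra.
have mln : measurable_fun (`]0, 1] : set R) (@ln R).
  by apply: measurable_funTS; exact: measurable_ln.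
have mf q : measurable_fun (`]0, 1] : set R) (f q).
  apply: measurable_funM => //; apply: measurable_funM => //.
  apply: measurable_funB; last exact: measurable_cst.
  apply: measurableT_comp; first exact: measurable_expR.
  by apply: measurable_funM => //; exact: measurable_cst.
have low q s : `]u, v[%classic q -> 0 < s <= 1 -> 0 <= expR (q * ln s) * s <= expR (e / 2 * - ln s).
  rewrite /= in_itv/= => /andP[uq qv] /andP[s0 s1]; rewrite mulr_ge0 ?expR_ge0 ?(ltW s0)//=.
  rewrite -[X in _ * X](lnK s0) -expRD ler_expR.
  have l0 : ln s <= 0 by rewrite ln_le0.
  have q1 : 0 <= q + 1 + e / 2 by move: uq; rewrite /u; lra.
  by have := mulr_ge0_le0 q1 l0; rewrite mulrN !mulrDl mul1r; lra.
have intf q : `]u, v[%classic q -> leb.-integrable `]0, 1] (EFin \o f q).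
  move=> Iq; apply: (@le_integrable _ _ _ leb `]0, 1] (measurable_itv _) _ (EFin \o (fun s => 2 * W s))).
  - by apply/measurable_EFinP; exact: mf.
  - move=> s /=; rewrite in_itv/= => s01; have /andP[h1 h2] := low q s Iq s01.
    have /andP[s0 s1] := s01; have r0 : 0 <= rho s by rewrite rho_ge0// (ltW s0).
    rewrite lee_fin /f mulrBl mul1r normrM (ger0_norm r0) (ger0_norm (x := 2 * _)) ?mulr_ge0//.
    rewrite Wpos// mulrA ler_wpM2r//.
    have l0 : 0 <= - ln s by rewrite oppr_ge0 ln_le0.
    have h3 : expR (e / 2 * - ln s) <= expR (e * - ln s).
      by rewrite ler_expR ler_wpM2r//; lra.
    have h4 : 1 <= expR (e * - ln s) by rewrite -[leLHS]expR0 ler_expR mulr_ge0// ltW.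
    by rewrite ler_norml; apply/andP; split; lra.
  - exact: (@integrableZl _ _ _ leb _ (measurable_itv _) 2 (EFin \o W) iW).
have df (q s : R) : is_derive q (1 : R) (f^~ s) (ln s * expR (q * ln s) * s * rho s).
  have h1 : is_derive q (1 : R) (fun q => q * ln s) (ln s).
    rewrite (_ : (fun q => q * ln s) = ln s \*: (id : R -> R)); last first.
      by apply/funext => q'; rewrite /= mulrC.
    by apply: is_derive_eq; rewrite /GRing.scale/= mulr1.
  have h2 : is_derive q (1 : R) (fun q => expR (q * ln s)) (expR (q * ln s) * ln s).
    exact: (is_derive1_comp (f := expR) (g := fun q => q * ln s)).
  rewrite (_ : f^~ s = ((s * rho s) \*: (fun q => expR (q * ln s))) - cst (s * rho s)); last first.
    apply/funext => q'; transitivity (s * rho s * expR (q' * ln s) - s * rho s) => //.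
    by rewrite /f; ring.
  apply: is_derive_eq; rewrite subr0.
  by transitivity (s * rho s * (expR (q * ln s) * ln s)) => //; ring.
have d1E q s : partial1of2 f q s = ln s * expR (q * ln s) * s * rho s.
  by rewrite partial1of2E; have [_ ->] := df q s.
(* Half of the exponent e bounds s^q s; the other half bounds the logarithm, through y <= (2/e)
   exp(e y / 2) with y = -ln s. *)
pose G s := 2 / e * W s.
have derf q s : `]u, v[%classic q -> `]0, 1]%classic s -> derivable (f^~ s) q 1.
  by move=> _ _; have [] := df q s.
have G0 s : 0 <= G s by rewrite mulr_ge0// divr_ge0// ltW.
have iG : leb.-integrable `]0, 1] (EFin \o G).
  exact: (@integrableZl _ _ _ leb _ (measurable_itv _) (2 / e) (EFin \o W) iW).
have Gub q s : `]u, v[%classic q -> `]0, 1]%classic s -> `|partial1of2 f q s| <= G s.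
  move=> Iq; rewrite /= in_itv/= => s01; have /andP[s0 s1] := s01.
  have /andP[h1 h2] := low q s Iq s01; have r0 : 0 <= rho s by rewrite rho_ge0// (ltW s0).
  rewrite d1E -[ln s * _ * _]mulrA normrM (ger0_norm r0) /G Wpos// [leRHS]mulrA ler_wpM2r//.
  have l0 : 0 <= - ln s by rewrite oppr_ge0 ln_le0.
  rewrite normrM (ger0_norm h1) ler0_norm ?ln_le0//.
  have -> : e * - ln s = e / 2 * - ln s + e / 2 * - ln s by field.
  rewrite expRD [leRHS]mulrA ler_pM// -[2 / e]invf_div mulrC ler_pdivlMr ?divr_gt0//.
  by have := expR_ge1Dx (e / 2 * - ln s); rewrite [- ln s * _]mulrC; lra.
have h1 := @differentiation_under_integral R _ _ leb f _ m01 (- 1) u v I1 intf derf G G0 iG Gub.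
have h2 := @derivable_under_integral R _ _ leb f _ m01 (- 1) u v I1 intf derf G G0 iG Gub.
pose F (q : R) : R := \int[leb]_(s in `]0, 1]) f q s.
have h3 : is_derive (- 1 : R) (1 : R) (am \*: (id : R -> R)) am.
  by apply: is_derive_eq; rewrite /GRing.scale/= mulr1.
have h4 : is_derive (- 1 : R) (1 : R) F (derive1 F (- 1)).
  by rewrite derive1E; exact: derivableP.
have [_ h5] := is_deriveD h3 h4.
rewrite FE derive1E [LHS]h5 h1; congr (_ + _).
rewrite opprK Rintegral01; last by apply: measurable_funM.
apply: eq_Rintegral => s; rewrite inE/= in_itv/= => /andP[s0 _].
by rewrite d1E mulN1r expRN lnK// mulfVK// gt_eqF.
Qed.

End exponents.

Lemma eq_density {R : realType} (m : probability (measurableTypeR R) R) (h : R -> R) (c : R) :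
  measurable_fun setT h -> (forall x, 0 <= h x) ->
  (forall u v, c <= u -> u <= v ->
    m `]u, v]%classic = (\int[lebesgue_measure]_(x in `]u, v]) (h x)%:E)%E) ->
  forall A : set R, measurable A -> A `<=` `]c, +oo[ ->
    m A = (\int[lebesgue_measure]_(x in A) (h x)%:E)%E.
Proof.
move=> mh h0 mE.
pose D : set (measurableTypeR R) := `]c, +oo[%classic.
have mD : measurable D by exact: measurable_itv.
have mhE B : measurable_fun (B : set (measurableTypeR R)) (fun x => (h x)%:E).
  by apply/measurable_EFinP; exact: measurable_funTS.
pose n0 (A : set (measurableTypeR R)) : \bar R :=
  (\int[lebesgue_measure]_(x in A `&` D) (h x)%:E)%E.
have n00 : n0 set0 = 0%E by rewrite /n0 set0I integral_set0.
have n0_ge0 A : (0 <= n0 A)%E by apply: integral_ge0 => x _; rewrite lee_fin.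
have n0_sigma : semi_sigma_additive n0.
  move=> F mF tF mUF; rewrite /n0; apply: cvg_toP.
    apply: ereal_nondecreasing_is_cvgn => k l kl.
    by apply: lee_sum_nneg_natr => // i _ _; exact: n0_ge0.
  rewrite setI_bigcupl ge0_integral_bigcup//=.
  - by move=> k; exact: measurableI.
  - by move=> x _; rewrite lee_fin.
  - by apply: trivIset_setIr.
pose n : {measure set (measurableTypeR R) -> \bar R} :=
  HB.pack n0 (isMeasure.Build _ _ _ n0 n00 n0_ge0 n0_sigma).
move=> A mA AD.
have AE : A `&` D = A by exact/setIidPl.
pose m' : {measure set (measurableTypeR R) -> \bar R} := mrestr m mD.
suff mn : m' A = n A by have : m (A `&` D) = n0 A := mn; rewrite /n0 AE.
apply: (@measure_unique _ R (measurableTypeR R) (@ocitv R) (fun k => `](- k%:R), k%:R]%classic)) => //.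
- exact: ocitvI.
- by move=> i; exact: is_ocitv.
- apply/seteqP; split=> // x _; exists (Num.trunc `|x|).+1 => //=.
  rewrite in_itv/=; have := truncnS_gt `|x|; rewrite ltr_norml => /andP[-> /ltW ->//].
- move=> _ [[u v] _ <-] /=; rewrite /m' /mrestr /n/= /n0.
  have -> : `]u, v]%classic `&` D = `]Num.max u c, v]%classic.
    rewrite /D; apply/seteqP; split=> x /=; rewrite !in_itv/= gt_max andbT.
      by move=> [/andP[-> ->] ->].
    by move=> /andP[/andP[-> ->] ->].
  have [uv|vu] := leP (Num.max u c) v; first by rewrite mE// le_max lexx orbT.
  by rewrite set_itv_ge ?measure0 ?integral_set0// bnd_simp -leNgt ltW.
- move=> k; apply: (@le_lt_trans _ _ 1%E); last by rewrite ltry.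
  by apply: (@probability_le1 _ _ _ m); exact: measurableI.
Qed.

(** * The density of the invariant law above one *)

Section limit_law.
Context {R : realType} (am ap : R) (rho : R -> R).
Hypotheses (ap_gt0 : 0 < ap) (ap_lt_am : ap < am).
Context {d : measure_display} {T : measurableType d} (P : probability T R).
Variables E S : nat -> {RV P >-> R}.
Hypothesis ES : compound_poisson rho E S.
Variable eta : R -> R -> T -> R.
Hypothesis eta_refracted : refracted am ap E S eta.
Variable nu : probability (measurableTypeR R) R.
Hypothesis nu_inv : invariant_law P eta nu.
Hypothesis rho_meas : measurable_fun (`[0, 1] : set R) rho.
Hypothesis rho_ge0 : forall s : R, 0 <= s <= 1 -> 0 <= rho s.

Local Notation lam := (jump_rate rho).
Local Notation mu := (log_law nu).
Local Notation flow := (flow am ap).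


Local Notation leb := (@lebesgue_measure R).
Local Notation kappa := (- \int[leb]_(s in `[0, 1]) (ln s * rho s)).
Hypothesis rho_log : ap < kappa < am.
Local Notation beta := (beta ap rho).
Local Notation F := (upper nu).

Let beta0 : 0 < beta.
Proof. exact: (beta_gt0 ap_gt0 ES rho_meas rho_ge0 rho_log). Qed.

Let root : lam * Ex P (fun w => 1 - expR (beta * ln (S 0 w))) = ap * beta.
Proof. exact: (beta_root ap_gt0 ES rho_meas rho_ge0 rho_log). Qed.

Let F_exp h : 0 <= h -> F h = expR (- (beta * h)) * F 0.
Proof.
exact: (upper_exp ap_gt0 ap_lt_am ES eta_refracted nu_inv rho_ge0 beta0 root).
Qed.

Let strict u : R := Ex mu (fun x => ind (u < x)).

(** The exponential form makes F continuous on [0, oo), so the logarithmic law has no atom there: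
    moving right by e / beta costs at most e. *)
Lemma strict_upper u : 0 <= u -> strict u = F u.
Proof.
move=> u0; have b1 (v : R) : bmf (fun x : R => ind (v < x) : R).
  by apply: bmf_bool; apply: measurable_fun_ltr => //; exact: measurable_cst.
have b2 (v : R) : bmf (fun x : R => ind (v <= x) : R).
  by apply: bmf_bool; apply: measurable_fun_ler => //; exact: measurable_cst.
apply/eqP; rewrite eq_le; apply/andP; split.
  by apply: Ex_le => // x; rewrite ler_nat; case: ltgtP.
apply/ler_addgt0Pr => e e0; rewrite -lerBlDr.
have F1 : 0 <= F u <= 1.
  rewrite upper_ge0/=; apply: Ex_le_cst => // x; by rewrite lern1 leq_b1.
pose h := e / beta; have h0 : 0 < h by rewrite divr_gt0.
apply: (@le_trans _ _ (F (u + h))); last first.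
  apply: Ex_le => // x; rewrite ler_nat; case: (leP (u + h) x) => // ux.
  by rewrite (lt_le_trans _ ux)// ltrDl.
have -> : F (u + h) = expR (- e) * F u.
  rewrite (F_exp (addr_ge0 u0 (ltW h0))) (F_exp u0) mulrA -expRD; congr (expR _ * _).
  by rewrite /h mulrDr opprD addrC mulrCA divff ?mulr1// gt_eqF.
have := expR_ge1Dx (- e); have /andP[F0 F1'] := F1 => h1.
have : (1 - e) * F u <= expR (- e) * F u by rewrite ler_wpM2r.
have : e * F u <= e * 1 by rewrite ler_wpM2l// ltW.
by rewrite mulrBl mul1r mulr1; lra.
Qed.

Lemma nu_itv u v : 1 <= u -> u <= v ->
  nu `]u, v]%classic = (F 0 * (expR (- (beta * ln u)) - expR (- (beta * ln v))))%:E.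
Proof.
move=> u1 uv; have v1 : 1 <= v by exact: le_trans uv.
(* Also valid for x <= 0, where [ln x] is 0 by convention, because ln w >= 0. *)
have ln_lt w x : 1 <= w -> (ln w < ln x) = (w < x).
  move=> w1; have w0 : 0 < w by exact: lt_le_trans w1.
  have [x0|x0] := ltP 0 x; first by rewrite ltr_ln.
  by rewrite (ln0 x0) !ltNge ln_ge0// (le_trans x0)// ltW.
have mI : measurable (`]u, v] : set R) by exact: measurable_itv.
have -> : nu `]u, v]%classic = mu `](ln u), (ln v)]%classic.
  have itvE x : (ln u < ln x <= ln v) = (u < x <= v).
    by rewrite ln_lt// !(leNgt _ v) leNgt ln_lt// -leNgt.
  by congr (nu _); apply/seteqP; split=> x /=; rewrite !in_itv/= itvE.
have mb (w : R) : bmf (fun x : R => ind (w < x) : R).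
  by apply: bmf_bool; apply: measurable_fun_ltr => //; exact: measurable_cst.
rewrite (_ : `](ln u), (ln v)]%classic = [set x | ln u < x <= ln v]); last first.
  by apply/seteqP; split=> x /=; rewrite in_itv.
rewrite prob_Ex; last first.
  apply: measurable_and; first by apply: measurable_fun_ltr => //; exact: measurable_cst.
  by apply: measurable_fun_ler => //; exact: measurable_cst.
congr EFin; have uv' : ln u <= ln v by rewrite ler_ln// ?posrE (lt_le_trans ltr01).
transitivity (strict (ln u) - strict (ln v)).
  rewrite /strict -ExB//; apply: Ex_ext => x; case: (leP x (ln v)) => xv.
    by rewrite andbT subr0.
  by rewrite (le_lt_trans uv' xv) /= subrr.
by rewrite !strict_upper ?ln_ge0// (F_exp (ln_ge0 u1)) (F_exp (ln_ge0 v1)); ring.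
Qed.

Lemma nu_density (A : set R) : measurable A -> A `<=` `]1, +oo[ ->
  nu A = (\int[leb]_(x in A) (F 0 * beta * expR (- ((1 + beta) * ln x)))%:E)%E.
Proof.
apply: eq_density.
- apply: measurable_funM; first exact: measurable_cst.
  apply: measurableT_comp; first exact: measurable_expR.
  apply: measurableT_comp => //; apply: measurable_funM; first exact: measurable_cst.
  exact: measurable_ln.
- by move=> x; rewrite mulr_ge0 ?expR_ge0// mulr_ge0 ?upper_ge0// ltW.
move=> u v u1 uv; rewrite nu_itv//.
have u0 : 0 < u by exact: lt_le_trans u1.
pose G x := - F 0 * expR (- (beta * ln x)).
transitivity (G v - G u)%:E; first by rewrite /G; congr EFin; ring.
apply/esym/(integral_oc u0 uv).
- move=> x x0.
  have h1 : is_derive x (1 : R) (fun x => - (beta * ln x)) (- beta * x^-1).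
    rewrite (_ : (fun x => - (beta * ln x)) = - beta \*: (@ln R)); last first.
      by apply/funext => y; rewrite -mulNr.
    by have := is_deriveZ (- beta) (is_derive1_ln x0).
  have h2 : is_derive x (1 : R) (fun x => expR (- (beta * ln x)))
      (expR (- (beta * ln x)) * (- beta * x^-1)).
    exact: (is_derive1_comp (f := expR) (g := fun x => - (beta * ln x))).
  rewrite (_ : G =
      - F 0 \*: (fun x => expR (- (beta * ln x)))); last exact/funext.
  apply: is_derive_eq.
  transitivity (- F 0 * (expR (- (beta * ln x)) * (- beta * x^-1))) => //.
  have lE : expR (- ln x) = x^-1 by rewrite expRN lnK.
  by rewrite mulrDl mul1r opprD expRD lE; ring.
- move=> x x0; apply: continuousM; first exact: cst_continuous.
  apply: (@continuous_comp _ _ _ (fun x => - ((1 + beta) * ln x)) expR); last exact: continuous_expR.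
  by apply: continuousN; apply: continuousM; [exact: cst_continuous|exact: continuous_ln].
Qed.

End limit_law.

Unset Implicit Arguments.

Theorem proposition4p5 (R : realType) (am ap : R) (rho : R -> R)
  (ap_gt0 : 0 < ap) (ap_lt_am : ap < am)
  (rho_meas : measurable_fun (`[0, 1] : set R) rho)
  (rho_ge0 : forall s : R, 0 <= s <= 1 -> 0 <= rho s)
  (rho_moment : exists2 eps0 : R, 0 < eps0 &
    ((\int[lebesgue_measure]_(s in `[0%R, 1%R]) (s `^ (- eps0) * rho s)%:E)
       < +oo)%E)
  (rho_log : ap < - (\int[lebesgue_measure]_(s in `[0, 1]) (ln s * rho s)) < am)
  (d : measure_display) (T : measurableType d) (P : probability T R)
  (E S : nat -> {RV P >-> R}) (ES : compound_poisson rho E S)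
  (eta : R -> R -> T -> R) (eta_refracted : refracted am ap E S eta)
  (nu : probability (measurableTypeR R) R) (nu_inv : invariant_law P eta nu) :
  m_mass am ap P eta =
    ((am - ap) / ap * (derive1 (Psi am rho) (- 1))^-1
      * (Phi ap rho (Psi ap rho (-1)) + 1)^-1)%:E /\
  (let c1 := (fine (m_mass am ap P eta))^-1 in
   forall A : set R, measurable A -> A `<=` `]1, +oo[ ->
     nu A = (\int[lebesgue_measure]_(x in A)
               (c1 / ap * x `^ (- (1 + beta ap rho)))%:E)%E).
Proof.
have F0E := mean_positive ap_gt0 ap_lt_am ES eta_refracted nu_inv rho_meas rho_ge0 rho_log.
have b0 := beta_gt0 ap_gt0 ES rho_meas rho_ge0 rho_log.
have root := beta_root ap_gt0 ES rho_meas rho_ge0 rho_log.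
have fluxE := flux0 ap_gt0 ap_lt_am ES eta_refracted nu_inv rho_ge0 b0 root.
have /andP[k1 k2] := rho_log.
(* The bound kappa < am puts mass above level 0; hence flux(0) > 0 and the mass is finite. *)
have F0_gt0 : 0 < upper nu 0 by rewrite /upper F0E divr_gt0 ?subr_gt0.
have flux_gt0 : 0 < flux rho S nu 0 by rewrite fluxE !mulr_gt0.
have mE := mass_flux ap_gt0 ap_lt_am ES eta_refracted nu_inv rho_meas rho_ge0 flux_gt0 rho_log.
split.
  (* The mass is 1 / (ap beta F(0)) with F(0) = (am - kappa) / (am - ap). *)
  rewrite mE fluxE (Phi_beta ap_gt0 ES rho_meas rho_ge0 rho_log).
  rewrite (derive1_Psi _ rho_meas rho_ge0 rho_moment) /upper F0E; congr EFin.
  by field; rewrite !gt_eqF ?subr_gt0.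
move=> c1 A mA A1.
rewrite (nu_density ap_gt0 ap_lt_am ES eta_refracted nu_inv rho_meas rho_ge0 rho_log mA A1).
apply: eq_integral => x; rewrite inE => /A1; rewrite /= in_itv/= andbT => x1.
rewrite /c1 mE /= invrK fluxE /powR gt_eqF ?(lt_trans ltr01)// mulNr; congr EFin.
by field; rewrite gt_eqF.
Qed.
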